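(* Consider the periodic Novikov equation on $\mathbb{T}=\mathbb{R}/2\pi\mathbb{Z}$, $$\partial_t u+u^2\partial_x u=-\tfrac12(1-\partial_x^2)^{-1}\big((\partial_x u)^3\big)-\partial_x(1-\partial_x^2)^{-1}\Big(\tfrac32u(\partial_x u)^2+u^3\Big),\qquad u(0,x)=u_0(x).$$ For every sufficiently large $n\in\mathbb{Z}^+$ there exists a real-valued initial datum $u_0\in H^\infty(\mathbb{T})$ with $$\|u_0\|_{B^1_{\infty,1}(\mathbb{T})}\le \frac{1}{\log\log n}$$ such that, denoting by $u\in\mathcal{C}([0,T);H^\infty(\mathbb{T}))$ the solution of the periodic Novikov equation with initial datum $u_0$, there is a time $t_0\in\big(0,\frac{1}{\log n}\big]$ with $$\|u(t_0)\|_{B^1_{\infty,1}(\mathbb{T})}\ge \log\log n .$$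
   Context: Periodic Fourier transform: for $u$ on $\mathbb{T}$, $\widehat u(\xi)=\int_{\mathbb{T}}e^{-\mathrm{i}x\xi}u(x)\,dx$ for $\xi\in\mathbb{Z}$, and $u(x)=\frac1{2\pi}\sum_{\xi\in\mathbb{Z}}\widehat u(\xi)e^{\mathrm{i}x\xi}$. Fix a smooth function $\chi$ supported in the ball of radius $4/3$ and equal to $1$ on the ball of radius $3/4$; set $\varphi(\xi)=\chi(\xi/2)-\chi(\xi)$ and $\varphi_j(\xi)=\varphi(2^{-j}\xi)$. Periodic dyadic blocks: $\Delta_j u=0$ for $j\le -2$, $\Delta_{-1}u=\frac1{2\pi}\sum_{\xi\in\mathbb{Z}}\chi(\xi)\widehat u(\xi)e^{\mathrm{i}x\xi}$, and $\Delta_j u=\frac1{2\pi}\sum_{\xi\in\mathbb{Z}}\varphi_j(\xi)\widehat u(\xi)e^{\mathrm{i}x\xi}$ for $j\ge0$. The Besov norm is $\|f\|_{B^s_{p,r}(\mathbb{T})}=\big(\sum_{j\ge-1}2^{sjr}\|\Delta_jf\|^r_{L^p(\mathbb{T})}\big)^{1/r}$ for $r<\infty$; in particular $\|f\|_{B^1_{\infty,1}(\mathbb{T})}=\sum_{j\ge-1}2^j\|\Delta_jf\|_{L^\infty(\mathbb{T})}$. *)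

(* Defs.v *)
From Stdlib Require Import Reals.
From Coquelicot Require Import Coquelicot.
Open Scope R_scope.

(** Functions on the torus T = R/2piZ are represented as 2pi-periodic functions R -> R. *)
Definition periodic2pi (f : R -> R) : Prop := forall x, f (x + 2 * PI) = f x.

Definition smooth (f : R -> R) : Prop :=
  forall (k : nat) (x : R), ex_derive (Derive_n f k) x.

Definition H_infty (f : R -> R) : Prop := periodic2pi f /\ smooth f.

Definition fourier_re (u : R -> R) (xi : R) : R :=
  RInt (fun x => cos (x * xi) * u x) 0 (2 * PI).
Definition fourier_im (u : R -> R) (xi : R) : R :=
  - RInt (fun x => sin (x * xi) * u x) 0 (2 * PI).

(** Littlewood-Paley weights.  Block index k : nat stands for j = k - 1 >= -1:
    k = 0 : chi(xi)   (Delta_{-1});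
    k = k'+1 : phi_{k'}(xi) = chi(2^{-k'} xi / 2) - chi(2^{-k'} xi). *)
Definition lp_weight (chi : R -> R) (k : nat) (xi : R) : R :=
  match k with
  | O => chi xi
  | S k' => chi (xi / 2 ^ (S k')) - chi (xi / 2 ^ k')
  end.

(** Delta_{k-1} u (x) = (1/2pi) sum_{xi in Z} w_k(xi) \hat u(xi) e^{i x xi}.
    Since chi vanishes outside [-4/3,4/3], w_k(xi) = 0 whenever |xi| > 2^(k+1),
    so the sum over Z equals the finite sum over xi = -2^(k+1) .. 2^(k+1)
    (xi = i - 2^(k+1), i = 0 .. 2^(k+2)).  Real and imaginary parts: *)
Definition block_re (chi : R -> R) (k : nat) (u : R -> R) (x : R) : R :=
  / (2 * PI) *
  sum_f_R0 (fun i => let xi := INR i - 2 ^ (S k) in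
     lp_weight chi k xi *
     (fourier_re u xi * cos (x * xi) - fourier_im u xi * sin (x * xi)))
    (2 ^ (S (S k)))%nat.
Definition block_im (chi : R -> R) (k : nat) (u : R -> R) (x : R) : R :=
  / (2 * PI) *
  sum_f_R0 (fun i => let xi := INR i - 2 ^ (S k) in
     lp_weight chi k xi *
     (fourier_re u xi * sin (x * xi) + fourier_im u xi * cos (x * xi)))
    (2 ^ (S (S k)))%nat.

(** || Delta_{k-1} u ||_{L^infty(T)} (the block is continuous, so the sup of the
    complex modulus over x). *)
Definition block_Linf (chi : R -> R) (k : nat) (u : R -> R) : Rbar :=
  Lub_Rbar (fun r => exists x, r = sqrt (block_re chi k u x ^ 2 + block_im chi k u x ^ 2)).

Fixpoint besov_partial (chi : R -> R) (u : R -> R) (N : nat) : Rbar :=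
  match N with
  | O => Finite 0
  | S N' => Rbar_plus (besov_partial chi u N')
                      (Rbar_mult (Finite (2 ^ N' / 2)) (block_Linf chi N' u))
  end.

Definition besov_B1inf1 (chi : R -> R) (u : R -> R) : Rbar :=
  Sup_seq (besov_partial chi u).

(** Periodic Green function of (1 - d_x^2) on T:
    G(z) = cosh(z' - pi) / (2 sinh pi), z' = z mod 2pi in [0, 2pi). *)
Definition green (z : R) : R :=
  let z' := z - 2 * PI * IZR (floor (z / (2 * PI))) in
  cosh (z' - PI) / (2 * sinh PI).

(** (1 - d_x^2)^{-1} f = G * f  (convolution on T). *)
Definition Linv (f : R -> R) (x : R) : R :=
  RInt (fun y => green (x - y) * f y) 0 (2 * PI).

Definition novikov_rhs (v : R -> R) (x : R) : R :=
  - (v x) ^ 2 * Derive v x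
  - / 2 * Linv (fun y => (Derive v y) ^ 3) x
  - Derive (Linv (fun y => 3 / 2 * v y * (Derive v y) ^ 2 + (v y) ^ 3)) x.

(** u (written u t x) is a solution in C([0,T); H^infty(T)) of the periodic Novikov
    equation with initial datum u0:
    - each u(t) is in H^infty(T);
    - every spatial derivative d_x^k u is jointly continuous on [0,T) x R
      (equivalent, by periodicity and Sobolev embedding, to u in C([0,T);H^infty));
    - u(0) = u0;
    - the equation holds pointwise for 0 < t < T. *)
Definition novikov_solution (T : R) (u0 : R -> R) (u : R -> R -> R) : Prop :=
  (forall t, 0 <= t < T -> H_infty (u t)) /\
  (forall (k : nat) t x, 0 <= t < T ->
     forall eps, 0 < eps -> exists delta, 0 < delta /\
       forall s y, 0 <= s < T -> Rabs (s - t) < delta -> Rabs (y - x) < delta ->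
         Rabs (Derive_n (u s) k y - Derive_n (u t) k x) < eps) /\
  (forall x, u 0 x = u0 x) /\
  (forall t x, 0 < t < T -> is_derive (fun s => u s x) t (novikov_rhs (u t) x)).

(* Main.v *)
Require Import Defs.
From Stdlib Require Import Reals Lra Lia Psatz ZArith Classical ClassicalEpsilon.
From Coquelicot Require Import Coquelicot.
Open Scope R_scope.

(** In Lagrangian coordinates, with [eta_t = u^2], [q = eta_x] and [w = (u o eta)_x], the Novikov
    equation is an ODE in a space of continuous functions that is locally Lipschitz uniformly over data
    of size 1 in C^1, so the lifespan does not depend on the high frequencies of the datum.

    The slope [v = u_x] satisfies [v_t + (u^2 v)_x = 3/2 u v^2] up to terms that are Lipschitz in space.
    The datum is [a + (b/lam) sin (lam x) (1 + S)], with [S] a Fejer mean of the sawtooth: its spectrum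
    sits in one dyadic block, so its norm is small, but squaring the slope demodulates it and produces
    the low frequency profile [b^2/2 (1 + S)^2], a smoothed jump having comparable amplitude in each of
    [N] dyadic blocks.  Hence [u v^2] has B^0_{oo,1} norm of order [N].

    This is detected by pairing [v] with a kernel that sums one bump per block, behaves like a truncated
    Hilbert kernel, and is carried by the flow: its weighted integrals grow at most linearly in [N] and
    are insensitive to the distortion by the flow, while the norm of [u] controls the pairing. Choosing
    first [N] large and then [lam] large depending on [N] gives the growth. *)

(** * Continuity, derivatives and integrals of real functions *)

(** The rate of gain is of order [a * b ^ 2 * N] with [a = b] of order [1 / ln (ln n)], so a loss
    proportional to [N] is affordable only with a further factor [t]; every other loss must be
    bounded independently of [N]. The main pairing moves by [O(N * t)]. The Lipschitz terms lose
    [O(1)] because the kernel is odd: the value at its centre can be subtracted, and the resulting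
    factor [|y|] makes the sum over blocks geometric. The obstacle is the motion of the kernel. Its
    centre follows the particle labelled 0, so its argument changes at the rate [U ^ 2 - U(0) ^ 2],
    but estimating this directly still loses [O(N)] without a factor [t]. Instead
    [w * (U ^ 2 - U(0) ^ 2)] is written as the derivative of a function quadratic in [U - U(0)], an
    increment that starts at [O(1 / lam)] and then grows at most like [t * |x|]. The constant [a] is
    present because [u], and with it [u * v ^ 2], would otherwise be [O(1 / lam)]. The 1 in [1 + S]
    is present because [S ^ 2] is even, so that an odd kernel sees only the cross term [2 * S]. *)

Definition cont1 (f : R -> R) : Prop := forall x, continuous f x.
Definition cont2 (f : R -> R -> R) : Prop := forall t x, continuity_2d_pt f t x.

Lemma cont1_ext f g : (forall x, f x = g x) -> cont1 f -> cont1 g.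
Proof. intros H Hf x. apply continuous_ext with f; [exact H|apply Hf]. Qed.

Lemma der_eq (f : R -> R) (x l l' : R) : is_derive f x l -> l = l' -> is_derive f x l'.
Proof. intros H E. rewrite <- E. exact H. Qed.
Lemma der_ext (f g : R -> R) (x l : R) : (forall y, f y = g y) -> is_derive f x l -> is_derive g x l.
Proof. intros H Hf. apply is_derive_ext with f; trivial. Qed.
Lemma der_const (c x : R) : is_derive (fun _ : R => c) x 0.
Proof. apply (is_derive_const (K := R_AbsRing) (V := R_NormedModule)). Qed.
Lemma der_id (x : R) : is_derive (fun y : R => y) x 1.
Proof. apply (is_derive_id (K := R_AbsRing)). Qed.
Lemma der_plus (f g : R -> R) (x a b : R) : is_derive f x a -> is_derive g x b ->
  is_derive (fun y => f y + g y) x (a + b).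
Proof. apply (is_derive_plus (K := R_AbsRing) (V := R_NormedModule)). Qed.
Lemma der_minus (f g : R -> R) (x a b : R) : is_derive f x a -> is_derive g x b ->
  is_derive (fun y => f y - g y) x (a - b).
Proof. apply (is_derive_minus (K := R_AbsRing) (V := R_NormedModule)). Qed.
Lemma der_opp (f : R -> R) (x a : R) : is_derive f x a -> is_derive (fun y => - f y) x (- a).
Proof. apply (is_derive_opp (K := R_AbsRing) (V := R_NormedModule)). Qed.
Lemma der_mult (f g : R -> R) (x a b : R) : is_derive f x a -> is_derive g x b ->
  is_derive (fun y => f y * g y) x (a * g x + f x * b).
Proof. intros. apply (is_derive_mult (K := R_AbsRing) f g x a b); trivial. intros; apply Rmult_comm. Qed.
Lemma der_scal (c : R) (f : R -> R) (x a : R) : is_derive f x a -> is_derive (fun y => c * f y) x (c * a).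
Proof. intros. eapply der_eq; [apply der_mult; [apply der_const|eassumption]|cbv beta; ring]. Qed.
Lemma der_comp (f g : R -> R) (x a b : R) : is_derive f (g x) a -> is_derive g x b ->
  is_derive (fun y => f (g y)) x (a * b).
Proof. intros Hf Hg. eapply der_eq; [apply (is_derive_comp (K := R_AbsRing) (V := R_NormedModule) f g x a b Hf Hg)|apply Rmult_comm]. Qed.
Lemma der_exp (f : R -> R) (x a : R) : is_derive f x a -> is_derive (fun y => exp (f y)) x (exp (f x) * a).
Proof. intro H. apply (der_comp exp); trivial. apply is_derive_exp. Qed.
Lemma der_sin (f : R -> R) (x a : R) : is_derive f x a -> is_derive (fun y => sin (f y)) x (cos (f x) * a).
Proof. intro H. apply (der_comp sin); trivial. apply is_derive_sin. Qed.
Lemma der_cos (f : R -> R) (x a : R) : is_derive f x a -> is_derive (fun y => cos (f y)) x (- sin (f x) * a).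
Proof. intro H. apply (der_comp cos); trivial. apply is_derive_cos. Qed.
Lemma der_inv (f : R -> R) (x a : R) : is_derive f x a -> f x <> 0 -> is_derive (fun y => / f y) x (- a / f x ^ 2).
Proof. intros H H0. apply (is_derive_inv f x a); trivial. Qed.
Lemma der_div (f g : R -> R) (x a b : R) : is_derive f x a -> is_derive g x b -> g x <> 0 ->
  is_derive (fun y => f y / g y) x (a / g x - f x * b / g x ^ 2).
Proof. intros Hf Hg H0. apply der_eq with (a * / g x + f x * (- b / g x ^ 2)); [apply (der_mult f (fun y => / g y)); [exact Hf|apply der_inv; trivial]|field; trivial]. Qed.
Lemma der_pow (f : R -> R) n (x a : R) : is_derive f x a ->
  is_derive (fun y => f y ^ n) x (INR n * a * f x ^ pred n).
Proof. intro H. apply (is_derive_pow f n x a H). Qed.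

Lemma cont1_derive (f g : R -> R) : (forall x, is_derive f x (g x)) -> cont1 f.
Proof. intros H x. apply (ex_derive_continuous (K := R_AbsRing) (V := R_NormedModule) f x). exists (g x). apply H. Qed.

Lemma cont1_const c : cont1 (fun _ => c).
Proof. intro x. apply continuous_const. Qed.
Lemma cont1_id : cont1 (fun x => x).
Proof. intro x. apply continuous_id. Qed.
Lemma cont1_plus f g : cont1 f -> cont1 g -> cont1 (fun x => f x + g x).
Proof. intros Hf Hg x. apply (continuous_plus f g); auto. Qed.
Lemma cont1_minus f g : cont1 f -> cont1 g -> cont1 (fun x => f x - g x).
Proof. intros Hf Hg x. apply (continuous_minus f g); auto. Qed.
Lemma cont1_opp f : cont1 f -> cont1 (fun x => - f x).
Proof. intros Hf x. apply (continuous_opp f); auto. Qed.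
Lemma cont1_mult f g : cont1 f -> cont1 g -> cont1 (fun x => f x * g x).
Proof. intros Hf Hg x. apply (continuous_mult f g); auto. Qed.
Lemma cont1_comp f g : cont1 g -> cont1 f -> cont1 (fun x => f (g x)).
Proof. intros Hg Hf x. apply (continuous_comp g f); auto. Qed.
Lemma cont1_exp f : cont1 f -> cont1 (fun x => exp (f x)).
Proof. intro H. apply (cont1_comp exp); trivial. apply cont1_derive with exp. apply is_derive_exp. Qed.
Lemma cont1_sin f : cont1 f -> cont1 (fun x => sin (f x)).
Proof. intro H. apply (cont1_comp sin); trivial. apply cont1_derive with cos. apply is_derive_sin. Qed.
Lemma cont1_cos f : cont1 f -> cont1 (fun x => cos (f x)).
Proof. intro H. apply (cont1_comp cos); trivial. apply cont1_derive with (fun x => - sin x). apply is_derive_cos. Qed.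
Lemma cont1_pow f n : cont1 f -> cont1 (fun x => f x ^ n).
Proof.
  intro H; induction n; simpl; [apply cont1_const|apply (cont1_mult f); auto].
Qed.
Lemma cont1_inv f : cont1 f -> (forall x, f x <> 0) -> cont1 (fun x => / f x).
Proof. intros Hf H x. apply (continuous_comp f Rinv); [apply Hf|].
  apply (ex_derive_continuous (K := R_AbsRing) (V := R_NormedModule) Rinv (f x)). auto_derive; auto. Qed.
Lemma cont1_div f g : cont1 f -> cont1 g -> (forall x, g x <> 0) -> cont1 (fun x => f x / g x).
Proof. intros; apply cont1_mult; trivial; apply cont1_inv; trivial. Qed.
Lemma cont1_abs f : cont1 f -> cont1 (fun x => Rabs (f x)).
Proof. intros H x. apply (continuous_comp f Rabs); [apply H|apply (continuous_abs (f x))]. Qed.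

#[export] Hint Resolve cont1_const cont1_id cont1_plus cont1_minus cont1_opp cont1_mult cont1_exp cont1_sin cont1_cos cont1_pow cont1_abs : cont.

Lemma cont2_ext f g : (forall t x, f t x = g t x) -> cont2 f -> cont2 g.
Proof. intros H Hf t x. apply continuity_2d_pt_ext with f; [exact H|apply Hf]. Qed.
Lemma cont2_const c : cont2 (fun _ _ => c).
Proof. intros t x. apply continuity_2d_pt_const. Qed.
Lemma cont2_fst : cont2 (fun t _ => t).
Proof. intros t x. apply continuity_2d_pt_id1. Qed.
Lemma cont2_snd : cont2 (fun _ x => x).
Proof. intros t x. apply continuity_2d_pt_id2. Qed.
Lemma cont2_plus f g : cont2 f -> cont2 g -> cont2 (fun t x => f t x + g t x).
Proof. intros Hf Hg t x. apply continuity_2d_pt_plus; auto. Qed.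
Lemma cont2_minus f g : cont2 f -> cont2 g -> cont2 (fun t x => f t x - g t x).
Proof. intros Hf Hg t x. apply continuity_2d_pt_minus; auto. Qed.
Lemma cont2_opp f : cont2 f -> cont2 (fun t x => - f t x).
Proof. intros Hf t x. apply continuity_2d_pt_opp; auto. Qed.
Lemma cont2_mult f g : cont2 f -> cont2 g -> cont2 (fun t x => f t x * g t x).
Proof. intros Hf Hg t x. apply continuity_2d_pt_mult; auto. Qed.
Lemma cont2_comp1 f g : cont1 f -> cont2 g -> cont2 (fun t x => f (g t x)).
Proof. intros Hf Hg t x. apply (continuity_1d_2d_pt_comp f g); auto.
  apply continuity_pt_filterlim. apply Hf. Qed.
Lemma cont2_exp f : cont2 f -> cont2 (fun t x => exp (f t x)).
Proof. apply (cont2_comp1 exp). apply cont1_derive with exp. apply is_derive_exp. Qed.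
Lemma cont2_pow f n : cont2 f -> cont2 (fun t x => f t x ^ n).
Proof. intro H; induction n; simpl; [apply cont2_const|apply (cont2_mult f); auto]. Qed.
Lemma cont2_inv f : cont2 f -> (forall t x, f t x <> 0) -> cont2 (fun t x => / f t x).
Proof. intros Hf H t x. apply continuity_2d_pt_inv; auto. Qed.
Lemma cont2_div f g : cont2 f -> cont2 g -> (forall t x, g t x <> 0) -> cont2 (fun t x => f t x / g t x).
Proof. intros; apply cont2_mult; trivial; apply cont2_inv; trivial. Qed.

Lemma cont2_comp f g h : cont2 f -> cont2 g -> cont2 h -> cont2 (fun t x => f (g t x) (h t x)).
Proof.
  intros Hf Hg Hh t x eps.
  destruct (Hf (g t x) (h t x) eps) as [d Hd].
  generalize (Hg t x d) (Hh t x d). unfold locally_2d.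
  intros [d1 H1] [d2 H2].
  exists (mkposreal (Rmin d1 d2) (Rmin_pos _ _ (cond_pos d1) (cond_pos d2))).
  simpl. intros u v Hu Hv.
  apply Hd; [apply H1|apply H2];
    (eapply Rlt_le_trans; [eassumption|]); (apply Rmin_l || apply Rmin_r).
Qed.

Lemma cont2_slice_x f t : cont2 f -> cont1 (f t).
Proof.
  intros H x. apply continuity_pt_filterlim. apply continuity_pt_locally.
  intro eps. destruct (H t x eps) as [d Hd]. exists d. intros y Hy.
  apply Hd; [rewrite Rminus_diag, Rabs_R0; apply cond_pos|exact Hy].
Qed.
Lemma cont2_slice_t f x : cont2 f -> cont1 (fun t => f t x).
Proof.
  intros H t. apply continuity_pt_filterlim. apply continuity_pt_locally.
  intro eps. destruct (H t x eps) as [d Hd]. exists d. intros y Hy.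
  apply Hd; [exact Hy|rewrite Rminus_diag, Rabs_R0; apply cond_pos].
Qed.
Lemma cont2_swap f : cont2 f -> cont2 (fun t x => f x t).
Proof. intros H. apply (cont2_comp f (fun t x => x) (fun t x => t)); auto using cont2_fst, cont2_snd. Qed.

#[export] Hint Resolve cont2_const cont2_fst cont2_snd cont2_plus cont2_minus cont2_opp cont2_mult cont2_exp cont2_pow cont2_slice_x cont2_slice_t : cont.

(** * Integrals of continuous functions *)

Lemma ex_rint (f : R -> R) a b : cont1 f -> ex_RInt f a b.
Proof. intro H. apply (ex_RInt_continuous (V := R_CompleteNormedModule)). intros; apply H. Qed.

Lemma rint_ext (f g : R -> R) a b : (forall x, f x = g x) -> RInt f a b = RInt g a b.
Proof. intro H. apply RInt_ext. intros; apply H. Qed.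

Lemma rint_plus (f g : R -> R) a b : cont1 f -> cont1 g -> RInt (fun x => f x + g x) a b = RInt f a b + RInt g a b.
Proof. intros. apply (RInt_plus (V := R_CompleteNormedModule) f g); apply ex_rint; trivial. Qed.
Lemma rint_minus (f g : R -> R) a b : cont1 f -> cont1 g -> RInt (fun x => f x - g x) a b = RInt f a b - RInt g a b.
Proof. intros. apply (RInt_minus (V := R_CompleteNormedModule) f g); apply ex_rint; trivial. Qed.
Lemma rint_opp (f : R -> R) a b : cont1 f -> RInt (fun x => - f x) a b = - RInt f a b.
Proof. intros. apply (RInt_opp (V := R_CompleteNormedModule) f); apply ex_rint; trivial. Qed.
Lemma rint_scal c (f : R -> R) a b : cont1 f -> RInt (fun x => c * f x) a b = c * RInt f a b.
Proof. intros. apply (RInt_scal (V := R_CompleteNormedModule) f a b c); apply ex_rint; trivial. Qed.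
Lemma rint_chasles (f : R -> R) a b c : cont1 f -> RInt f a b + RInt f b c = RInt f a c.
Proof. intros. apply (RInt_Chasles (V := R_CompleteNormedModule) f a b c); apply ex_rint; trivial. Qed.
Lemma rint_swap (f : R -> R) a b : cont1 f -> RInt f a b = - RInt f b a.
Proof. intro H. generalize (rint_chasles f a b a H). rewrite RInt_point.
  change (zero : R) with 0. lra. Qed.
Lemma rint_point (f : R -> R) a : RInt f a a = 0.
Proof. apply (RInt_point (V := R_CompleteNormedModule)). Qed.
Lemma rint_const (c a b : R) : RInt (fun _ => c) a b = (b - a) * c.
Proof. apply (RInt_const (V := R_CompleteNormedModule)). Qed.
Lemma rint_le (f g : R -> R) a b : a <= b -> cont1 f -> cont1 g -> (forall x, a <= x <= b -> f x <= g x) ->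
  RInt f a b <= RInt g a b.
Proof. intros. apply RInt_le; auto using ex_rint. intros; apply H2; lra. Qed.
Lemma rint_ftc (F f : R -> R) a b : (forall x, is_derive F x (f x)) -> cont1 f -> RInt f a b = F b - F a.
Proof.
  intros H Hc. apply is_RInt_unique. apply (is_RInt_derive F f); intros; [apply H|apply Hc].
Qed.
Lemma rint_derive (f : R -> R) a x : cont1 f -> is_derive (fun y => RInt f a y) x (f x).
Proof.
  intro H. apply (is_derive_RInt f (fun y => RInt f a y) a x).
  - exists (mkposreal 1 Rlt_0_1). intros y _. apply (RInt_correct (V := R_CompleteNormedModule) f a y). apply ex_rint; trivial.
  - apply H.
Qed.
Lemma rint_abs_le (f g : R -> R) a b : a <= b -> cont1 f -> cont1 g -> (forall x, a <= x <= b -> Rabs (f x) <= g x) ->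
  Rabs (RInt f a b) <= RInt g a b.
Proof.
  intros Hab Hf Hg H. apply Rabs_le. split.
  - rewrite <- rint_opp by trivial. apply rint_le; auto 20 with cont.
    intros x Hx. generalize (H x Hx). intro Hh. apply Rabs_le_between in Hh. lra.
  - apply rint_le; auto. intros x Hx. generalize (H x Hx). intro Hh. apply Rabs_le_between in Hh. lra.
Qed.
Lemma rint_bound (f : R -> R) a b C : cont1 f -> (forall x, Rmin a b <= x <= Rmax a b -> Rabs (f x) <= C) ->
  Rabs (RInt f a b) <= C * Rabs (b - a).
Proof.
  intros Hf H. destruct (Rle_dec a b) as [h|h].
  - rewrite (Rabs_pos_eq (b - a)) by lra.
    rewrite Rmin_left, Rmax_right in H by lra.
    rewrite Rmult_comm, <- (rint_const C a b).
    apply rint_abs_le; auto 20 with cont.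
  - assert (h' : b <= a) by lra. rewrite rint_swap, Rabs_Ropp by trivial.
    rewrite Rmin_right, Rmax_left in H by lra.
    rewrite (Rabs_left1 (b - a)) by lra.
    replace (C * - (b - a)) with ((a - b) * C) by ring. rewrite <- (rint_const C b a).
    apply rint_abs_le; auto 20 with cont.
Qed.
Lemma rint_subst (f g dg : R -> R) a b : cont1 f -> (forall x, is_derive g x (dg x)) -> cont1 dg ->
  RInt (fun x => dg x * f (g x)) a b = RInt f (g a) (g b).
Proof.
  intros Hf Hg Hdg. apply (RInt_comp (V := R_CompleteNormedModule) f g dg a b).
  - intros; apply Hf. - intros; split; [apply Hg|apply Hdg].
Qed.
Lemma rint_parts (f g f' g' : R -> R) a b : (forall x, is_derive f x (f' x)) -> (forall x, is_derive g x (g' x)) ->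
  cont1 f' -> cont1 g' ->
  RInt (fun x => f' x * g x) a b = f b * g b - f a * g a - RInt (fun x => f x * g' x) a b.
Proof.
  intros Hf Hg Cf Cg.
  assert (Cf0 := cont1_derive _ _ Hf). assert (Cg0 := cont1_derive _ _ Hg).
  assert (E : RInt (fun x => f' x * g x + f x * g' x) a b = f b * g b - f a * g a).
  { apply (rint_ftc (fun x => f x * g x)); auto 20 with cont.
    intro x. apply der_mult; auto. }
  rewrite rint_plus in E by auto 20 with cont. lra.
Qed.

Lemma period_shift (f : R -> R) p a b : cont1 f -> (forall x, f (x + p) = f x) -> RInt f a (a + p) = RInt f b (b + p).
Proof.
  intros Hf Hp.
  assert (E : RInt f (a + p) (b + p) = RInt f a b).
  { rewrite <- (rint_subst f (fun x => x + p) (fun _ => 1)); auto 20 with cont.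
    - apply rint_ext. intro; rewrite Hp; ring.
    - intro; eapply der_eq; [apply der_plus; [apply der_id|apply der_const]|cbv beta; ring]. }
  generalize (rint_chasles f a b (b + p) Hf) (rint_chasles f a (a + p) (b + p) Hf). lra.
Qed.

Lemma periodic_bounded (f : R -> R) p : 0 < p -> cont1 f -> (forall x, f (x + p) = f x) ->
  exists C, 0 <= C /\ forall x, Rabs (f x) <= C.
Proof.
  intros Hp Hf Hper.
  destruct (continuity_ab_maj (fun x => Rabs (f x)) 0 p) as [M [HM _]]; [lra| |].
  { intros c _. apply continuity_pt_filterlim. apply (cont1_abs f Hf). }
  exists (Rabs (f M)). split; [apply Rabs_pos|]. intro x.
  assert (Hn : forall n : nat, forall y, f (y + INR n * p) = f y).
  { induction n; intro y; [simpl; f_equal; ring|].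
    rewrite S_INR, <- (IHn y), <- (Hper (y + INR n * p)). f_equal; ring. }
  assert (Hz : forall z : Z, forall y, f (y + IZR z * p) = f y).
  { intros z y. destruct (Z_le_gt_dec 0 z) as [h|h].
    - rewrite <- (Z2Nat.id z) by lia. rewrite <- INR_IZR_INZ. apply Hn.
    - rewrite <- (Hn (Z.to_nat (- z)) (y + IZR z * p)). f_equal.
      rewrite INR_IZR_INZ, Z2Nat.id, opp_IZR by lia. ring. }
  set (z := floor (x / p)).
  assert (F := proj2_sig (floor_ex (x / p))). fold z in F. 
  change (IZR z <= x / p < IZR z + 1) in F.
  rewrite <- (Hz (- z)%Z x). apply (HM (x + IZR (- z) * p)). rewrite opp_IZR.
  assert (x = x / p * p) by (field; lra).
  split; nra.
Qed.

(** The increment splits into a change of integrand, controlled by uniform continuity of [h] near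
    the segment of times [[- A, A]] at [x], and a change of the upper limit, controlled by the
    maximum of the slice at [x]. *)
Lemma cont2_int_t h : cont2 h -> cont2 (fun t x => RInt (fun s => h s x) 0 t).
Proof.
  intros Hh t x eps.
  set (A := Rabs t + 1).
  assert (HA : 0 < A) by (unfold A; generalize (Rabs_pos t); lra).
  assert (He : 0 < eps / (2 * A)) by (apply Rdiv_lt_0_compat; [apply cond_pos|lra]).
  destruct (uniform_continuity_2d_1d h (- A) A x (fun y _ => Hh y x) (mkposreal _ He)) as [d Hd].
  simpl in Hd.
  destruct (continuity_ab_maj (fun s => Rabs (h s x)) (- A) A) as [M [HM _]]; [lra| |].
  { intros c _. apply continuity_pt_filterlim. apply (cont1_abs (fun s => h s x)). auto 20 with cont. }
  set (B := Rabs (h M x) + 1). assert (HB : 1 <= B) by (unfold B; generalize (Rabs_pos (h M x)); lra).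
  assert (Hmin : 0 < Rmin (Rmin d 1) (eps / (2 * B))).
  { repeat apply Rmin_pos; [apply cond_pos|lra|apply Rdiv_lt_0_compat; [apply cond_pos|lra]]. }
  exists (mkposreal _ Hmin). simpl. intros u v Hu Hv.
  assert (Hu1 : Rabs (u - t) < 1) by (eapply Rlt_le_trans; [exact Hu|]; eapply Rle_trans; [apply Rmin_l|apply Rmin_r]).
  assert (Hu2 : Rabs (u - t) < eps / (2 * B)) by (eapply Rlt_le_trans; [exact Hu|]; apply Rmin_r).
  assert (Hv1 : Rabs (v - x) < d) by (eapply Rlt_le_trans; [exact Hv|]; eapply Rle_trans; [apply Rmin_l|apply Rmin_l]).
  assert (HuA : Rabs u <= A).
  { unfold A. replace u with ((u - t) + t) by ring. eapply Rle_trans; [apply Rabs_triang|]. lra. }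
  assert (HtA : Rabs t <= A) by (unfold A; lra).
  assert (C1x : forall y, cont1 (fun s => h s y)) by (intro; auto 20 with cont).
  rewrite <- (rint_chasles (fun s => h s x) 0 u t) by auto.
  assert (E1 : Rabs (RInt (fun s => h s v) 0 u - RInt (fun s => h s x) 0 u) <= eps / (2 * A) * Rabs (u - 0)).
  { rewrite <- rint_minus by auto. apply rint_bound; auto 20 with cont. intros s Hs.
    apply Rlt_le. apply Hd.
    - unfold Rmin, Rmax in Hs; destruct (Rle_dec 0 u); apply Rabs_le_between in HuA; lra.
    - generalize (cond_pos d); lra.
    - unfold Rmin, Rmax in Hs; destruct (Rle_dec 0 u); apply Rabs_le_between in HuA; lra.
    - apply Rabs_lt_between in Hv1; lra.
    - rewrite Rminus_diag, Rabs_R0; apply cond_pos. }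
  assert (E2 : Rabs (RInt (fun s => h s x) u t) <= (B - 1) * Rabs (t - u)).
  { apply rint_bound; auto. intros s Hs. unfold B. ring_simplify (Rabs (h M x) + 1 - 1).
    apply HM. unfold Rmin, Rmax in Hs. apply Rabs_le_between in HuA. apply Rabs_le_between in HtA.
    destruct (Rle_dec u t); lra. }
  rewrite Rminus_0_r in E1.
  assert (E3 : eps / (2 * A) * Rabs u <= eps / 2).
  { apply Rle_trans with (eps / (2 * A) * A); [apply Rmult_le_compat_l; lra|]. right; field; lra. }
  assert (E4 : (B - 1) * Rabs (t - u) < eps / 2).
  { rewrite Rabs_minus_sym. apply Rle_lt_trans with (B * Rabs (u - t)).
    - apply Rmult_le_compat_r; [apply Rabs_pos|lra].
    - apply Rlt_le_trans with (B * (eps / (2 * B))); [apply Rmult_lt_compat_l; lra|]. right; field; lra. }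
  replace (RInt (fun s => h s v) 0 u - (RInt (fun s => h s x) 0 u + RInt (fun s => h s x) u t))
    with ((RInt (fun s => h s v) 0 u - RInt (fun s => h s x) 0 u) + - RInt (fun s => h s x) u t) by ring.
  eapply Rle_lt_trans; [apply Rabs_triang|]. rewrite Rabs_Ropp. lra.
Qed.

Lemma cont1_int_param h a b : cont2 h -> cont1 (fun x => RInt (fun s => h s x) a b).
Proof.
  intro H. apply cont1_ext with (fun x => RInt (fun s => h s x) 0 b - RInt (fun s => h s x) 0 a).
  - intro x. rewrite <- (rint_chasles (fun s => h s x) 0 a b) by auto 20 with cont. ring.
  - apply cont1_minus; [apply (cont2_slice_x _ b (cont2_int_t h H))|apply (cont2_slice_x _ a (cont2_int_t h H))].
Qed.

Lemma rint_param_derive (h h' : R -> R -> R) a b : (forall s x, is_derive (h s) x (h' s x)) -> cont2 h' ->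
  (forall x, cont1 (fun s => h s x)) ->
  forall x, is_derive (fun x => RInt (fun s => h s x) a b) x (RInt (fun s => h' s x) a b).
Proof.
  intros Hd Hc Hs x.
  rewrite <- (rint_ext (fun s => Derive (h s) x)) by (intro; apply is_derive_unique; apply Hd).
  apply (is_derive_RInt_param (fun x s => h s x) a b x).
  - exists (mkposreal 1 Rlt_0_1). intros y _ s _. exists (h' s y). apply Hd.
  - intros s _. apply continuity_2d_pt_ext with (fun x s => h' s x).
    + intros y z. symmetry. apply is_derive_unique. apply Hd.
    + apply (cont2_swap h' Hc).
  - exists (mkposreal 1 Rlt_0_1). intros y _. apply ex_rint. apply Hs.
Qed.

(* [ring] reads the carrier off the left-hand side; a bare [RInt] has a Coquelicot structure as type. *)
Ltac rring := apply (Rplus_eq_reg_l 0); ring.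
Ltac rfield := apply (Rplus_eq_reg_l 0); field.

(** * The Lagrangian vector field *)

Lemma exp_le x y : x <= y -> exp x <= exp y.
Proof. intros [H|H]; [left; apply exp_increasing; trivial|rewrite H; right; trivial]. Qed.

Lemma sinh_PI_pos : 0 < sinh PI.
Proof.
  unfold sinh. assert (exp (- PI) < exp PI) by (apply exp_increasing; generalize PI_RGT_0; lra). lra.
Qed.

(** This integrates [exp (s * (x - z)) * f z] over the last period; [s = 1] and [s = -1] give the
    two exponential pieces of the periodic Green function. The factor [exp (s * x)] is pulled out so
    that [x] enters the integral only through its limits. *)
Definition conv (s : R) (f : R -> R) (x : R) : R :=
  exp (s * x) * RInt (fun z => exp (- (s * z)) * f z) (x - 2 * PI) x.

Lemma conv_derive s f x : cont1 f ->
  is_derive (conv s f) x (s * conv s f x + f x - exp (2 * PI * s) * f (x - 2 * PI)).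
Proof.
  intro Hf. unfold conv.
  assert (Hg : cont1 (fun z => exp (- (s * z)) * f z)) by auto 20 with cont.
  set (g := fun z => exp (- (s * z)) * f z) in *.
  assert (D : is_derive (fun x => RInt g (x - 2 * PI) x) x (g x - g (x - 2 * PI))).
  { apply der_ext with (fun x => RInt g 0 x - RInt g 0 (x - 2 * PI)).
    - intro y. rewrite <- (rint_chasles g 0 (y - 2 * PI) y); trivial. ring.
    - apply der_minus; [apply rint_derive; trivial|].
      eapply der_eq; [apply (der_comp (RInt g 0)); [apply rint_derive; trivial|
        apply der_minus; [apply der_id|apply der_const]]|cbv beta; ring]. }
  eapply der_eq; [apply der_mult; [apply der_exp; apply der_scal; apply der_id|exact D]|].
  cbv beta. unfold g.
  replace (exp (2 * PI * s)) with (exp (s * x) * exp (- (s * (x - 2 * PI))))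
    by (rewrite <- exp_plus; f_equal; ring).
  assert (E : exp (s * x) * exp (- (s * x)) = 1) by (rewrite <- exp_plus, <- exp_0; f_equal; ring).
  replace (f x) with (exp (s * x) * exp (- (s * x)) * f x) at 2 by (rewrite E; ring).
  ring.
Qed.

Lemma conv_cont1 s f : cont1 f -> cont1 (conv s f).
Proof. intro H. eapply cont1_derive. intro; apply conv_derive; trivial. Qed.

Lemma conv_periodic s f : cont1 f -> periodic2pi f -> periodic2pi (conv s f).
Proof.
  intros Hf Hp x. unfold conv.
  replace (x + 2 * PI - 2 * PI) with ((x - 2 * PI) + 2 * PI) by ring.
  rewrite <- (rint_subst (fun z => exp (- (s * z)) * f z) (fun x => x + 2 * PI) (fun _ => 1)); auto 20 with cont.
  2: intro; eapply der_eq; [apply der_plus; [apply der_id|apply der_const]|cbv beta; ring].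
  rewrite (rint_ext _ (fun z => exp (- (s * (2 * PI))) * (exp (- (s * z)) * f z))).
  - rewrite rint_scal by auto 20 with cont. rewrite <- Rmult_assoc, <- exp_plus. do 2 f_equal. ring.
  - intro z. rewrite Hp. rewrite Rmult_1_l, <- Rmult_assoc, <- exp_plus. do 2 f_equal. ring.
Qed.

(** On the window, [x - z] lies in [[0, 2 * PI]], so the weight is at most [exp (2 * PI)] when
    [|s| <= 1]; the window has length [2 * PI]. *)
Definition convC : R := exp (2 * PI) * (2 * PI).
Lemma convC_pos : 0 <= convC.
Proof. unfold convC. generalize (exp_pos (2 * PI)) PI_RGT_0. nra. Qed.

Lemma conv_bound s f C x : cont1 f -> -1 <= s <= 1 -> (forall x, Rabs (f x) <= C) ->
  Rabs (conv s f x) <= C * convC.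
Proof.
  intros Hf Hs Hb. unfold conv. rewrite <- rint_scal by auto 20 with cont.
  assert (HP := PI_RGT_0).
  eapply Rle_trans; [apply (rint_bound _ _ _ (exp (2 * PI) * C)); auto 20 with cont|].
  - intros z. rewrite Rmin_left, Rmax_right by lra. intro Hz.
    rewrite !Rabs_mult. rewrite !(Rabs_pos_eq (exp _)) by (left; apply exp_pos).
    rewrite <- Rmult_assoc, <- exp_plus. apply Rmult_le_compat; trivial.
    + left; apply exp_pos. + apply Rabs_pos.
    + apply exp_le. nra.
  - replace (x - (x - 2 * PI)) with (2 * PI) by ring. rewrite (Rabs_pos_eq (2 * PI)) by lra.
    unfold convC. right; ring.
Qed.

Lemma conv_minus s f g x : cont1 f -> cont1 g ->
  conv s f x - conv s g x = conv s (fun z => f z - g z) x.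
Proof.
  intros Hf Hg. unfold conv. rewrite <- Rmult_minus_distr_l, <- rint_minus by auto 20 with cont.
  f_equal. apply rint_ext. intro; ring.
Qed.

(* With [eta x = x + Z x] the value at [x] is [exp (s eta(x)) * int_{x-2pi}^x exp (- s eta(z)) f(z) dz]. *)
Definition half (s : R) (Z f : R -> R) (x : R) : R :=
  exp (s * Z x) * conv s (fun z => exp (- s * Z z) * f z) x.

(** By periodicity both ends of the window contribute the same [f x], the lower one with weight
    [exp (2 * PI * s)], and the exponents in [Z] cancel there. Hence [f] is never differentiated. *)
Lemma half_derive s Z q f x : cont1 f -> periodic2pi Z -> periodic2pi f ->
  (forall x, is_derive Z x (q x - 1)) ->
  is_derive (half s Z f) x (s * q x * half s Z f x + (1 - exp (2 * PI * s)) * f x).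
Proof.
  intros Hf HpZ Hpf HZ. unfold half.
  assert (CZ : cont1 Z) by (eapply cont1_derive; apply HZ).
  eapply der_eq.
  - apply der_mult; [apply der_exp; apply der_scal; apply HZ|apply conv_derive; auto 20 with cont].
  - cbv beta.
    assert (E : exp (s * Z x) * exp (- s * Z x) = 1) by (rewrite <- exp_plus, <- exp_0; f_equal; ring).
    assert (Ep : Z (x - 2 * PI) = Z x) by (rewrite <- (HpZ (x - 2 * PI)); f_equal; ring).
    assert (Ef : f (x - 2 * PI) = f x) by (rewrite <- (Hpf (x - 2 * PI)); f_equal; ring).
    rewrite Ep, Ef.
    set (c := conv s _ x).
    replace ((1 - exp (2 * PI * s)) * f x) with (exp (s * Z x) * exp (- s * Z x) * ((1 - exp (2 * PI * s)) * f x)) by (rewrite E; ring).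
    ring.
Qed.

(** Coefficients of [exp d] and [exp (- d)] in [cosh (d - PI) / (2 * sinh PI)], the periodic Green
    function at distance [d] in [[0, 2 * PI]]. *)
Definition al : R := exp (- PI) / (4 * sinh PI).
Definition be : R := exp PI / (4 * sinh PI).
(* Convolution with the periodic Green function and with its derivative, along the flow. *)
Definition opA (Z f : R -> R) (x : R) : R := al * half 1 Z f x + be * half (-1) Z f x.
Definition opB (Z f : R -> R) (x : R) : R := al * half 1 Z f x + - be * half (-1) Z f x.

(** Together with [be_jump]: the endpoint contributions cancel in the sum, because the Green
    function is continuous on the diagonal, and give [-1] in the difference, which is the jump of
    its derivative. *)
Lemma al_jump : al * (1 - exp (2 * PI * 1)) = - / 2.
Proof.
  unfold al. generalize sinh_PI_pos. intro H.
  assert (E : exp (- PI) * exp (2 * PI * 1) = exp PI) by (rewrite <- exp_plus; f_equal; ring).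
  replace (exp (- PI) / (4 * sinh PI) * (1 - exp (2 * PI * 1))) with
    ((exp (- PI) - exp (- PI) * exp (2 * PI * 1)) / (4 * sinh PI)) by (field; lra).
  rewrite E. unfold sinh in *. field. lra.
Qed.
Lemma be_jump : be * (1 - exp (2 * PI * -1)) = / 2.
Proof.
  unfold be. generalize sinh_PI_pos. intro H.
  assert (E : exp PI * exp (2 * PI * -1) = exp (- PI)) by (rewrite <- exp_plus; f_equal; ring).
  replace (exp PI / (4 * sinh PI) * (1 - exp (2 * PI * -1))) with
    ((exp PI - exp PI * exp (2 * PI * -1)) / (4 * sinh PI)) by (field; lra).
  rewrite E. unfold sinh in *. field. lra.
Qed.

Lemma opA_derive Z q f x : cont1 f -> periodic2pi Z -> periodic2pi f ->
  (forall x, is_derive Z x (q x - 1)) -> is_derive (opA Z f) x (q x * opB Z f x).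
Proof.
  intros. unfold opA, opB. eapply der_eq.
  - apply der_plus; apply der_scal; apply half_derive; eassumption.
  - generalize al_jump be_jump; intros E1 E2.
    transitivity (q x * (al * half 1 Z f x + - be * half (-1) Z f x)
      + (al * (1 - exp (2 * PI * 1)) + be * (1 - exp (2 * PI * -1))) * f x); [ring|].
    rewrite E1, E2. field.
Qed.
(** With [opA_derive] this is the identity [(1 - d_x^2) G = delta] carried along the flow: the
    second derivative returns the source itself, which includes the Jacobian. *)
Lemma opB_derive Z q f x : cont1 f -> periodic2pi Z -> periodic2pi f ->
  (forall x, is_derive Z x (q x - 1)) -> is_derive (opB Z f) x (q x * opA Z f x - f x).
Proof.
  intros. unfold opA, opB. eapply der_eq.
  - apply der_plus; apply der_scal; apply half_derive; eassumption.
  - generalize al_jump be_jump; intros E1 E2.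
    transitivity (q x * (al * half 1 Z f x + be * half (-1) Z f x)
      + (al * (1 - exp (2 * PI * 1)) - be * (1 - exp (2 * PI * -1))) * f x); [ring|].
    rewrite E1, E2. field.
Qed.

(* Components of the Lagrangian state: [Z = eta - x], [q = eta_x], [U = u o eta], [w = U_x]. *)
Inductive component := cZ | cq | cU | cw.

(** Invariant ball of the Picard iteration. The radii leave room: data bounded by 1 drift by at most
    [/ 4]. The resulting lower bound on [q] keeps [/ q] Lipschitz and the flow map invertible. *)
Record admissible (X : component -> R -> R) : Prop := {
  admissible_cont1 : forall i, cont1 (X i);
  admissible_per : forall i, periodic2pi (X i);
  admissible_Z : forall x, Rabs (X cZ x) <= 1;
  admissible_q : forall x, Rabs (X cq x - 1) <= / 4;
  admissible_U : forall x, Rabs (X cU x) <= 2;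
  admissible_w : forall x, Rabs (X cw x) <= 2 }.

Definition close (X Y : component -> R -> R) (d : R) := forall i x, Rabs (X i x - Y i x) <= d.

(** One constant serves as sup bound and as Lipschitz constant in the uniform distance. The class is
    closed under sums, products and the nonlocal operators and contains [/ q], so membership of the
    vector field follows from its syntax. No derivative of [X] is measured, hence no high frequency
    either. *)
Definition good_with (C : R) (P : (component -> R -> R) -> R -> R) : Prop :=
  0 <= C /\
  (forall X, admissible X -> cont1 (P X) /\ periodic2pi (P X) /\ forall x, Rabs (P X x) <= C) /\
  (forall X Y d, admissible X -> admissible Y -> close X Y d -> forall x, Rabs (P X x - P Y x) <= C * d).
Definition good P : Prop := exists C, good_with C P.

Lemma close_pos X Y d : close X Y d -> 0 <= d.
Proof. intro H. eapply Rle_trans; [apply Rabs_pos|apply (H cZ 0)]. Qed.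

Lemma good_with_le C D P : good_with C P -> C <= D -> good_with D P.
Proof.
  intros [H0 [H1 H2]] HD. split; [lra|split].
  - intros X HX. destruct (H1 X HX) as [a [b c]]. repeat split; trivial. intro x.
    eapply Rle_trans; [apply c|trivial].
  - intros X Y d HX HY Hd x. eapply Rle_trans; [apply H2; eassumption|].
    apply Rmult_le_compat_r; trivial. eapply close_pos; eassumption.
Qed.

Lemma good_const c : good (fun _ _ => c).
Proof.
  exists (Rabs c). split; [apply Rabs_pos|split].
  - intros; repeat split; auto 20 with cont. intro; lra.
  - intros X Y d _ _ H x. rewrite Rminus_diag, Rabs_R0. apply Rmult_le_pos; [apply Rabs_pos|eapply close_pos; eassumption].
Qed.

Lemma good_coord i : good (fun X => X i).
Proof.
  exists 2. split; [lra|split].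
  - intros X HX. split; [apply HX|split; [apply HX|]]. intro x. destruct i; try apply HX.
    + eapply Rle_trans; [apply HX|lra].
    + generalize (admissible_q X HX x). intro H. apply Rabs_le_between in H. apply Rabs_le. lra.
  - intros X Y d _ _ H x. generalize (close_pos _ _ _ H) (H i x). lra.
Qed.

Lemma good_plus P Q : good P -> good Q -> good (fun X x => P X x + Q X x).
Proof.
  intros [C [HC [H1 H2]]] [D [HD [K1 K2]]]. exists (C + D). split; [lra|split].
  - intros X HX. destruct (H1 X HX) as [a [b c]], (K1 X HX) as [a' [b' c']].
    split; [auto 20 with cont|split].
    + intro x; cbv beta; rewrite b, b'; trivial.
    + intro x. eapply Rle_trans; [apply Rabs_triang|]. generalize (c x) (c' x); lra.
  - intros X Y d HX HY Hd x.
    replace (P X x + Q X x - (P Y x + Q Y x)) with ((P X x - P Y x) + (Q X x - Q Y x)) by ring.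
    eapply Rle_trans; [apply Rabs_triang|].
    generalize (H2 X Y d HX HY Hd x) (K2 X Y d HX HY Hd x); lra.
Qed.

Lemma good_mult P Q : good P -> good Q -> good (fun X x => P X x * Q X x).
Proof.
  intros [C [HC [H1 H2]]] [D [HD [K1 K2]]]. exists (2 * C * D). split; [nra|split].
  - intros X HX. destruct (H1 X HX) as [a [b c]], (K1 X HX) as [a' [b' c']].
    split; [auto 20 with cont|split].
    + intro x; cbv beta; rewrite b, b'; trivial.
    + intro x. rewrite Rabs_mult. generalize (c x) (c' x) (Rabs_pos (P X x)) (Rabs_pos (Q X x)). nra.
  - intros X Y d HX HY Hd x.
    destruct (H1 X HX) as [_ [_ c]], (K1 Y HY) as [_ [_ c']].
    replace (P X x * Q X x - P Y x * Q Y x) with (P X x * (Q X x - Q Y x) + (P X x - P Y x) * Q Y x) by ring.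
    eapply Rle_trans; [apply Rabs_triang|]. rewrite !Rabs_mult.
    generalize (H2 X Y d HX HY Hd x) (K2 X Y d HX HY Hd x) (c x) (c' x) (close_pos _ _ _ Hd); intros.
    assert (Rabs (P X x) * Rabs (Q X x - Q Y x) <= C * (D * d)) by (apply Rmult_le_compat; auto using Rabs_pos).
    assert (Rabs (P X x - P Y x) * Rabs (Q Y x) <= (C * d) * D) by (apply Rmult_le_compat; auto using Rabs_pos).
    lra.
Qed.

Lemma admissible_q_bounds X x : admissible X -> 3 / 4 <= X cq x <= 5 / 4.
Proof. intros H. generalize (admissible_q X H x). intro K. apply Rabs_le_between in K. lra. Qed.

Lemma good_invq : good (fun X x => / X cq x).
Proof.
  exists 2. split; [lra|split].
  - intros X HX. split; [|split].
    + apply cont1_inv; [apply HX|]. intro x. generalize (admissible_q_bounds X x HX); lra.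
    + intro x. cbv beta. rewrite (admissible_per X HX). trivial.
    + intro x. generalize (admissible_q_bounds X x HX); intro. rewrite Rabs_pos_eq.
      * replace 2 with (/ / 2) by field. apply Rinv_le_contravar; lra.
      * left; apply Rinv_0_lt_compat; lra.
  - intros X Y d HX HY Hd x.
    generalize (admissible_q_bounds X x HX) (admissible_q_bounds Y x HY) (Hd cq x) (close_pos _ _ _ Hd); intros.
    replace (/ X cq x - / Y cq x) with ((Y cq x - X cq x) * (/ X cq x * / Y cq x)) by (field; lra).
    rewrite Rabs_mult, Rabs_minus_sym, (Rabs_pos_eq (_ * _)).
    + rewrite (Rmult_comm 2). apply Rmult_le_compat; auto using Rabs_pos.
      * left; apply Rmult_lt_0_compat; apply Rinv_0_lt_compat; lra.
      * rewrite <- Rinv_mult. replace 2 with (/ / 2) by field. apply Rinv_le_contravar; nra.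
    + left; apply Rmult_lt_0_compat; apply Rinv_0_lt_compat; lra.
Qed.

Lemma exp_lipschitz x y : x <= 1 -> y <= 1 -> Rabs (exp x - exp y) <= exp 1 * Rabs (x - y).
Proof.
  intros Hx Hy.
  destruct (MVT_gen exp y x exp) as [c [Hc E]].
  - intros; apply is_derive_exp.
  - intros. apply continuity_pt_filterlim. apply (cont1_exp _ cont1_id).
  - rewrite E, Rabs_mult, (Rabs_pos_eq (exp c)) by (left; apply exp_pos).
    apply Rmult_le_compat_r; [apply Rabs_pos|]. apply exp_le.
    unfold Rmax in Hc; destruct (Rle_dec y x); lra.
Qed.

(** The bound [|Z| <= 1] keeps the exponent at most 1, a range on which [exp] has Lipschitz constant
    [exp 1]. *)
Lemma good_expZ s : -1 <= s <= 1 -> good (fun X x => exp (s * X cZ x)).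
Proof.
  intro Hs. assert (Hb : forall X x, admissible X -> s * X cZ x <= 1).
  { intros X x HX. generalize (admissible_Z X HX x). intro K. apply Rabs_le_between in K. nra. }
  exists (exp 1). split; [left; apply exp_pos|split].
  - intros X HX. split; [|split].
    + apply cont1_exp. apply cont1_mult; [apply cont1_const|apply HX].
    + intro x. cbv beta. rewrite (admissible_per X HX). trivial.
    + intro x. rewrite Rabs_pos_eq by (left; apply exp_pos). apply exp_le. auto.
  - intros X Y d HX HY Hd x. eapply Rle_trans; [apply exp_lipschitz; auto|].
    apply Rmult_le_compat_l; [left; apply exp_pos|].
    rewrite <- Rmult_minus_distr_l, Rabs_mult. generalize (Hd cZ x) (Rabs_pos (X cZ x - Y cZ x)). intros.
    assert (Rabs s <= 1) by (apply Rabs_le; lra). generalize (Rabs_pos s). nra.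
Qed.

(** Linearity in the convolved function turns the sup bound into the Lipschitz bound. *)
Lemma good_conv s P : -1 <= s <= 1 -> good P -> good (fun X x => conv s (P X) x).
Proof.
  intros Hs [C [HC [H1 H2]]]. exists (C * convC).
  assert (HcC := convC_pos).
  split; [apply Rmult_le_pos; trivial|split].
  - intros X HX. destruct (H1 X HX) as [a [b c]]. split; [apply conv_cont1; trivial|split].
    + apply conv_periodic; trivial.
    + intro; apply conv_bound; trivial.
  - intros X Y d HX HY Hd x. destruct (H1 X HX) as [a [b c]], (H1 Y HY) as [a' [b' c']].
    rewrite conv_minus by trivial.
    eapply Rle_trans; [apply (conv_bound s _ (C * d)); auto 20 with cont|]. right; ring.
Qed.

Lemma good_half s P : -1 <= s <= 1 -> good P -> good (fun X x => half s (X cZ) (P X) x).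
Proof.
  intros Hs HP. unfold half. apply good_mult; [apply good_expZ; trivial|].
  apply (good_conv s (fun X z => exp (- s * X cZ z) * P X z)); trivial.
  apply good_mult; trivial. apply good_expZ; lra.
Qed.
Lemma good_opA P : good P -> good (fun X x => opA (X cZ) (P X) x).
Proof.
  intro HP. unfold opA. apply good_plus; apply good_mult; auto using good_const; apply good_half; trivial; lra.
Qed.
Lemma good_opB P : good P -> good (fun X x => opB (X cZ) (P X) x).
Proof.
  intro HP. unfold opB. apply good_plus; apply good_mult; auto using good_const; apply good_half; trivial; lra.
Qed.

(** Sources of the nonlocal terms, composed with the flow and multiplied by the Jacobian, [u_x]
    along the flow being [w / q]: here [(w / q) ^ 3 * q], and in [src2] likewise
    [(3 / 2 * U * (w / q) ^ 2 + U ^ 3) * q]. *)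
Definition src1 (X : component -> R -> R) (x : R) : R :=
  X cw x * X cw x * X cw x * (/ X cq x * / X cq x).
Definition src2 (X : component -> R -> R) (x : R) : R :=
  3 / 2 * (X cU x * (X cw x * X cw x) * / X cq x) + X cU x * X cU x * X cU x * X cq x.

(** The [cq] and [cw] components are the formal [x]-derivatives of the [cZ] and [cU] ones. The Green
    function absorbs the derivative in [cw], so no derivative of the state occurs and the system is
    an ODE. *)
Definition vfield (i : component) (X : component -> R -> R) (x : R) : R :=
  match i with
  | cZ => X cU x * X cU x
  | cq => 2 * (X cU x * X cw x)
  | cU => - / 2 * opA (X cZ) (src1 X) x + -1 * opB (X cZ) (src2 X) x
  | cw => X cq x * (- / 2 * opB (X cZ) (src1 X) x + -1 * opA (X cZ) (src2 X) x) + src2 X x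
  end.

Lemma good_src1 : good src1.
Proof. unfold src1. repeat apply good_mult; auto using good_coord, good_invq. Qed.
Lemma good_src2 : good src2.
Proof. unfold src2. apply good_plus; repeat apply good_mult; auto using good_coord, good_invq, good_const. Qed.

Lemma good_field i : good (vfield i).
Proof.
  destruct i; unfold vfield.
  - apply good_mult; apply good_coord.
  - repeat apply good_mult; auto using good_coord, good_const.
  - apply good_plus; apply good_mult; auto using good_const; [apply good_opA|apply good_opB]; auto using good_src1, good_src2.
  - apply good_plus; [apply good_mult; [apply good_coord|]|apply good_src2].
    apply good_plus; apply good_mult; auto using good_const; [apply good_opB|apply good_opA]; auto using good_src1, good_src2.
Qed.

Lemma good_field_uniform : exists C, 0 < C /\ forall i, good_with C (vfield i).
Proof.
  destruct (good_field cZ) as [k1 H1], (good_field cq) as [k2 H2], (good_field cU) as [k3 H3], (good_field cw) as [k4 H4].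
  exists (k1 + k2 + k3 + k4 + 1).
  assert (0 <= k1) by apply H1. assert (0 <= k2) by apply H2. assert (0 <= k3) by apply H3. assert (0 <= k4) by apply H4.
  split; [lra|].
  destruct i; eapply good_with_le; try eassumption; lra.
Qed.

(** The ODE treats [q] and [w] as independent unknowns so that sup norms suffice; this constraint
    restores their meaning and is preserved by the iteration. *)
Definition slaved (X : component -> R -> R) : Prop :=
  forall x, is_derive (X cZ) x (X cq x - 1) /\ is_derive (X cU) x (X cw x).

Lemma field_slaved X : admissible X -> slaved X ->
  forall x, is_derive (vfield cZ X) x (vfield cq X x) /\ is_derive (vfield cU X) x (vfield cw X x).
Proof.
  intros HX HD x.
  destruct good_src1 as [c1 [_ [G1 _]]], good_src2 as [c2 [_ [G2 _]]].
  destruct (G1 X HX) as [a1 [b1 _]], (G2 X HX) as [a2 [b2 _]].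
  unfold vfield. split.
  - eapply der_eq; [apply der_mult; apply HD|cbv beta; ring].
  - eapply der_eq; [apply der_plus; apply der_scal; [eapply opA_derive|eapply opB_derive]; try eassumption; try apply HX; intro; apply HD|].
    cbv beta. ring.
Qed.

(** * Picard iteration *)

(* Time cutoff: the flow is frozen for [|t| >= 2 T], so that it is defined for all times. *)
Definition cutoff (T s : R) : R := Rmax 0 (Rmin 1 (2 - Rabs s / T)).

Lemma cutoff_cont1 T : cont1 (cutoff T).
Proof.
  (* Minimum and maximum are rewritten through absolute values, for which continuity is
     immediate. *)
  apply cont1_ext with (fun s => (((1 + (2 - Rabs s / T)) - Rabs (1 - (2 - Rabs s / T))) / 2
     + Rabs (((1 + (2 - Rabs s / T)) - Rabs (1 - (2 - Rabs s / T))) / 2)) / 2).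
  - intro x. unfold cutoff. set (y := 2 - Rabs x / T).
    unfold Rmin, Rmax. destruct (Rle_dec 1 y).
    + rewrite (Rabs_left1 (1 - y)) by lra. replace ((1 + y - - (1 - y)) / 2) with 1 by lra.
      rewrite Rabs_pos_eq by lra. destruct (Rle_dec 0 1); lra.
    + rewrite (Rabs_pos_eq (1 - y)) by lra. replace ((1 + y - (1 - y)) / 2) with y by lra.
      destruct (Rle_dec 0 y); [rewrite Rabs_pos_eq by lra|rewrite Rabs_left1 by lra]; lra.
  - unfold Rdiv. auto 30 with cont.
Qed.
Lemma cutoff_bounds T s : 0 <= cutoff T s <= 1.
Proof.
  unfold cutoff. split; [apply Rmax_l|]. apply Rmax_lub; [lra|apply Rmin_l].
Qed.
Lemma cutoff_1 T s : 0 < T -> Rabs s <= T -> cutoff T s = 1.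
Proof.
  intros HT Hs. unfold cutoff.
  assert (Rabs s / T <= 1) by (apply Rle_div_l; lra).
  rewrite Rmin_left by lra. apply Rmax_right; lra.
Qed.
Lemma cutoff_0 T s : 0 < T -> 2 * T <= Rabs s -> cutoff T s = 0.
Proof.
  intros HT Hs. unfold cutoff.
  assert (2 <= Rabs s / T) by (apply Rle_div_r; lra).
  rewrite Rmax_left; trivial. eapply Rle_trans; [apply Rmin_r|lra].
Qed.

Lemma cutoff_int_lip T g C a b : cont1 g -> (forall s, Rabs (g s) <= C) ->
  Rabs (RInt (fun s => cutoff T s * g s) a b) <= C * Rabs (b - a).
Proof.
  intros Hg HC. apply rint_bound; [apply cont1_mult; auto using cutoff_cont1|].
  intros s _. rewrite Rabs_mult. generalize (cutoff_bounds T s); intro.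
  rewrite (Rabs_pos_eq (cutoff T s)) by lra.
  generalize (HC s) (Rabs_pos (g s)). nra.
Qed.

(** The integrand vanishes for [|s| >= 2 * T], so the bound does not grow with [t]; this is what
    makes the Picard map a contraction over all times at once. *)
Lemma cutoff_int_bound T g C t : 0 < T -> cont1 g -> (forall s, Rabs (g s) <= C) ->
  Rabs (RInt (fun s => cutoff T s * g s) 0 t) <= C * (2 * T).
Proof.
  intros HT Hg HC.
  assert (HC0 : 0 <= C) by (eapply Rle_trans; [apply Rabs_pos|apply (HC 0)]).
  assert (Hc : cont1 (fun s => cutoff T s * g s)) by (apply cont1_mult; auto using cutoff_cont1).
  assert (H0 : forall a b, (forall s, Rmin a b <= s <= Rmax a b -> 2 * T <= Rabs s) ->
    RInt (fun s => cutoff T s * g s) a b = 0).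
  { intros a b H. rewrite (RInt_ext _ (fun _ => 0)).
    - rewrite rint_const. apply Rmult_0_r.
    - intros s Hs. rewrite cutoff_0; [apply Rmult_0_l|lra|apply H; lra]. }
  destruct (Rle_dec (Rabs t) (2 * T)) as [h|h].
  - eapply Rle_trans; [apply cutoff_int_lip; eassumption|]. rewrite Rminus_0_r. nra.
  - destruct (Rle_dec 0 t) as [h0|h0].
    + rewrite Rabs_pos_eq in h by lra.
      rewrite <- (rint_chasles _ 0 (2 * T) t), (H0 (2 * T) t); trivial.
      * rewrite Rplus_0_r. eapply Rle_trans; [apply cutoff_int_lip; eassumption|].
        rewrite Rminus_0_r, (Rabs_pos_eq (2 * T)); lra.
      * intros s. rewrite Rmin_left, Rmax_right by lra. intro. rewrite Rabs_pos_eq; lra.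
    + rewrite Rabs_left1 in h by lra.
      rewrite <- (rint_chasles _ 0 (- (2 * T)) t), (H0 (- (2 * T)) t); trivial.
      * rewrite Rplus_0_r. eapply Rle_trans; [apply cutoff_int_lip; eassumption|].
        rewrite Rminus_0_r, Rabs_Ropp, (Rabs_pos_eq (2 * T)); lra.
      * intros s. rewrite Rmin_right, Rmax_left by lra. intro. rewrite Rabs_left1; lra.
Qed.

Lemma cont2_of_lip f L : (forall t, cont1 (f t)) -> (forall t s x, Rabs (f t x - f s x) <= L * Rabs (t - s)) -> cont2 f.
Proof.
  intros Hc HL t x eps.
  assert (He : 0 < eps / 2) by (generalize (cond_pos eps); lra).
  assert (HL0 : 0 <= L). { generalize (HL 1 0 0) (Rabs_pos (f 1 0 - f 0 0)). rewrite Rminus_0_r, Rabs_R1. lra. }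
  destruct (proj1 (continuity_pt_locally (f t) x) (proj2 (continuity_pt_filterlim (f t) x) (Hc t x)) (mkposreal _ He)) as [d Hd].
  assert (Hm : 0 < Rmin d (eps / (2 * (L + 1)))).
  { apply Rmin_pos; [apply cond_pos|]. apply Rdiv_lt_0_compat; [apply cond_pos|lra]. }
  exists (mkposreal _ Hm). simpl. intros u v Hu Hv.
  assert (H1 : Rabs (f t v - f t x) < eps / 2).
  { apply Hd. eapply Rlt_le_trans; [exact Hv|apply Rmin_l]. }
  assert (H2 : Rabs (u - t) < eps / (2 * (L + 1))) by (eapply Rlt_le_trans; [exact Hu|apply Rmin_r]).
  replace (f u v - f t x) with ((f u v - f t v) + (f t v - f t x)) by ring.
  eapply Rle_lt_trans; [apply Rabs_triang|].
  assert (Rabs (f u v - f t v) <= eps / 2).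
  { eapply Rle_trans; [apply HL|]. apply Rle_trans with ((L + 1) * (eps / (2 * (L + 1)))).
    - apply Rmult_le_compat; try lra. apply Rabs_pos.
    - right; field; lra. }
  lra.
Qed.

Definition flow_ok (L : R) (X : R -> component -> R -> R) : Prop :=
  (forall t, admissible (X t)) /\ forall t s i x, Rabs (X t i x - X s i x) <= L * Rabs (t - s).

Lemma good_along_flow C L P X : good_with C P -> flow_ok L X -> cont2 (fun t => P (X t)).
Proof.
  intros [H0 [H1 H2]] [HX HL]. apply cont2_of_lip with (C * L).
  - intro t. apply H1. apply HX.
  - intros t s x. rewrite Rmult_assoc. apply H2; auto. intros i y. apply HL.
Qed.
Lemma coord_along_flow L X i : flow_ok L X -> cont2 (fun t => X t i).
Proof. intro H. destruct (good_coord i) as [C HC]. apply (good_along_flow C L (fun X => X i)); trivial. Qed.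

Definition data (u0 v0 : R -> R) (i : component) (x : R) : R :=
  match i with cZ => 0 | cq => 1 | cU => u0 x | cw => v0 x end.

Definition small_data (u0 v0 : R -> R) : Prop :=
  (forall x, is_derive u0 x (v0 x)) /\ cont1 v0 /\ periodic2pi u0 /\ periodic2pi v0 /\
  (forall x, Rabs (u0 x) <= 1) /\ (forall x, Rabs (v0 x) <= 1).

Definition picard (T : R) (u0 v0 : R -> R) (X : R -> component -> R -> R) (t : R) (i : component) (x : R) : R :=
  data u0 v0 i x + RInt (fun s => cutoff T s * vfield i (X s) x) 0 t.

Lemma data_cont1 u0 v0 i : small_data u0 v0 -> cont1 (data u0 v0 i).
Proof.
  intros [H [H1 _]]. destruct i; [apply cont1_const|apply cont1_const|exact (cont1_derive u0 v0 H)|exact H1].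
Qed.

Lemma field_cutoff_cont2 C L T X i : good_with C (vfield i) -> flow_ok L X ->
  cont2 (fun s x => cutoff T s * vfield i (X s) x).
Proof.
  intros HF HX. apply cont2_mult.
  - apply (cont2_comp1 (cutoff T) (fun s _ => s)); [apply cutoff_cont1|apply cont2_fst].
  - eapply good_along_flow; eassumption.
Qed.

Lemma picard_ok T C u0 v0 X : 0 < T -> 8 * T * C <= 1 -> (forall i, good_with C (vfield i)) ->
  small_data u0 v0 -> flow_ok C X -> flow_ok C (picard T u0 v0 X).
Proof.
  intros HT HTC HF HD HX.
  assert (Hc := fun i => field_cutoff_cont2 C C T X i (HF i) HX).
  assert (Hg : forall i x, cont1 (fun s => vfield i (X s) x)).
  { intros i x. apply (cont2_slice_t (fun s => vfield i (X s))). eapply good_along_flow; eauto. }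
  assert (Hb : forall i x s, Rabs (vfield i (X s) x) <= C).
  { intros i x s. destruct (HF i) as [_ [H1 _]]. apply H1. apply HX. }
  (* The drift is at most [C * (2 * T) <= / 4], the margin built into [admissible]. *)
  assert (Hi : forall t i x, Rabs (picard T u0 v0 X t i x - data u0 v0 i x) <= / 4).
  { intros t i x. unfold picard. rewrite Rplus_minus_l.
    eapply Rle_trans; [apply (cutoff_int_bound T (fun s => vfield i (X s) x) C); auto|]. lra. }
  assert (HD' := HD). destruct HD as [HD0 [HD1 [HD2 [HD3 [HD4 HD5]]]]].
  split.
  - intro t. constructor.
    + intro j. apply cont1_plus; [apply data_cont1; exact HD'|apply cont1_int_param; auto].
    + intros j x. unfold picard. f_equal.
      * destruct j; simpl; auto.
      * apply rint_ext. intro s. f_equal. destruct (HF j) as [_ [H1 _]]. apply H1. apply HX.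
    + intro x. generalize (Hi t cZ x). simpl. rewrite Rminus_0_r. lra.
    + intro x. apply (Hi t cq x).
    + intro x. generalize (Hi t cU x) (HD4 x). simpl. intros K1 K2.
      apply Rabs_le_between in K1. apply Rabs_le_between in K2. apply Rabs_le. lra.
    + intro x. generalize (Hi t cw x) (HD5 x). simpl. intros K1 K2.
      apply Rabs_le_between in K1. apply Rabs_le_between in K2. apply Rabs_le. lra.
  - intros t s i x. unfold picard.
    rewrite <- (rint_chasles (fun r => cutoff T r * vfield i (X r) x) 0 s t) by (apply (cont2_slice_t _ x (Hc i))).
    match goal with |- Rabs ?e <= _ => replace e with (RInt (fun r => cutoff T r * vfield i (X r) x) s t) by rring end.
    apply cutoff_int_lip; auto.
Qed.

(** The contraction factor is the Lipschitz constant times the total mass of the cutoff,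
    [C * (2 * T) <= / 4]. *)
Lemma picard_contract T C u0 v0 X Y d : 0 < T -> 8 * T * C <= 1 -> (forall i, good_with C (vfield i)) ->
  flow_ok C X -> flow_ok C Y -> (forall t, close (X t) (Y t) d) ->
  forall t, close (picard T u0 v0 X t) (picard T u0 v0 Y t) (d / 4).
Proof.
  intros HT HTC HF HX HY Hd t i x. unfold picard.
  assert (Hg : forall X, flow_ok C X -> cont1 (fun s => vfield i (X s) x)).
  { intros Z HZ. apply (cont2_slice_t (fun s => vfield i (Z s))). eapply good_along_flow; eauto. }
  match goal with |- Rabs ?e <= _ => replace e with (RInt (fun r => cutoff T r * (vfield i (X r) x - vfield i (Y r) x)) 0 t) end.
  - eapply Rle_trans; [apply (cutoff_int_bound T _ (C * d)); trivial|].
    + apply cont1_minus; auto.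
    + intro s. destruct (HF i) as [_ [_ H2]]. apply H2; [apply HX|apply HY|apply Hd].
    + generalize (close_pos _ _ _ (Hd 0)). nra.
  - rewrite (rint_ext _ (fun r => cutoff T r * vfield i (X r) x - cutoff T r * vfield i (Y r) x)) by (intro; ring).
    rewrite rint_minus by (apply cont1_mult; auto using cutoff_cont1). rring.
Qed.

(** Differentiation in [x] passes under the time integral, and [field_slaved] identifies the
    derivative of the integrand with the other component. *)
Lemma picard_slaved T C u0 v0 X : (forall i, good_with C (vfield i)) -> small_data u0 v0 ->
  flow_ok C X -> (forall t, slaved (X t)) -> forall t, slaved (picard T u0 v0 X t).
Proof.
  intros HF HD HX HS t x. unfold picard.
  assert (Hfs := fun s y => field_slaved (X s) (proj1 HX s) (HS s) y).
  split.
  - simpl data. apply der_ext with (fun y => RInt (fun s => cutoff T s * vfield cZ (X s) y) 0 t); [intro; rring|].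
    rewrite Rplus_minus_l.
    apply (rint_param_derive (fun s y => cutoff T s * vfield cZ (X s) y) (fun s y => cutoff T s * vfield cq (X s) y)).
    + intros s y. apply der_scal. apply Hfs.
    + eapply field_cutoff_cont2; eauto.
    + intro y. apply (cont2_slice_t (fun s y => cutoff T s * vfield cZ (X s) y)). eapply field_cutoff_cont2; eauto.
  - apply der_plus; [apply HD|].
    apply (rint_param_derive (fun s y => cutoff T s * vfield cU (X s) y) (fun s y => cutoff T s * vfield cw (X s) y)).
    + intros s y. apply der_scal. apply Hfs.
    + eapply field_cutoff_cont2; eauto.
    + intro y. apply (cont2_slice_t (fun s y => cutoff T s * vfield cU (X s) y)). eapply field_cutoff_cont2; eauto.
Qed.

Fixpoint iterate T u0 v0 (n : nat) : R -> component -> R -> R :=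
  match n with O => fun _ => data u0 v0 | S n => picard T u0 v0 (iterate T u0 v0 n) end.

Lemma geometric_limit (x : nat -> R) c : (forall n, Rabs (x (S n) - x n) <= c / 2 ^ n) ->
  exists l, forall n, Rabs (l - x n) <= 2 * c / 2 ^ n.
Proof.
  intro H.
  assert (Hp : forall n, 0 < 2 ^ n) by (intro; apply pow_lt; lra).
  assert (H1 : forall k n, Rabs (x (n + k)%nat - x n) <= 2 * c / 2 ^ n - 2 * c / 2 ^ (n + k)).
  { induction k; intro n.
    - rewrite Nat.add_0_r, !Rminus_diag, Rabs_R0. lra.
    - rewrite Nat.add_succ_r.
      replace (x (S (n + k)) - x n) with ((x (S (n + k)) - x (n + k)%nat) + (x (n + k)%nat - x n)) by ring.
      eapply Rle_trans; [apply Rabs_triang|]. generalize (H (n + k)%nat) (IHk n).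
      replace (2 * c / 2 ^ S (n + k)) with (c / 2 ^ (n + k)) by (simpl; field; apply Rgt_not_eq, Hp).
      replace (2 * c / 2 ^ (n + k)) with (c / 2 ^ (n + k) + c / 2 ^ (n + k)) by (field; apply Rgt_not_eq, Hp).
      lra. }
  assert (Hc : 0 <= c). { generalize (H 0%nat) (Rabs_pos (x 1%nat - x 0%nat)). simpl. lra. }
  assert (H2 : forall n k, Rabs (x (n + k)%nat - x n) <= 2 * c / 2 ^ n).
  { intros n k. eapply Rle_trans; [apply H1|].
    assert (0 <= 2 * c / 2 ^ (n + k)) by (apply Rmult_le_pos; [lra|left; apply Rinv_0_lt_compat, Hp]). lra. }

  assert (Hex : ex_finite_lim_seq x).
  { apply ex_lim_seq_cauchy_corr. intro eps.
    destruct (pow_lt_1_zero (/ 2) ltac:(rewrite Rabs_pos_eq; lra) (eps / (4 * c + 1))) as [N HN].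
    { apply Rdiv_lt_0_compat; [apply cond_pos|lra]. }
    exists N. intros n m Hn Hm.
    assert (Hs : 2 * c / 2 ^ N < eps / 2).
    { specialize (HN N (Nat.le_refl N)). rewrite pow_inv, Rabs_pos_eq in HN by (left; apply Rinv_0_lt_compat, Hp).
      unfold Rdiv at 1. apply Rle_lt_trans with (2 * c * (eps / (4 * c + 1))).
      - apply Rmult_le_compat_l; lra.
      - generalize (cond_pos eps); intro. apply Rmult_lt_reg_r with (4 * c + 1); [lra|].
        replace (2 * c * (eps / (4 * c + 1)) * (4 * c + 1)) with (2 * c * eps) by (field; lra). nra. }
    replace n with (N + (n - N))%nat by lia. replace m with (N + (m - N))%nat by lia.
    generalize (H2 N (n - N)%nat) (H2 N (m - N)%nat). intros K1 K2.
    match goal with |- Rabs (?a - ?b) < _ => replace (a - b) with ((a - x N) + - (b - x N)) by rring end.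
    eapply Rle_lt_trans; [apply Rabs_triang|]. rewrite Rabs_Ropp. lra. }
  destruct Hex as [l Hl]. exists l. intro n.
  apply (is_lim_seq_incr_n x n l) in Hl.
  assert (Hl2 : is_lim_seq (fun k => Rabs (x (k + n)%nat - x n)) (Rabs (l - x n))).
  { apply (is_lim_seq_abs _ (l - x n)). apply is_lim_seq_minus'; [exact Hl|apply is_lim_seq_const]. }
  apply (is_lim_seq_le (fun k => Rabs (x (k + n)%nat - x n)) (fun _ => 2 * c / 2 ^ n) (Rabs (l - x n)) (2 * c / 2 ^ n)); trivial.
  - intro k. rewrite Nat.add_comm. apply H2.
  - apply is_lim_seq_const.
Qed.

(** The properties of the limit flow are phrased as inequalities that hold up to [c / 2 ^ n] on the
    iterates; this lemma removes the error. *)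
Lemma small_of_geometric (a b c : R) : (forall n, a <= b + c / 2 ^ n) -> a <= b.
Proof.
  intro H. apply (is_lim_seq_le (fun _ => a) (fun n => b + c / 2 ^ n) a b); trivial.
  - apply is_lim_seq_const.
  - replace (Finite b) with (Finite (b + c * 0)) by (f_equal; ring).
    apply is_lim_seq_plus'; [apply is_lim_seq_const|].
    apply (is_lim_seq_scal_l _ c 0).
    apply is_lim_seq_ext with (fun n => (/ 2) ^ n); [intro; rewrite pow_inv; trivial|].
    apply is_lim_seq_geom. rewrite Rabs_pos_eq; lra.
Qed.

Lemma cont1_uniform_limit (f : R -> R) (fn : nat -> R -> R) c :
  (forall n, cont1 (fn n)) -> (forall n x, Rabs (f x - fn n x) <= c / 2 ^ n) -> cont1 f.
Proof.
  intros Hc Hl x. apply continuity_pt_filterlim, continuity_pt_locally. intro eps.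
  assert (Hn : exists n, c / 2 ^ n < eps / 3).
  { apply not_all_not_ex. intro H.
    assert (eps / 3 <= 0). { apply small_of_geometric with c. intro n. generalize (H n). lra. }
    generalize (cond_pos eps). lra. }
  destruct Hn as [n Hn].
  assert (He : 0 < eps / 3) by (generalize (cond_pos eps); lra).
  destruct (proj1 (continuity_pt_locally (fn n) x) (proj2 (continuity_pt_filterlim (fn n) x) (Hc n x)) (mkposreal _ He)) as [d Hd].
  exists d. intros y Hy. generalize (Hd y Hy). simpl. intro K.
  replace (f y - f x) with ((f y - fn n y) + (fn n y - fn n x) + - (f x - fn n x)) by ring.
  eapply Rle_lt_trans; [apply Rabs_triang|]. rewrite Rabs_Ropp.
  eapply Rle_lt_trans; [apply Rplus_le_compat_r; apply Rabs_triang|].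
  generalize (Hl n y) (Hl n x). lra.
Qed.

(** The identity [fn n y = fn n 0 + RInt (gn n) 0 y] passes to the limit, with an error proportional
    to [(2 + |y|) / 2 ^ n]. *)
Lemma derive_uniform_limit (f g : R -> R) (fn gn : nat -> R -> R) c :
  (forall n x, is_derive (fn n) x (gn n x)) -> (forall n, cont1 (gn n)) ->
  (forall n x, Rabs (f x - fn n x) <= c / 2 ^ n) -> (forall n x, Rabs (g x - gn n x) <= c / 2 ^ n) ->
  forall x, is_derive f x (g x).
Proof.
  intros Hd Hc Hf Hg x.
  assert (Cg : cont1 g) by (eapply cont1_uniform_limit; eassumption).
  apply der_ext with (fun y => f 0 + RInt g 0 y).
  2: { eapply der_eq; [apply der_plus; [apply der_const|apply rint_derive; trivial]|ring]. }
  intro y. symmetry. apply Rminus_diag_uniq. apply Rabs_eq_0. apply Rle_antisym; [|apply Rabs_pos].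
  apply small_of_geometric with (2 * c + c * Rabs y). intro n.
  assert (E : fn n y = fn n 0 + RInt (gn n) 0 y).
  { rewrite (rint_ftc (fn n) (gn n)); auto. ring. }
  replace (f y - (f 0 + RInt g 0 y)) with ((f y - fn n y) + - (f 0 - fn n 0) + - RInt (fun z => g z - gn n z) 0 y).
  - eapply Rle_trans; [apply Rabs_triang|]. eapply Rle_trans; [apply Rplus_le_compat_r, Rabs_triang|].
    rewrite !Rabs_Ropp.
    assert (Rabs (RInt (fun z => g z - gn n z) 0 y) <= c / 2 ^ n * Rabs (y - 0)).
    { apply rint_bound; [apply cont1_minus; auto|]. intros; apply Hg. }
    rewrite Rminus_0_r in H. generalize (Hf n y) (Hf n 0).
    replace ((2 * c + c * Rabs y) / 2 ^ n) with (c / 2 ^ n + c / 2 ^ n + c / 2 ^ n * Rabs y) by (field; apply pow_nonzero; lra).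
    lra.
  - rewrite rint_minus by auto. rewrite E. ring.
Qed.

Lemma admissible_limit (X : component -> R -> R) (Xn : nat -> component -> R -> R) c :
  (forall n, admissible (Xn n)) -> (forall n, close X (Xn n) (c / 2 ^ n)) -> admissible X.
Proof.
  intros HA Hl.
  assert (Hb : forall i y x b, (forall n, Rabs (Xn n i x - y) <= b) -> Rabs (X i x - y) <= b).
  { intros i y x b H. apply small_of_geometric with c. intro n.
    replace (X i x - y) with ((X i x - Xn n i x) + (Xn n i x - y)) by ring.
    eapply Rle_trans; [apply Rabs_triang|]. generalize (Hl n i x) (H n). lra. }
  constructor.
  - intro i. apply (cont1_uniform_limit (X i) (fun n => Xn n i) c); [intro; apply HA|intros; apply Hl].
  - intros i x. apply Rminus_diag_uniq. apply Rabs_eq_0. apply Rle_antisym; [|apply Rabs_pos].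
    apply small_of_geometric with (2 * c). intro n.
    replace (X i (x + 2 * PI) - X i x) with ((X i (x + 2 * PI) - Xn n i (x + 2 * PI)) + - (X i x - Xn n i x)).
    + eapply Rle_trans; [apply Rabs_triang|]. rewrite Rabs_Ropp.
      generalize (Hl n i x) (Hl n i (x + 2 * PI)). unfold Rdiv. lra.
    + rewrite (admissible_per _ (HA n)). ring.
  - intro x. generalize (Hb cZ 0 x 1). rewrite Rminus_0_r. intro H. apply H. intro n. rewrite Rminus_0_r. apply HA.
  - intro x. apply Hb. intro n. apply HA.
  - intro x. generalize (Hb cU 0 x 2). rewrite Rminus_0_r. intro H. apply H. intro n. rewrite Rminus_0_r. apply HA.
  - intro x. generalize (Hb cw 0 x 2). rewrite Rminus_0_r. intro H. apply H. intro n. rewrite Rminus_0_r. apply HA.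
Qed.

Lemma lagrangian_flow_exists T C u0 v0 : 0 < T -> 8 * T * C <= 1 -> 0 < C ->
  (forall i, good_with C (vfield i)) -> small_data u0 v0 ->
  exists X, flow_ok C X /\ (forall t, slaved (X t)) /\
    forall t i x, X t i x = data u0 v0 i x + RInt (fun s => cutoff T s * vfield i (X s) x) 0 t.
Proof.
  intros HT HTC HC0 HF HD. set (Xn := iterate T u0 v0).
  assert (Hok : forall n, flow_ok C (Xn n)).
  { induction n; [|apply picard_ok; trivial].
    assert (HD' := HD). destruct HD as [HD0 [HD1 [HD2 [HD3 [HD4 HD5]]]]]. split.
    - intros t. unfold Xn; simpl. constructor; simpl.
      + intro i; apply data_cont1; exact HD'.
      + intros i x. destruct i; simpl; auto.
      + intro. apply Rabs_le; lra. + intro. apply Rabs_le; lra.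
      + intro x. generalize (HD4 x); lra. + intro x. generalize (HD5 x); lra.
    - intros t s i x. unfold Xn; simpl. rewrite Rminus_diag, Rabs_R0. apply Rmult_le_pos; [lra|apply Rabs_pos]. }
  assert (Hsl : forall n t, slaved (Xn n t)).
  { induction n; [|intro; apply (picard_slaved T C); trivial].
    intros t x. unfold Xn; simpl. split; [rewrite Rminus_diag; apply der_const|apply HD]. }
  (* The first gap is at most 4 because admissible states are bounded by 2. The map contracts by
     [/ 4]; the rate [/ 2] is all that is recorded. *)
  assert (Hcl : forall n t, close (Xn (S n) t) (Xn n t) (4 / 2 ^ n)).
  { induction n.
    - intros t i x. replace (4 / 2 ^ 0) with 4 by (simpl; lra).
      assert (Hb : forall n i x, Rabs (Xn n t i x) <= 2).
      { intros n j y. assert (HA := proj1 (Hok n) t). destruct j; try apply HA.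
        - eapply Rle_trans; [apply HA|lra].
        - generalize (admissible_q_bounds _ y HA). intro. rewrite Rabs_pos_eq; lra. }
      generalize (Hb 1%nat i x) (Hb 0%nat i x). intros K1 K2. 
      apply Rabs_le_between in K1. apply Rabs_le_between in K2. apply Rabs_le. lra.
    - intros t i x. eapply Rle_trans; [apply (picard_contract T C u0 v0 (Xn (S n)) (Xn n) (4 / 2 ^ n)); trivial|].
      assert (0 < / 2 ^ n) by (apply Rinv_0_lt_compat, pow_lt; lra).
      unfold Rdiv. simpl. rewrite Rinv_mult. lra. }
  (* The limit is chosen point by point; the uniform rate gives back its regularity afterwards. *)
  assert (Hlim : exists X, forall t i x n, Rabs (X t i x - Xn n t i x) <= 8 / 2 ^ n).
  { assert (E : forall t i x, exists l, forall n, Rabs (l - Xn n t i x) <= 2 * 4 / 2 ^ n).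
    { intros t i x. apply (geometric_limit (fun n => Xn n t i x)). intro n. apply Hcl. }
    exists (fun t i x => proj1_sig (constructive_indefinite_description _ (E t i x))).
    intros t i x n. destruct (constructive_indefinite_description _ (E t i x)) as [l Hl].
    simpl. generalize (Hl n). replace (2 * 4) with 8 by ring. trivial. }
  destruct Hlim as [X HX].
  assert (HXok : flow_ok C X).
  { split.
    - intro t. apply (admissible_limit (X t) (fun n => Xn n t) 8); [intro; apply Hok|]. intros n i x. apply HX.
    - intros t s i x. apply small_of_geometric with 16. intro n.
      replace (X t i x - X s i x) with ((X t i x - Xn n t i x) + (Xn n t i x - Xn n s i x) + - (X s i x - Xn n s i x)) by ring.
      eapply Rle_trans; [apply Rabs_triang|]. eapply Rle_trans; [apply Rplus_le_compat_r, Rabs_triang|].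
      rewrite Rabs_Ropp. generalize (HX t i x n) (HX s i x n) (proj2 (Hok n) t s i x). unfold Rdiv. lra. }
  exists X. split; [trivial|split].
  - intros t x. split.
    + apply (derive_uniform_limit (X t cZ) (fun x => X t cq x - 1) (fun n => Xn n t cZ) (fun n x => Xn n t cq x - 1) 8).
      * intros n y. apply Hsl. * intro n. apply cont1_minus; [apply Hok|apply cont1_const].
      * intros; apply HX. * intros n y. replace (X t cq y - 1 - (Xn n t cq y - 1)) with (X t cq y - Xn n t cq y) by ring. apply HX.
    + apply (derive_uniform_limit (X t cU) (X t cw) (fun n => Xn n t cU) (fun n => Xn n t cw) 8).
      * intros n y. apply Hsl. * intro n. apply Hok. * intros; apply HX. * intros; apply HX.
  - intros t i x. apply Rminus_diag_uniq. apply Rabs_eq_0. apply Rle_antisym; [|apply Rabs_pos].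
    apply small_of_geometric with 16. intro n.
    fold (picard T u0 v0 X t i x).
    replace (X t i x - picard T u0 v0 X t i x) with ((X t i x - Xn (S n) t i x) + - (picard T u0 v0 X t i x - picard T u0 v0 (Xn n) t i x)) by (change (Xn (S n)) with (picard T u0 v0 (Xn n)); ring).
    eapply Rle_trans; [apply Rabs_triang|]. rewrite Rabs_Ropp.
    generalize (HX t i x (S n)).
    generalize (picard_contract T C u0 v0 X (Xn n) (8 / 2 ^ n) HT HTC HF HXok (Hok n) (fun t i x => HX t i x n) t i x).
    assert (0 < / 2 ^ n) by (apply Rinv_0_lt_compat, pow_lt; lra).
    unfold Rdiv. simpl. rewrite Rinv_mult. lra.
Qed.

(** * Smoothness of the flow *)

(** Only [x]-derivatives are counted, each jointly continuous in time and space. This is the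
    continuity that [novikov_solution] asks for, and the corners of [cutoff] limit the regularity in
    time. *)
Fixpoint smooth_in_x (k : nat) (f : R -> R -> R) : Prop :=
  match k with
  | O => cont2 f
  | S k' => cont2 f /\ exists g, (forall t x, is_derive (f t) x (g t x)) /\ smooth_in_x k' g
  end.

Lemma smooth_in_x_cont2 k f : smooth_in_x k f -> cont2 f.
Proof. destruct k; simpl; [trivial|intros [H _]; trivial]. Qed.
Lemma smooth_in_x_pred k f : smooth_in_x (S k) f -> smooth_in_x k f.
Proof.
  revert f. induction k; intros f [H1 [g [H2 H3]]]; simpl; trivial.
  split; trivial. exists g. split; trivial. apply IHk. exact H3.
Qed.
Lemma smooth_in_x_step k f g : (forall t x, is_derive (f t) x (g t x)) -> cont2 f -> smooth_in_x k g -> smooth_in_x (S k) f.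
Proof. intros; simpl; split; trivial. exists g; auto. Qed.
Lemma smooth_in_x_ext k f g : (forall t x, f t x = g t x) -> smooth_in_x k f -> smooth_in_x k g.
Proof.
  intros E. destruct k; simpl; [apply cont2_ext; trivial|].
  intros [H1 [h [H2 H3]]]. split; [apply cont2_ext with f; trivial|].
  exists h. split; trivial. intros t x. apply der_ext with (f t); auto.
Qed.
Lemma smooth_in_x_const k c : smooth_in_x k (fun _ _ => c).
Proof.
  revert c. induction k; intro c; [apply cont2_const|].
  apply smooth_in_x_step with (fun _ _ => 0); auto using cont2_const. intros; apply der_const.
Qed.
Lemma smooth_in_x_plus k f g : smooth_in_x k f -> smooth_in_x k g -> smooth_in_x k (fun t x => f t x + g t x).
Proof.
  revert f g. induction k; intros f g Hf Hg; [apply cont2_plus; trivial|].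
  destruct Hf as [Hf [f' [Df Sf]]], Hg as [Hg [g' [Dg Sg]]].
  apply smooth_in_x_step with (fun t x => f' t x + g' t x); auto using cont2_plus.
  intros; apply der_plus; auto.
Qed.
Lemma smooth_in_x_mult k f g : smooth_in_x k f -> smooth_in_x k g -> smooth_in_x k (fun t x => f t x * g t x).
Proof.
  revert f g. induction k; intros f g Hf Hg; [apply cont2_mult; trivial|].
  assert (Pf := smooth_in_x_pred _ _ Hf). assert (Pg := smooth_in_x_pred _ _ Hg).
  destruct Hf as [Hf [f' [Df Sf]]], Hg as [Hg [g' [Dg Sg]]].
  apply smooth_in_x_step with (fun t x => f' t x * g t x + f t x * g' t x); auto using cont2_mult, smooth_in_x_plus.
  intros; apply der_mult; auto.
Qed.
Lemma smooth_in_x_opp k f : smooth_in_x k f -> smooth_in_x k (fun t x => - f t x).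
Proof.
  intro H. apply smooth_in_x_ext with (fun t x => -1 * f t x); [intros; ring|].
  apply smooth_in_x_mult; auto using smooth_in_x_const.
Qed.
Lemma smooth_in_x_minus k f g : smooth_in_x k f -> smooth_in_x k g -> smooth_in_x k (fun t x => f t x - g t x).
Proof. intros. apply smooth_in_x_plus; auto using smooth_in_x_opp. Qed.
Lemma smooth_in_x_exp k f : smooth_in_x k f -> smooth_in_x k (fun t x => exp (f t x)).
Proof.
  revert f. induction k; intros f Hf; [apply cont2_exp; trivial|].
  assert (Pf := smooth_in_x_pred _ _ Hf). destruct Hf as [Hf [f' [Df Sf]]].
  apply smooth_in_x_step with (fun t x => exp (f t x) * f' t x); auto using cont2_exp, smooth_in_x_mult.
  intros; apply der_exp; auto.
Qed.
Lemma smooth_in_x_inv k f : (forall t x, f t x <> 0) -> smooth_in_x k f -> smooth_in_x k (fun t x => / f t x).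
Proof.
  intros Hn. induction k; intros Hf; [apply cont2_inv; trivial|].
  assert (Pf := smooth_in_x_pred _ _ Hf). destruct Hf as [Hf [f' [Df Sf]]].
  apply smooth_in_x_step with (fun t x => (- f' t x) * (/ f t x * / f t x)); auto using cont2_inv, smooth_in_x_mult, smooth_in_x_opp.
  intros. eapply der_eq; [apply der_inv; auto|field; auto].
Qed.
Lemma smooth_in_x_cutoff_int k T f : smooth_in_x k f -> smooth_in_x k (fun t x => RInt (fun s => cutoff T s * f s x) 0 t).
Proof.
  assert (Hc : forall f, cont2 f -> cont2 (fun s x => cutoff T s * f s x)).
  { intros h Hh. apply cont2_mult; trivial. apply (cont2_comp1 (cutoff T) (fun s _ => s)); [apply cutoff_cont1|apply cont2_fst]. }
  revert f. induction k; intros f Hf; [apply cont2_int_t; auto|].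
  destruct Hf as [Hf [f' [Df Sf]]].
  apply smooth_in_x_step with (fun t x => RInt (fun s => cutoff T s * f' s x) 0 t); auto using cont2_int_t.
  intros t x. apply (rint_param_derive (fun s x => cutoff T s * f s x) (fun s x => cutoff T s * f' s x)).
  - intros s y. apply der_scal; auto.
  - apply Hc. eapply smooth_in_x_cont2; eassumption.
  - intro y. apply (cont2_slice_t (fun s x => cutoff T s * f s x)); auto.
Qed.
Lemma smooth_in_x_of_smooth k f : smooth f -> smooth_in_x k (fun _ x => f x).
Proof.
  intro H.
  assert (K : forall k j, smooth_in_x k (fun _ x => Derive_n f j x)); [|apply (K k 0%nat)].
  assert (Hd : forall j x, is_derive (Derive_n f j) x (Derive_n f (S j) x)).
  { intros j x. apply (Derive_correct (Derive_n f j)). apply H. }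
  assert (Hc : forall j, cont2 (fun _ x => Derive_n f j x)).
  { intro j. apply (cont2_comp1 (Derive_n f j) (fun _ x => x)); [|apply cont2_snd]. eapply cont1_derive. apply Hd. }
  clear k. induction k; intro j; [apply Hc|].
  apply smooth_in_x_step with (fun _ => Derive_n f (S j)); auto.
Qed.

Lemma smooth_in_x_Derive_n k f : smooth_in_x k f -> exists g, cont2 g /\ forall t x, Derive_n (f t) k x = g t x.
Proof.
  revert f. induction k; intros f H; [exists f; split; trivial|].
  destruct H as [_ [f' [D S']]]. destruct (IHk f' S') as [g [Hg E]].
  exists g. split; trivial. intros t x. rewrite <- E.
  transitivity (Derive_n (Derive (f t)) k x).
  - rewrite (Derive_n_comp (f t) k 1). f_equal. lia.
  - apply Derive_n_ext. intro y. apply is_derive_unique, D.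
Qed.
Lemma smooth_in_x_smooth f t : (forall k, smooth_in_x k f) -> smooth (f t).
Proof.
  intros H k x. revert f H. induction k; intros f H.
  - destruct (H 1%nat) as [_ [g [D _]]]. exists (g t x). apply D.
  - destruct (H 1%nat) as [_ [g [D _]]].
    (* Each level supplies its own witness for the derivative; uniqueness of derivatives identifies
       them with [g]. *)
    assert (Hg : forall k, smooth_in_x k g).
    { intro j. destruct (H (S j)) as [_ [g' [D' S']]]. apply smooth_in_x_ext with g'; trivial.
      intros s y. rewrite <- (is_derive_unique _ _ _ (D s y)). symmetry. apply is_derive_unique, D'. }
    apply ex_derive_ext with (Derive_n (g t) k); [|apply IHk; trivial].
    intro y. symmetry. transitivity (Derive_n (Derive (f t)) k y).
    + rewrite (Derive_n_comp (f t) k 1). f_equal. lia.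
    + apply Derive_n_ext. intro z. apply is_derive_unique, D.
Qed.

(** * Difference quotients and dependence on a parameter *)

Lemma constant_of_derive_0 (f : R -> R) a b : (forall x, is_derive f x 0) -> f a = f b.
Proof.
  intro H. assert (E := rint_ftc f (fun _ => 0) b a H (cont1_const 0)).
  rewrite rint_const, Rmult_0_r in E. lra.
Qed.

(** Caratheodory's form of differentiability. It lets derivatives be read off from exact increment
    identities, without remainder estimates. *)
Lemma derive_of_slope (f Y : R -> R) x : (forall h, f (x + h) - f x = h * Y h) -> continuous Y 0 ->
  is_derive f x (Y 0).
Proof.
  intros H Hc. apply is_derive_Reals. intros eps He.
  destruct (proj1 (continuity_pt_locally Y 0) (proj2 (continuity_pt_filterlim Y 0) Hc) (mkposreal _ He)) as [d Hd].
  exists d. intros h Hh Hhd. rewrite H. replace (h * Y h / h) with (Y h) by (field; trivial).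
  apply Hd. change (Rabs (h - 0) < d). rewrite Rminus_0_r; trivial.
Qed.

(** The base point [x] is fixed and the variables are the parameter [s] and the increment [h]. The
    value [fx s x] at [h = 0] makes the quotient jointly continuous there. *)
Definition divdiff (f fx : R -> R -> R) (x s h : R) : R :=
  if Req_EM_T h 0 then fx s x else (f s (x + h) - f s x) / h.

Lemma divdiff_mult f fx x s h : f s (x + h) - f s x = h * divdiff f fx x s h.
Proof.
  unfold divdiff. destruct (Req_EM_T h 0) as [E|E]; [rewrite E, Rplus_0_r; ring|field; trivial].
Qed.

(** Near [h = 0] the mean value theorem turns the quotient into a value of [fx] at a nearby point
    and the same parameter, so joint continuity of [fx] suffices. *)
Lemma divdiff_cont2 f fx x : cont2 f -> cont2 fx -> (forall t x, is_derive (f t) x (fx t x)) -> cont2 (divdiff f fx x).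
Proof.
  intros Hf Hfx D s h. destruct (Req_EM_T h 0) as [E|E].
  - subst h. intro eps. destruct (Hfx s x eps) as [d Hd].
    exists d. intros r h Hr Hh. rewrite Rminus_0_r in Hh.
    assert (E0 : divdiff f fx x s 0 = fx s x) by (unfold divdiff; destruct (Req_EM_T 0 0); lra).
    rewrite E0. unfold divdiff. destruct (Req_EM_T h 0) as [E1|E1].
    + apply Hd; trivial. rewrite Rminus_diag, Rabs_R0. apply cond_pos.
    + destruct (MVT_gen (f r) x (x + h) (fx r)) as [c [Hc Ec]].
      * intros; apply D.
      * intros. apply continuity_pt_filterlim. apply (cont2_slice_x f r Hf).
      * rewrite Ec. replace (fx r c * (x + h - x) / h) with (fx r c) by (field; trivial).
        apply Hd; trivial. eapply Rle_lt_trans; [|exact Hh].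
        unfold Rmin, Rmax in Hc. unfold Rabs. destruct (Rle_dec x (x + h)); destruct (Rcase_abs h); destruct (Rcase_abs (c - x)); lra.
  - apply continuity_2d_pt_ext_loc with (fun s h => (f s (x + h) - f s x) / h).
    + assert (Hp : 0 < Rabs h) by (apply Rabs_pos_lt; trivial).
      exists (mkposreal _ Hp). intros u v _ Hv. simpl in Hv. unfold divdiff.
      destruct (Req_EM_T v 0) as [Ev|Ev]; trivial. subst v.
      rewrite Rminus_0_l, Rabs_Ropp in Hv. lra.
    + apply continuity_2d_pt_mult.
      * apply continuity_2d_pt_minus.
        -- apply (cont2_comp f (fun s _ => s) (fun _ h => x + h)); auto with cont.
        -- apply (cont2_comp f (fun s _ => s) (fun _ h => x)); auto with cont.
      * apply continuity_2d_pt_inv; [apply continuity_2d_pt_id2|trivial].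
Qed.


(* A Riccati equation depending on a parameter: the difference quotient in [x] solves a linear equation
   whose coefficients stay continuous as the increment tends to 0. *)
Lemma riccati_param_derive T (V U Ux g gx : R -> R -> R) (V0 V0' : R -> R) :
  cont2 V -> cont2 U -> cont2 Ux -> cont2 g -> cont2 gx -> cont1 V0' ->
  (forall t x, is_derive (U t) x (Ux t x)) -> (forall t x, is_derive (g t) x (gx t x)) ->
  (forall x, is_derive V0 x (V0' x)) -> (forall x, V 0 x = V0 x) ->
  (forall t x, is_derive (fun t => V t x) t (cutoff T t * (- / 2 * (U t x * (V t x * V t x)) + g t x))) ->
  forall t x, is_derive (V t) x
   (exp (RInt (fun s => cutoff T s * (-1 * (U s x * V s x))) 0 t) *
    (V0' x + RInt (fun s => cutoff T s * (exp (- RInt (fun r => cutoff T r * (-1 * (U r x * V r x))) 0 s) *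
       (- / 2 * (V s x * V s x * Ux s x) + gx s x))) 0 t)).
Proof.
  intros HV HU HUx Hg Hgx HV0' DU Dg DV0 V00 DV t x.
  assert (CcT : cont2 (fun s _ => cutoff T s)) by (apply (cont2_comp1 (cutoff T) (fun s _ => s)); [apply cutoff_cont1|apply cont2_fst]).
  assert (Hsh : forall f, cont2 f -> cont2 (fun s h => f s (x + h))).
  { intros f Hf. apply (cont2_comp f (fun s _ => s) (fun _ h => x + h)); auto with cont. }
  assert (Hx : forall f, cont2 f -> cont2 (fun s (h : R) => f s x)).
  { intros f Hf. apply (cont2_comp f (fun s _ => s) (fun _ h => x)); auto with cont. }
  (* With primes for values at [x + h], [U' * V' ^ 2 - U * V ^ 2 = U' * (V' + V) * (V' - V) + V ^ 2
     * (U' - U)]. Thus [al] is the coefficient of the unknown increment of [V] and [bt] the source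
     per unit of [h]. *)
  set (al s h := -1 * (/ 2 * (U s (x + h) * (V s (x + h) + V s x)))).
  set (bt s h := - / 2 * (V s x * V s x * divdiff U Ux x s h) + divdiff g gx x s h).
  assert (Cal : cont2 (fun s h => cutoff T s * al s h)) by (unfold al; auto 20 with cont).
  assert (Cbt : cont2 bt).
  { unfold bt. apply cont2_plus; [apply cont2_mult; auto with cont; apply cont2_mult; auto with cont|]; apply divdiff_cont2; trivial. }
  set (a s h := RInt (fun r => cutoff T r * al r h) 0 s).
  assert (Ca : cont2 a) by (apply cont2_int_t; trivial).
  assert (Cin : cont2 (fun s h => cutoff T s * (exp (- a s h) * bt s h))) by auto 20 with cont.
  set (Y h := exp (a t h) * (divdiff (fun _ => V0) (fun _ => V0') x 0 h
     + RInt (fun s => cutoff T s * (exp (- a s h) * bt s h)) 0 t)).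
  assert (CY : cont1 Y).
  { unfold Y. apply (cont2_slice_x (fun t h => exp (a t h) * (divdiff (fun _ => V0) (fun _ => V0') x 0 h
     + RInt (fun s => cutoff T s * (exp (- a s h) * bt s h)) 0 t)) t).
    apply cont2_mult; [auto with cont|]. apply cont2_plus; [|apply cont2_int_t; trivial].
    assert (K : cont2 (divdiff (fun _ : R => V0) (fun _ => V0') x)).
    { apply divdiff_cont2; trivial.
      - apply (cont2_comp1 V0 (fun _ h => h)); [eapply cont1_derive; apply DV0|apply cont2_snd].
      - apply (cont2_comp1 V0' (fun _ h => h)); [trivial|apply cont2_snd]. 
    }
    apply (cont2_comp _ (fun _ _ => 0) (fun _ h => h) K); auto with cont. }
  assert (E : forall h, V t (x + h) - V t x = h * Y h).
  { intro h.
    assert (Cal1 : cont1 (fun s => cutoff T s * al s h)) by (apply (cont2_slice_t _ h Cal)).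
    assert (Cin1 : cont1 (fun s => cutoff T s * (exp (- a s h) * bt s h))) by (apply (cont2_slice_t _ h Cin)).
    (* Integrating factor: the increment times [exp (- a)], minus its accumulated source, is
       constant in time. *)
    set (W s := exp (- a s h) * (V s (x + h) - V s x) - h * RInt (fun s => cutoff T s * (exp (- a s h) * bt s h)) 0 s).
    assert (DW : forall s, is_derive W s 0).
    { intro s. unfold W. eapply der_eq.
      - apply der_minus; [apply der_mult; [apply der_exp; apply der_opp; unfold a; apply (rint_derive (fun r => cutoff T r * al r h)); trivial|
          apply der_minus; [apply (DV s (x + h))|apply (DV s x)]]|apply der_scal; apply (rint_derive (fun s => cutoff T s * (exp (- a s h) * bt s h))); trivial].
      - cbv beta. unfold bt.
        replace (h * (cutoff T s * (exp (- a s h) * (- / 2 * (V s x * V s x * divdiff U Ux x s h) + divdiff g gx x s h))))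
          with (cutoff T s * (exp (- a s h) * (- / 2 * (V s x * V s x * (h * divdiff U Ux x s h)) + h * divdiff g gx x s h))) by ring.
        rewrite <- !divdiff_mult. unfold a, al. field. }
    assert (EW := constant_of_derive_0 W t 0 DW). unfold W in EW.
    assert (Ea : exp (- a 0 h) = 1).
    { unfold a. rewrite rint_point, Ropp_0. apply exp_0. }
    rewrite rint_point, Ea, !V00, (divdiff_mult (fun _ => V0) (fun _ => V0') x 0 h) in EW.
    assert (Ee : exp (a t h) * exp (- a t h) = 1) by (rewrite <- exp_plus, Rplus_opp_r; apply exp_0).
    unfold Y.
    replace (V t (x + h) - V t x) with (exp (a t h) * (exp (- a t h) * (V t (x + h) - V t x))) by (rewrite <- Rmult_assoc, Ee; ring).
    rewrite (Rmult_comm h), Rmult_assoc. f_equal. lra. }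
  eapply der_eq; [apply (derive_of_slope (V t) Y x E (CY 0))|].
  assert (Ed : forall f fx s, divdiff f fx x s 0 = fx s x) by (intros; unfold divdiff; destruct (Req_EM_T 0 0); lra).
  assert (Eal : forall s, al s 0 = -1 * (U s x * V s x)) by (intro; unfold al; rewrite Rplus_0_r; field).
  assert (Ea : forall s, a s 0 = RInt (fun r => cutoff T r * (-1 * (U r x * V r x))) 0 s).
  { intro s. apply rint_ext. intro r. rewrite Eal. trivial. }
  unfold Y. rewrite Ed, Ea. do 2 f_equal. apply rint_ext. intro s. unfold bt. rewrite !Ed, Ea. trivial.
Qed.

(** * Regularity of the Lagrangian flow *)

Definition lagrangian_flow (T C : R) (u0 v0 : R -> R) (X : R -> component -> R -> R) : Prop :=
  flow_ok C X /\ (forall t, slaved (X t)) /\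
  (forall i x, X 0 i x = data u0 v0 i x) /\
  (forall t i x, is_derive (fun t => X t i x) t (cutoff T t * vfield i (X t) x)).

Lemma lagrangian_flow_intro T C u0 v0 : 0 < T -> 8 * T * C <= 1 -> 0 < C ->
  (forall i, good_with C (vfield i)) -> small_data u0 v0 -> exists X, lagrangian_flow T C u0 v0 X.
Proof.
  intros HT HTC HC HF HD.
  destruct (lagrangian_flow_exists T C u0 v0 HT HTC HC HF HD) as [X [H1 [H2 H3]]].
  exists X. split; [trivial|split; [trivial|split]].
  - intros i x. rewrite H3, rint_point. apply Rplus_0_r.
  - intros t i x. apply der_ext with (fun t => data u0 v0 i x + RInt (fun s => cutoff T s * vfield i (X s) x) 0 t); [intro; auto|].
    eapply der_eq; [apply der_plus; [apply der_const|apply (rint_derive (fun s => cutoff T s * vfield i (X s) x))]|ring].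
    apply (cont2_slice_t (fun s x => cutoff T s * vfield i (X s) x)). eapply field_cutoff_cont2; eauto.
Qed.

Definition velx (X : R -> component -> R -> R) (t x : R) : R := X t cw x / X t cq x.
Definition pA (P : (component -> R -> R) -> R -> R) (X : R -> component -> R -> R) (t x : R) : R := opA (X t cZ) (P (X t)) x.
Definition pB (P : (component -> R -> R) -> R -> R) (X : R -> component -> R -> R) (t x : R) : R := opB (X t cZ) (P (X t)) x.

(** Bootstrap in the number of [x]-derivatives. The derivatives of [U] and of the nonlocal terms are
    polynomials in quantities of the previous order, so these gain one order first. The slope [velx]
    then gains one through its Riccati equation, and finally [q], an exponential of a time integral
    of [U * velx]. *)
Lemma flow_regular T C u0 v0 X : smooth v0 -> cont1 v0 -> lagrangian_flow T C u0 v0 X ->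
  forall k, smooth_in_x k (fun t => X t cq) /\ smooth_in_x k (fun t => X t cU) /\ smooth_in_x k (velx X) /\
    (smooth_in_x k (pA src1 X) /\ smooth_in_x k (pB src1 X)) /\ (smooth_in_x k (pA src2 X) /\ smooth_in_x k (pB src2 X)).
Proof.
  intros Hs0 Hv0 [Hok [Hsl [H0 Ht]]].
  assert (Hq : forall t x, 3 / 4 <= X t cq x <= 5 / 4) by (intros; apply admissible_q_bounds; apply Hok).
  assert (Hq0 : forall t x, X t cq x <> 0) by (intros t x; generalize (Hq t x); lra).
  assert (Ew : forall t x, X t cw x = X t cq x * velx X t x) by (intros; unfold velx; field; auto).
  assert (CX : forall i, cont2 (fun t => X t i)) by (intro; eapply coord_along_flow; eassumption).
  assert (CV : cont2 (velx X)) by (apply cont2_div; auto).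
  assert (Cp : forall P, good P -> cont2 (pA P X) /\ cont2 (pB P X)).
  { intros P HP. destruct (good_opA P HP) as [c1 G1], (good_opB P HP) as [c2 G2].
    split; [apply (good_along_flow c1 C (fun X x => opA (X cZ) (P X) x))|apply (good_along_flow c2 C (fun X x => opB (X cZ) (P X) x))]; trivial. }
  destruct (Cp _ good_src1) as [CA1 CB1], (Cp _ good_src2) as [CA2 CB2].
  assert (Dp : forall P, good P -> forall t x,
    is_derive (pA P X t) x (X t cq x * pB P X t x) /\
    is_derive (pB P X t) x (X t cq x * pA P X t x - P (X t) x)).
  { intros P [c [_ [G _]]] t x. destruct (G (X t) (proj1 Hok t)) as [G1 [G2 _]].
    split; [apply opA_derive|apply opB_derive]; trivial; try apply Hok; intro; apply Hsl. }
  assert (E1 : forall t x, src1 (X t) x = velx X t x * velx X t x * velx X t x * X t cq x).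
  { intros. unfold src1. rewrite Ew. field. auto. }
  assert (E2 : forall t x, src2 (X t) x = 3 / 2 * (X t cU x * (velx X t x * velx X t x)) * X t cq x + X t cU x * X t cU x * X t cU x * X t cq x).
  { intros. unfold src2. rewrite Ew. field. auto. }
  (* Up to the cutoff, the slope equation is [v_t = - / 2 * U * v ^ 2 + g]; the [- / 2] is the
     [3 / 2] of [src2] minus the 2 coming from [q_t]. *)
  set (g t x := X t cU x * X t cU x * X t cU x + (- / 2 * pB src1 X t x + -1 * pA src2 X t x)).
  assert (Cg : cont2 g) by (unfold g; auto 20 with cont).
  assert (DV : forall t x, is_derive (fun t => velx X t x) t
    (cutoff T t * (- / 2 * (X t cU x * (velx X t x * velx X t x)) + g t x))).
  { intros t x. unfold velx at 1. eapply der_eq; [apply der_div; [apply Ht|apply Ht|auto]|].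
    unfold g, vfield. change (opB (X t cZ) (src1 (X t)) x) with (pB src1 X t x). change (opA (X t cZ) (src2 (X t)) x) with (pA src2 X t x).
    rewrite E2, Ew. field. auto. }
  assert (V00 : forall x, velx X 0 x = v0 x).
  { intro x. unfold velx. rewrite !H0. simpl. field. }
  (* Since [w = q * velx], the equation of [q] is linear in [q], which gives a formula with no
     [x]-derivative of the flow in it. *)
  assert (Eq : forall t x, X t cq x = exp (RInt (fun s => cutoff T s * (2 * (X s cU x * velx X s x))) 0 t)).
  { intros t x. set (a t := RInt (fun s => cutoff T s * (2 * (X s cU x * velx X s x))) 0 t).
    assert (E : X t cq x * exp (- a t) = X 0 cq x * exp (- a 0)).
    { apply (constant_of_derive_0 (fun t => X t cq x * exp (- a t))). intro s.
      eapply der_eq; [apply der_mult; [apply Ht|apply der_exp; apply der_opp; apply (rint_derive (fun s => cutoff T s * (2 * (X s cU x * velx X s x))))]|].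
      - apply (cont2_slice_t (fun s x => cutoff T s * (2 * (X s cU x * velx X s x)))).
        apply cont2_mult; [apply (cont2_comp1 (cutoff T) (fun s _ => s)); [apply cutoff_cont1|apply cont2_fst]|auto 20 with cont].
      - unfold vfield. rewrite Ew. ring. }
    unfold a in E at 2. rewrite rint_point, Ropp_0, exp_0, H0, Rmult_1_r in E. simpl in E.
    rewrite <- (Rmult_1_r (X t cq x)), <- exp_0, <- (Rplus_opp_l (a t)), exp_plus, <- Rmult_assoc, E. ring. }
  induction k as [|k [Sq [SU [SV [[SA1 SB1] [SA2 SB2]]]]]].
  { simpl. repeat split; trivial. }
  assert (S1 : smooth_in_x k (fun t => src1 (X t))).
  { apply smooth_in_x_ext with (fun t x => velx X t x * velx X t x * velx X t x * X t cq x); [intros; rewrite E1; trivial|auto using smooth_in_x_mult]. }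
  assert (S2 : smooth_in_x k (fun t => src2 (X t))).
  { apply smooth_in_x_ext with (fun t x => 3 / 2 * (X t cU x * (velx X t x * velx X t x)) * X t cq x + X t cU x * X t cU x * X t cU x * X t cq x);
      [intros; rewrite E2; trivial|auto 10 using smooth_in_x_mult, smooth_in_x_plus, smooth_in_x_const]. }
  assert (SU' : smooth_in_x (S k) (fun t => X t cU)).
  { apply smooth_in_x_step with (fun t x => X t cq x * velx X t x); trivial; [|auto using smooth_in_x_mult].
    intros t x. rewrite <- Ew. apply Hsl. }
  assert (Sp : forall P, good P -> smooth_in_x k (fun t => P (X t)) -> smooth_in_x k (pA P X) -> smooth_in_x k (pB P X) -> smooth_in_x (S k) (pA P X) /\ smooth_in_x (S k) (pB P X)).
  { intros P HP SP SA SB. destruct (Cp P HP). split.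
    - apply smooth_in_x_step with (fun t x => X t cq x * pB P X t x); trivial; [intros; apply Dp; trivial|auto using smooth_in_x_mult].
    - apply smooth_in_x_step with (fun t x => X t cq x * pA P X t x - P (X t) x); trivial; [intros; apply Dp; trivial|auto using smooth_in_x_mult, smooth_in_x_minus]. }
  destruct (Sp _ good_src1 S1 SA1 SB1) as [SA1' SB1'].
  destruct (Sp _ good_src2 S2 SA2 SB2) as [SA2' SB2'].
  assert (SV' : smooth_in_x (S k) (velx X)).
  { set (Ux t x := X t cq x * velx X t x).
    set (gx t x := 3 * (X t cU x * X t cU x * Ux t x) + (- / 2 * (X t cq x * pA src1 X t x - src1 (X t) x) + -1 * (X t cq x * pB src2 X t x))).
    assert (SUx : smooth_in_x k Ux) by (unfold Ux; auto using smooth_in_x_mult).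
    assert (Sgx : smooth_in_x k gx) by (unfold gx; auto 20 using smooth_in_x_mult, smooth_in_x_plus, smooth_in_x_const, smooth_in_x_minus).
    assert (Dv0 : forall x, is_derive v0 x (Derive v0 x)) by (intro; apply Derive_correct; apply (Hs0 0%nat)).
    assert (Sv0 : smooth_in_x k (fun _ => Derive v0)).
    { destruct (smooth_in_x_of_smooth (S k) v0 Hs0) as [_ [d [Dd Sd]]]. apply smooth_in_x_ext with d; trivial.
      intros t x. symmetry. apply is_derive_unique. apply Dd. }
    eapply smooth_in_x_step; [|exact CV|].
    - apply (riccati_param_derive T (velx X) (fun t => X t cU) Ux g gx v0 (Derive v0)); trivial.
      + eapply smooth_in_x_cont2; eassumption.
      + eapply smooth_in_x_cont2; eassumption.
      + apply (cont2_slice_x (fun _ => Derive v0) 0). eapply smooth_in_x_cont2; eassumption.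
      + intros t x. unfold Ux. rewrite <- Ew. apply Hsl.
      + intros t x. unfold g, gx, Ux. rewrite <- Ew. eapply der_eq.
        * apply der_plus; [apply der_mult; [apply der_mult|]; apply Hsl|].
          apply der_plus; apply der_scal; [exact (proj2 (Dp _ good_src1 t x))|exact (proj1 (Dp _ good_src2 t x))].
        * cbv beta. ring.
    - apply smooth_in_x_mult.
      + apply smooth_in_x_exp. apply (smooth_in_x_cutoff_int k T (fun s x => -1 * (X s cU x * velx X s x))). auto using smooth_in_x_mult, smooth_in_x_const.
      + apply smooth_in_x_plus; [trivial|].
        apply (smooth_in_x_cutoff_int k T (fun s x => exp (- RInt (fun r => cutoff T r * (-1 * (X r cU x * velx X r x))) 0 s) *
          (- / 2 * (velx X s x * velx X s x * Ux s x) + gx s x))).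
        apply smooth_in_x_mult; [|auto 20 using smooth_in_x_mult, smooth_in_x_plus, smooth_in_x_const].
        apply smooth_in_x_exp, smooth_in_x_opp. apply (smooth_in_x_cutoff_int k T (fun s x => -1 * (X s cU x * velx X s x))). auto using smooth_in_x_mult, smooth_in_x_const. }
  assert (Sq' : smooth_in_x (S k) (fun t => X t cq)).
  { apply smooth_in_x_ext with (fun t x => exp (RInt (fun s => cutoff T s * (2 * (X s cU x * velx X s x))) 0 t)); [intros; rewrite <- Eq; trivial|].
    apply smooth_in_x_exp. apply (smooth_in_x_cutoff_int (S k) T (fun s x => 2 * (X s cU x * velx X s x))). auto using smooth_in_x_mult, smooth_in_x_const. }
  auto 10.
Qed.

(** * From Lagrangian to Eulerian variables *)

Lemma divdiff_0 f fx x s : divdiff f fx x s 0 = fx s x.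
Proof. unfold divdiff; destruct (Req_EM_T 0 0); lra. Qed.

(** The spatial increment is taken at the new time and the temporal one at the old position;
    [divdiff] makes both factors continuous in [h]. *)
Lemma increment_slope f fx ft z s : cont2 f -> cont2 fx -> cont2 ft ->
  (forall s x, is_derive (f s) x (fx s x)) -> (forall s x, is_derive (fun s => f s x) s (ft s x)) -> cont1 z ->
  exists A B, cont1 A /\ cont1 B /\ A 0 = fx s (z s) /\ B 0 = ft s (z s) /\
  (forall h, A h = divdiff f fx (z s) (s + h) (z (s + h) - z s)) /\
  forall h, f (s + h) (z (s + h)) - f s (z s) = (z (s + h) - z s) * A h + h * B h.
Proof.
  intros Cf Cfx Cft Dx Dt Cz.
  exists (fun h => divdiff f fx (z s) (s + h) (z (s + h) - z s)), (fun h => divdiff (fun x s => f s x) (fun x s => ft s x) s (z s) h).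
  split; [|split; [|split; [|split; [|split]]]].
  - apply (cont2_slice_x (fun _ h => divdiff f fx (z s) (s + h) (z (s + h) - z s)) 0).
    apply (cont2_comp _ (fun _ h => s + h) (fun _ h => z (s + h) - z s) (divdiff_cont2 f fx (z s) Cf Cfx Dx)); auto with cont.
    apply cont2_minus; auto with cont. apply (cont2_comp1 z (fun _ h => s + h)); auto with cont.
  - apply (cont2_slice_x (divdiff (fun x s => f s x) (fun x s => ft s x) s) (z s)).
    apply divdiff_cont2; [apply cont2_swap; trivial|apply cont2_swap; trivial|intros; apply Dt].
  - cbv beta. rewrite Rplus_0_r, Rminus_diag. apply divdiff_0.
  - exact (divdiff_0 (fun x s => f s x) (fun x s => ft s x) s (z s)).
  - trivial.
  - intro h. rewrite <- !divdiff_mult. replace (z s + (z (s + h) - z s)) with (z (s + h)) by ring. ring.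
Qed.

(** The increment identity is solved for the increment of [z]; injectivity keeps the spatial slope
    nonzero. The right-hand side [c + d * s] covers two uses: [d = 1] with [f] frozen in time gives
    the space derivative of the inverse flow, [d = 0] its time derivative. *)
Lemma implicit_derive f fx ft z m c d : cont2 f -> cont2 fx -> cont2 ft ->
  (forall s x, is_derive (f s) x (fx s x)) -> (forall s x, is_derive (fun s => f s x) s (ft s x)) -> cont1 z ->
  0 < m -> (forall s x y, m * Rabs (x - y) <= Rabs (f s x - f s y)) -> (forall s x, fx s x <> 0) ->
  (forall s, f s (z s) = c + d * s) -> forall s, is_derive z s ((d - ft s (z s)) / fx s (z s)).
Proof.
  intros Cf Cfx Cft Dx Dt Cz Hm Hinj Hnz Hc s.
  destruct (increment_slope f fx ft z s Cf Cfx Cft Dx Dt Cz) as [A [B [CA [CB [A0 [B0 [EA E]]]]]]].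
  assert (HA : forall h, A h <> 0).
  { intros h. rewrite EA. unfold divdiff. destruct (Req_EM_T _ 0) as [e|e]; [apply Hnz|].
    intro K. assert (K2 : f (s + h) (z s + (z (s + h) - z s)) - f (s + h) (z s) = 0).
    { apply Rmult_integral in K. destruct K as [K|K]; trivial. exfalso. apply (Rinv_neq_0_compat _ e); trivial. }
    generalize (Hinj (s + h) (z s + (z (s + h) - z s)) (z s)). rewrite K2, Rabs_R0.
    replace (z s + (z (s + h) - z s) - z s) with (z (s + h) - z s) by ring.
    generalize (Rabs_pos_lt _ e). nra. }
  rewrite <- A0, <- B0.
  apply (derive_of_slope z (fun h => (d - B h) / A h)).
  - intro h. specialize (E h). rewrite !Hc in E.
    assert (E2 : (z (s + h) - z s) * A h = h * (d - B h)) by lra.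
    replace (z (s + h) - z s) with ((z (s + h) - z s) * A h / A h) by (field; auto).
    rewrite E2. field. auto.
  - apply cont1_div; auto. apply cont1_minus; auto with cont.
Qed.

Lemma total_derive f fx ft z z' s : cont2 f -> cont2 fx -> cont2 ft ->
  (forall s x, is_derive (f s) x (fx s x)) -> (forall s x, is_derive (fun s => f s x) s (ft s x)) ->
  (forall s, is_derive z s (z' s)) -> cont1 z' ->
  is_derive (fun s => f s (z s)) s (ft s (z s) + fx s (z s) * z' s).
Proof.
  intros Cf Cfx Cft Dx Dt Dz Cz'.
  assert (Cz : cont1 z) by (eapply cont1_derive; exact Dz).
  destruct (increment_slope f fx ft z s Cf Cfx Cft Dx Dt Cz) as [A [B [CA [CB [A0 [B0 [_ E]]]]]]].
  set (Dv h := divdiff (fun _ => z) (fun _ => z') s 0 h).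
  assert (CD : cont1 Dv).
  { apply (cont2_slice_x (divdiff (fun _ => z) (fun _ => z') s) 0). apply divdiff_cont2; [| |intros; apply Dz].
    - apply (cont2_comp1 z (fun _ x => x)); auto with cont.
    - apply (cont2_comp1 z' (fun _ x => x)); auto with cont. }
  eapply der_eq; [apply (derive_of_slope (fun s => f s (z s)) (fun h => Dv h * A h + B h))|].
  - intro h. rewrite E. rewrite (divdiff_mult (fun _ => z) (fun _ => z') s 0 h : z (s + h) - z s = _). fold (Dv h). ring.
  - apply cont1_plus; [apply cont1_mult|]; trivial.
  - cbv beta. unfold Dv. rewrite divdiff_0, A0, B0. ring.
Qed.

(** * The Green function in Lagrangian and Eulerian variables *)

Definition Kper (d : R) : R := cosh (d - PI) / (2 * sinh PI).

Lemma green_shift d m : 0 < d < 2 * PI -> green (d + 2 * PI * IZR m) = Kper d.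
Proof.
  intros Hd. unfold green, Kper.
  assert (E : floor ((d + 2 * PI * IZR m) / (2 * PI)) = m).
  { assert (F := proj2_sig (floor_ex ((d + 2 * PI * IZR m) / (2 * PI)))).
    change (IZR (floor ((d + 2 * PI * IZR m) / (2 * PI))) <= (d + 2 * PI * IZR m) / (2 * PI) < IZR (floor ((d + 2 * PI * IZR m) / (2 * PI))) + 1) in F.
    set (n := floor _) in *.
    replace ((d + 2 * PI * IZR m) / (2 * PI)) with (d / (2 * PI) + IZR m) in F by (field; lra).
    assert (0 < d / (2 * PI) < 1).
    { split; [apply Rdiv_lt_0_compat; lra|]. apply Rlt_div_l; lra. }
    apply Z.le_antisymm; apply Zlt_succ_le; apply lt_IZR; unfold Z.succ; rewrite plus_IZR; lra. }
  rewrite E. do 2 f_equal. ring.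
Qed.

Lemma Kper_cont1 a : cont1 (fun y => Kper (a - y)).
Proof.
  unfold Kper, cosh. apply cont1_mult; auto with cont.
  unfold Rdiv. auto 20 with cont.
Qed.

Lemma reduce_period a : exists (k : Z) b, a = b + 2 * PI * IZR k /\ 0 <= b < 2 * PI.
Proof.
  assert (HP := PI_RGT_0).
  assert (F := proj2_sig (floor_ex (a / (2 * PI)))).
  set (k := proj1_sig (floor_ex (a / (2 * PI)))) in *.
  exists k, (a - 2 * PI * IZR k).
  assert (a = a / (2 * PI) * (2 * PI)) by (field; lra).
  split; [ring|]. split; nra.
Qed.

Lemma periodic_shift_Z f (m : Z) y : periodic2pi f -> f (y + 2 * PI * IZR m) = f y.
Proof.
  intro H.
  assert (Hn : forall n : nat, forall y, f (y + 2 * PI * INR n) = f y).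
  { induction n; intro z; [simpl; f_equal; ring|].
    rewrite S_INR, <- (IHn z), <- (H (z + 2 * PI * INR n)). f_equal; ring. }
  destruct (Z_le_gt_dec 0 m) as [h|h].
  - rewrite <- (Z2Nat.id m) by lia. rewrite <- INR_IZR_INZ. apply Hn.
  - rewrite <- (Hn (Z.to_nat (- m)) (y + 2 * PI * IZR m)). f_equal.
    rewrite INR_IZR_INZ, Z2Nat.id, opp_IZR by lia. ring.
Qed.

(** The period of integration is moved so that [y - z] stays in [[0, 2 * PI]], where the Green
    function is one smooth expression. The point [b] congruent to [y] in the original period is
    where [floor] jumps, so the integral is split there. *)
Lemma Linv_kernel f y : cont1 f -> periodic2pi f -> Linv f y = RInt (fun z => Kper (y - z) * f z) (y - 2 * PI) y.
Proof.
  intros Cf Pf. unfold Linv.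
  destruct (reduce_period (y - 2 * PI)) as [k [b [E Hb]]].
  assert (E1 : forall z, 0 < z < b -> green (y - z) * f z = Kper (b - z) * f z).
  { intros z Hz. f_equal. rewrite <- (green_shift (b - z) (k + 1)) by lra. f_equal. rewrite plus_IZR. lra. }
  assert (E2 : forall z, b < z < 2 * PI -> green (y - z) * f z = Kper (b + 2 * PI - z) * f z).
  { intros z Hz. f_equal. rewrite <- (green_shift (b + 2 * PI - z) k) by lra. f_equal. lra. }
  assert (I1 : ex_RInt (fun z => green (y - z) * f z) 0 b).
  { apply ex_RInt_ext with (fun z => Kper (b - z) * f z).
    - intros z Hz. rewrite Rmin_left, Rmax_right in Hz by lra. symmetry; auto.
    - apply ex_rint. apply cont1_mult; auto using Kper_cont1. }
  assert (I2 : ex_RInt (fun z => green (y - z) * f z) b (2 * PI)).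
  { apply ex_RInt_ext with (fun z => Kper (b + 2 * PI - z) * f z).
    - intros z Hz. rewrite Rmin_left, Rmax_right in Hz by lra. symmetry; auto.
    - apply ex_rint. apply cont1_mult; auto using Kper_cont1. }
  rewrite <- (RInt_Chasles (V := R_CompleteNormedModule) _ 0 b (2 * PI)) by trivial.
  rewrite (RInt_ext (fun z => green (y - z) * f z) (fun z => Kper (b - z) * f z) 0 b)
    by (intros z; rewrite Rmin_left, Rmax_right by lra; auto).
  rewrite (RInt_ext (fun z => green (y - z) * f z) (fun z => Kper (b + 2 * PI - z) * f z) b (2 * PI))
    by (intros z; rewrite Rmin_left, Rmax_right by lra; auto).
  assert (CK : forall a, cont1 (fun z => Kper (a - z) * f z)) by (intro; apply cont1_mult; auto using Kper_cont1).
  assert (S1 : RInt (fun z => Kper (y - z) * f z) (y - 2 * PI) y = RInt (fun z => Kper (b + 2 * PI - z) * f z) b (b + 2 * PI)).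
  { assert (K := rint_subst (fun z => Kper (y - z) * f z) (fun z => z + 2 * PI * IZR k) (fun _ => 1) b (b + 2 * PI)).
    cbv beta in K. rewrite <- E in K. replace (b + 2 * PI + 2 * PI * IZR k) with y in K by lra.
    rewrite <- K; auto with cont.
    - apply rint_ext. intro z. rewrite (periodic_shift_Z f) by trivial. rewrite Rmult_1_l. do 2 f_equal. lra.
    - intro; eapply der_eq; [apply der_plus; [apply der_id|apply der_const]|cbv beta; ring]. }
  rewrite S1, <- (rint_chasles _ b (2 * PI) (b + 2 * PI)) by trivial.
  rewrite Rplus_comm. f_equal.
  assert (K := rint_subst (fun z => Kper (b + 2 * PI - z) * f z) (fun z => z + 2 * PI) (fun _ => 1) 0 b).
  cbv beta in K. rewrite Rplus_0_l in K. rewrite <- K; auto with cont.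
  - apply rint_ext. intro z. rewrite Pf. rewrite Rmult_1_l. do 2 f_equal. lra.
  - intro; eapply der_eq; [apply der_plus; [apply der_id|apply der_const]|cbv beta; ring].
Qed.

Lemma half_0 s f x : half s (fun _ => 0) f x = conv s f x.
Proof.
  unfold half. rewrite Rmult_0_r, exp_0, Rmult_1_l. unfold conv. f_equal. apply rint_ext.
  intro. rewrite Rmult_0_r, exp_0. ring.
Qed.

Lemma Linv_opA f y : cont1 f -> periodic2pi f -> Linv f y = opA (fun _ => 0) f y.
Proof.
  intros Cf Pf. rewrite Linv_kernel by trivial. unfold opA. rewrite !half_0. unfold conv.
  rewrite <- !Rmult_assoc, <- !rint_scal, <- rint_plus by auto 20 with cont.
  apply rint_ext. intro z. unfold Kper, cosh, al, be. generalize sinh_PI_pos; intro.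
  replace (y - z - PI) with (- PI + (1 * y + - (1 * z))) at 1 by ring.
  replace (- (y - z - PI)) with (PI + (-1 * y + - (-1 * z))) by ring.
  rewrite !exp_plus. field. lra.
Qed.

(** Change of variables [z + Z z]. Its Jacobian [q] must be supplied by the source, which is why
    [src1] and [src2] contain it. *)
Lemma half_subst s Z q f x : cont1 f -> cont1 q -> periodic2pi Z -> (forall x, is_derive Z x (q x - 1)) ->
  half s Z (fun z => f (z + Z z) * q z) x = half s (fun _ => 0) f (x + Z x).
Proof.
  intros Cf Cq PZ DZ. rewrite half_0. unfold half, conv.
  rewrite <- Rmult_assoc, <- exp_plus.
  replace (s * Z x + s * x) with (s * (x + Z x)) by ring. f_equal.
  replace (x + Z x - 2 * PI) with ((x - 2 * PI) + Z (x - 2 * PI)).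
  2: { rewrite <- (PZ (x - 2 * PI)). replace (x - 2 * PI + 2 * PI) with x by ring. ring. }
  rewrite <- (rint_subst (fun z => exp (- (s * z)) * f z) (fun z => z + Z z) q); auto with cont.
  - apply rint_ext. intro z. replace (- (s * (z + Z z))) with (- (s * z) + - s * Z z) by ring. rewrite exp_plus. ring.
  - intro y. eapply der_eq; [apply der_plus; [apply der_id|apply DZ]|ring].
Qed.


(** Since [q >= 3 / 4], the flow map has an inverse [zeta] of the same regularity, and [u] is [U]
    composed with it. The transport term of the equation comes from the time derivative of
    [zeta]. *)
Lemma lagrangian_to_eulerian T C u0 v0 X : 0 < T -> smooth v0 -> cont1 v0 -> lagrangian_flow T C u0 v0 X ->
  exists u, novikov_solution T u0 u /\ (forall t, 0 <= t -> H_infty (u t)) /\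
    forall t x, u t (x + X t cZ x) = X t cU x.
Proof.
  intros HT Hs0 Cv0 HL.
  assert (Hreg := flow_regular T C u0 v0 X Hs0 Cv0 HL).
  destruct HL as [Hok [Hsl [H0 Ht]]].
  assert (HA := proj1 Hok).
  assert (CX : forall i, cont2 (fun t => X t i)) by (intro; eapply coord_along_flow; eassumption).
  assert (Hq : forall t x, 3 / 4 <= X t cq x <= 5 / 4) by (intros; apply admissible_q_bounds; apply Hok).
  assert (Hq0 : forall t x, X t cq x <> 0) by (intros t x; generalize (Hq t x); lra).
  set (eta t x := x + X t cZ x).
  assert (Ceta : cont2 eta) by (unfold eta; apply cont2_plus; auto with cont).
  assert (Deta : forall t x, is_derive (eta t) x (X t cq x)).
  { intros t x. eapply der_eq; [apply der_plus; [apply der_id|exact (proj1 (Hsl t x))]|ring]. }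
  assert (Dteta : forall t x, is_derive (fun t => eta t x) t (cutoff T t * vfield cZ (X t) x)).
  { intros t x. eapply der_eq; [apply der_plus; [apply der_const|exact (Ht t cZ x)]|ring]. }
  assert (Hinj : forall t x y, 3 / 4 * Rabs (x - y) <= Rabs (eta t x - eta t y)).
  { intros t x y. destruct (MVT_gen (eta t) y x (fun x => X t cq x)) as [c [_ Ec]].
    - intros; apply Deta.
    - intros; apply continuity_pt_filterlim; apply (cont2_slice_x eta t Ceta).
    - rewrite Ec, Rabs_mult. apply Rmult_le_compat_r; [apply Rabs_pos|]. generalize (Hq t c). intro. rewrite Rabs_pos_eq; lra. }
  assert (Hz : exists zeta : R -> R -> R, forall t y, eta t (zeta t y) = y).
  { assert (E : forall t y, exists x, eta t x = y).
    (* The bound [|Z| <= 1] places a preimage of [y] within distance 1 of it. *)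
    { intros t y. destruct (IVT_gen (eta t) (y - 1) (y + 1) y) as [x [_ Hx]].
      - intro x. apply continuity_pt_filterlim; apply (cont2_slice_x eta t Ceta).
      - generalize (admissible_Z _ (HA t) (y - 1)) (admissible_Z _ (HA t) (y + 1)). intros K1 K2.
        apply Rabs_le_between in K1. apply Rabs_le_between in K2. fold (eta t).
        assert (eta t (y - 1) <= y <= eta t (y + 1)) by (unfold eta; lra).
        rewrite Rmin_left, Rmax_right by lra. trivial.
      - exists x; trivial. }
    exists (fun t y => proj1_sig (constructive_indefinite_description _ (E t y))).
    intros t y. apply (proj2_sig (constructive_indefinite_description _ (E t y))). }
  destruct Hz as [zeta Hz].
  assert (Hze : forall t x, zeta t (eta t x) = x).
  { intros t x. apply Rminus_diag_uniq. apply Rabs_eq_0. generalize (Hinj t (zeta t (eta t x)) x).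
    rewrite Hz, Rminus_diag, Rabs_R0. generalize (Rabs_pos (zeta t (eta t x) - x)). lra. }
  assert (Czeta : cont2 zeta).
  { intros t y eps. destruct (Ceta t (zeta t y) (mkposreal (eps / 4) ltac:(generalize (cond_pos eps); lra))) as [d Hd].
    assert (Hm : 0 < Rmin d (eps / 4)) by (apply Rmin_pos; [apply cond_pos|generalize (cond_pos eps); lra]).
    exists (mkposreal _ Hm). simpl. intros s z Hs Hy.
    assert (K1 : Rabs (eta s (zeta t y) - eta t (zeta t y)) < eps / 4).
    { apply Hd; [eapply Rlt_le_trans; [exact Hs|apply Rmin_l]|rewrite Rminus_diag, Rabs_R0; apply cond_pos]. }
    assert (K2 : Rabs (z - y) < eps / 4) by (eapply Rlt_le_trans; [exact Hy|apply Rmin_r]).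
    generalize (Hinj s (zeta s z) (zeta t y)). rewrite Hz in K1 |- *.
    replace (z - eta s (zeta t y)) with ((z - y) + - (eta s (zeta t y) - y)) by ring.
    intro K. generalize (Rabs_triang (z - y) (- (eta s (zeta t y) - y))). rewrite Rabs_Ropp. intro.
    generalize (cond_pos eps). lra. }
  assert (Dzeta : forall t y, is_derive (zeta t) y (/ X t cq (zeta t y))).
  { intros t y. eapply der_eq.
    - apply (implicit_derive (fun _ => eta t) (fun _ => X t cq) (fun _ _ => 0) (zeta t) (3 / 4) 0 1); auto with cont; try lra.
      + apply (cont2_comp1 (eta t) (fun _ x => x)); auto with cont.
      + apply (cont2_comp1 (X t cq) (fun _ x => x)); auto with cont. apply HA.
      + intros; apply der_const.
      + intro; rewrite Hz; ring.
    - cbv beta. field. auto. }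
  assert (CcT : cont2 (fun s _ => cutoff T s)) by (apply (cont2_comp1 (cutoff T) (fun s _ => s)); [apply cutoff_cont1|apply cont2_fst]).
  assert (Dtzeta : forall y t, is_derive (fun t => zeta t y) t ((0 - cutoff T t * (X t cU (zeta t y) * X t cU (zeta t y))) / X t cq (zeta t y))).
  { intros y. apply (implicit_derive eta (fun t => X t cq) (fun t x => cutoff T t * (X t cU x * X t cU x)) (fun t => zeta t y) (3 / 4) y 0); auto with cont; try lra.
    intro; rewrite Hz; ring. }
  (* Each derivative brings down a factor [/ q] at [zeta], so the induction stays among functions of
     the Lagrangian variable composed with [zeta]. *)
  assert (Scomp : forall k f, smooth_in_x k f -> smooth_in_x k (fun t y => f t (zeta t y))).
  { induction k; intros f Hf.
    - apply (cont2_comp f (fun t _ => t) zeta); auto with cont.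
    - assert (Hf' := Hf). destruct Hf' as [Cf [g [Dg Sg]]].
      apply smooth_in_x_step with (fun t y => g t (zeta t y) * / X t cq (zeta t y)).
      + intros t y. apply (der_comp (f t) (zeta t)); auto.
      + apply (cont2_comp f (fun t _ => t) zeta); auto with cont.
      + apply (IHk (fun t x => g t x * / X t cq x)). apply smooth_in_x_mult; trivial. apply smooth_in_x_inv; trivial. apply (Hreg k). }
  set (u t y := X t cU (zeta t y)). set (v t y := velx X t (zeta t y)).
  assert (Su : forall k, smooth_in_x k u) by (intro k; apply (Scomp k (fun t => X t cU)); apply Hreg).
  assert (Sv : forall k, smooth_in_x k v) by (intro k; apply (Scomp k (velx X)); apply Hreg).
  assert (Hzp : forall t y, zeta t (y + 2 * PI) = zeta t y + 2 * PI).
  { intros t y. rewrite <- (Hze t (zeta t y + 2 * PI)). f_equal. unfold eta. rewrite (admissible_per _ (HA t)).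
    rewrite <- (Hz t y) at 1. unfold eta. ring. }
  assert (Pu : forall t, periodic2pi (u t)) by (intros t y; unfold u; rewrite Hzp; apply (admissible_per _ (HA t))).
  assert (Pv : forall t, periodic2pi (v t)).
  { intros t y; unfold v, velx. rewrite Hzp, !(admissible_per _ (HA t)). trivial. }
  assert (Du : forall t y, Derive (u t) y = v t y).
  { intros t y. apply is_derive_unique. eapply der_eq; [apply (der_comp (X t cU) (zeta t)); [apply Hsl|apply Dzeta]|]. unfold v, velx. trivial. }
  assert (HI : forall t, H_infty (u t)) by (intro; split; [apply Pu|apply smooth_in_x_smooth; trivial]).
  assert (Hu : forall t x, u t (eta t x) = X t cU x) by (intros; unfold u; rewrite Hze; trivial).
  assert (Hv : forall t x, v t (eta t x) = velx X t x) by (intros; unfold v; rewrite Hze; trivial).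
  assert (C1u : forall t, cont1 (u t)) by (intro t; apply (cont2_slice_x u t (Su 0%nat))).
  assert (C1v : forall t, cont1 (v t)) by (intro t; apply (cont2_slice_x v t (Sv 0%nat))).
  assert (E1 : forall t y, Linv (fun y => Derive (u t) y ^ 3) y = pA src1 X t (zeta t y)).
  { intros t y.
    assert (Cf : cont1 (fun y => Derive (u t) y ^ 3)).
    { apply cont1_pow. apply cont1_ext with (v t); auto. }
    rewrite Linv_opA; trivial; [|intro z; cbv beta; rewrite !Du, Pv; trivial].
    unfold pA, opA. rewrite <- (Hz t y) at 1 2. unfold eta.
    rewrite <- !(half_subst _ (X t cZ) (X t cq)); trivial; try apply HA; try (intro; apply Hsl).
    assert (Es : forall s x, half s (X t cZ) (fun z => Derive (u t) (z + X t cZ z) ^ 3 * X t cq z) x = half s (X t cZ) (src1 (X t)) x).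
    { intros s x. unfold half, conv. f_equal. f_equal. apply rint_ext. intro z. f_equal. f_equal.
      rewrite Du. change (z + X t cZ z) with (eta t z). rewrite Hv. unfold velx, src1. field. auto. }
    rewrite !Es. trivial. }
  set (f2 t y := 3 / 2 * u t y * Derive (u t) y ^ 2 + u t y ^ 3).
  assert (Cf2 : forall t, cont1 (f2 t)).
  { intro t. apply cont1_ext with (fun y => 3 / 2 * u t y * v t y ^ 2 + u t y ^ 3); [intro; unfold f2; rewrite Du; trivial|auto 20 with cont]. }
  assert (Pf2 : forall t, periodic2pi (f2 t)).
  { intros t y. unfold f2. rewrite !Du, Pu, Pv. trivial. }
  assert (E2 : forall t y, Derive (Linv (f2 t)) y = pB src2 X t (zeta t y)).
  { intros t y.
    rewrite (Derive_ext _ (opA (fun _ => 0) (f2 t))) by (intro; apply Linv_opA; trivial).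
    (* The Eulerian operator is the Lagrangian one for the identity flow: zero displacement,
       Jacobian 1. *)
    rewrite (is_derive_unique _ _ _ (opA_derive (fun _ => 0) (fun _ => 1) (f2 t) y (Cf2 t) (fun _ => eq_refl) (Pf2 t)
       (fun x => der_eq _ _ _ _ (der_const 0 x) (eq_sym (Rminus_diag 1))))).
    rewrite Rmult_1_l. unfold pB, opB. rewrite <- (Hz t y) at 1 2. unfold eta.
    rewrite <- !(half_subst _ (X t cZ) (X t cq)); trivial; try apply HA; try (intro; apply Hsl).
    assert (Es : forall s x, half s (X t cZ) (fun z => f2 t (z + X t cZ z) * X t cq z) x = half s (X t cZ) (src2 (X t)) x).
    { intros s x. unfold half, conv. f_equal. f_equal. apply rint_ext. intro z. f_equal. f_equal.
      unfold f2. rewrite Du. change (z + X t cZ z) with (eta t z). rewrite Hv, Hu. unfold velx, src2. field. auto. }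
    rewrite !Es. trivial. }
  exists u. split; [|split; [intros; apply HI|exact Hu]].
  split; [intros; apply HI|split; [|split]].
  - intros k t x _ eps He. destruct (smooth_in_x_Derive_n k u (Su k)) as [g [Cg Eg]].
    destruct (Cg t x (mkposreal eps He)) as [d Hd]. exists d. split; [apply cond_pos|].
    intros s y _ Hs Hy. rewrite !Eg. apply Hd; trivial.
  - intro x. rewrite <- (Hz 0 x) at 1. rewrite Hu, H0. simpl. f_equal.
    rewrite <- (Hz 0 x) at 2. unfold eta. rewrite H0. simpl. ring.
  - intros t y Ht0. unfold u at 1. eapply der_eq.
    + apply (total_derive (fun t => X t cU) (fun t => X t cw) (fun t x => cutoff T t * vfield cU (X t) x) (fun t => zeta t y)
        (fun t => (0 - cutoff T t * (X t cU (zeta t y) * X t cU (zeta t y))) / X t cq (zeta t y))); auto.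
      * apply cont2_mult; trivial. destruct (good_field cU) as [c Hc]. eapply (good_along_flow c); eassumption.
      * intros; apply Hsl.
      * apply (cont2_slice_t (fun t y => (0 - cutoff T t * (X t cU (zeta t y) * X t cU (zeta t y))) / X t cq (zeta t y))).
        assert (Cz : forall i, cont2 (fun t y => X t i (zeta t y))) by (intro i; apply (cont2_comp (fun t => X t i) (fun t _ => t) zeta); auto with cont).
        apply cont2_div; auto 10 with cont.
    + unfold novikov_rhs. fold (f2 t). rewrite E1, E2, Du.
      rewrite cutoff_1 by (trivial; rewrite Rabs_pos_eq; lra).
      unfold vfield, pA, pB, u, v, velx. field. auto.
Qed.

(** * Trigonometric polynomials and the Fejer kernel *)

(** Span of the modes with frequency in [[a, b]], as an inductive predicate, so that linear
    statements are proved mode by mode. The last constructor closes the class under pointwise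
    equality. *)
Inductive trig_poly (a b : Z) : (R -> R) -> Prop :=
  | trig_poly_zero : trig_poly a b (fun _ => 0)
  | trig_poly_cos m : (a <= m <= b)%Z -> trig_poly a b (fun x => cos (IZR m * x))
  | trig_poly_sin m : (a <= m <= b)%Z -> trig_poly a b (fun x => sin (IZR m * x))
  | trig_poly_scal c f : trig_poly a b f -> trig_poly a b (fun x => c * f x)
  | trig_poly_plus f g : trig_poly a b f -> trig_poly a b g -> trig_poly a b (fun x => f x + g x)
  | trig_poly_ext f g : (forall x, f x = g x) -> trig_poly a b f -> trig_poly a b g.

(** The real index is the sum of the coefficients. Their sign excludes cancellation when such a
    function is paired with the sawtooth, whose sine coefficients are nonnegative as well. *)
Inductive pos_sine_poly (a b : Z) : R -> (R -> R) -> Prop :=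
  | pos_sine_poly_zero : pos_sine_poly a b 0 (fun _ => 0)
  | pos_sine_poly_sin m : (a <= m <= b)%Z -> pos_sine_poly a b 1 (fun x => sin (IZR m * x))
  | pos_sine_poly_scal c W f : 0 <= c -> pos_sine_poly a b W f -> pos_sine_poly a b (c * W) (fun x => c * f x)
  | pos_sine_poly_plus W V f g : pos_sine_poly a b W f -> pos_sine_poly a b V g -> pos_sine_poly a b (W + V) (fun x => f x + g x)
  | pos_sine_poly_ext W V f g : (forall x, f x = g x) -> W = V -> pos_sine_poly a b W f -> pos_sine_poly a b V g.

Lemma trig_poly_of_pos_sine_poly a b W f : pos_sine_poly a b W f -> trig_poly a b f.
Proof. induction 1; [apply trig_poly_zero|apply trig_poly_sin|apply trig_poly_scal|apply trig_poly_plus|eapply trig_poly_ext]; eauto. Qed.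

Lemma trig_poly_cont1 a b f : trig_poly a b f -> cont1 f.
Proof. induction 1; auto 20 with cont. eapply cont1_ext; eassumption. Qed.

Lemma trig_periodic m : periodic2pi (fun x => cos (IZR m * x)) /\ periodic2pi (fun x => sin (IZR m * x)).
Proof.
  assert (P1 : periodic2pi cos) by (intro; replace (x + 2 * PI) with (x + 2 * INR 1 * PI) by (simpl; ring); apply cos_period).
  assert (P2 : periodic2pi sin) by (intro; replace (x + 2 * PI) with (x + 2 * INR 1 * PI) by (simpl; ring); apply sin_period).
  split; intro x.
  - rewrite <- (periodic_shift_Z cos m (IZR m * x) P1). f_equal. ring.
  - rewrite <- (periodic_shift_Z sin m (IZR m * x) P2). f_equal. ring.
Qed.

Lemma trig_poly_periodic a b f : trig_poly a b f -> periodic2pi f.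
Proof.
  induction 1; try (apply trig_periodic); intro x; trivial.
  - rewrite IHtrig_poly; trivial. - rewrite IHtrig_poly1, IHtrig_poly2; trivial. - rewrite <- !H, IHtrig_poly; trivial.
Qed.

Lemma der_cos_lin (c x : R) : is_derive (fun x => cos (c * x)) x (- c * sin (c * x)).
Proof. eapply der_eq; [apply der_cos, der_scal, der_id|cbv beta; ring]. Qed.
Lemma der_sin_lin (c x : R) : is_derive (fun x => sin (c * x)) x (c * cos (c * x)).
Proof. eapply der_eq; [apply der_sin, der_scal, der_id|cbv beta; ring]. Qed.

Lemma trig_poly_derive_ex a b f : trig_poly a b f -> exists g, trig_poly a b g /\ forall x, is_derive f x (g x).
Proof.
  induction 1 as [|m Hm|m Hm|c f Hf [g [Hg D]]|f1 f2 Hf1 [g1 [Hg1 D1]] Hf2 [g2 [Hg2 D2]]|f h E Hf [g [Hg D]]].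
  - exists (fun _ => 0). split; [apply trig_poly_zero|intro; apply der_const].
  - exists (fun x => - IZR m * sin (IZR m * x)). split; [apply trig_poly_scal, trig_poly_sin; trivial|intro; apply der_cos_lin].
  - exists (fun x => IZR m * cos (IZR m * x)). split; [apply trig_poly_scal, trig_poly_cos; trivial|intro; apply der_sin_lin].
  - exists (fun x => c * g x). split; [apply trig_poly_scal; trivial|intro; apply der_scal; trivial].
  - exists (fun x => g1 x + g2 x). split; [apply trig_poly_plus; trivial|intro; apply der_plus; trivial].
  - exists g. split; trivial. intro x. apply der_ext with f; trivial.
Qed.
Lemma trig_poly_derive a b f g : (forall x, is_derive f x (g x)) -> trig_poly a b f -> trig_poly a b g.
Proof.
  intros D Hf. destruct (trig_poly_derive_ex a b f Hf) as [h [Hh Dh]]. apply trig_poly_ext with h; trivial.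
  intro x. rewrite <- (is_derive_unique _ _ _ (Dh x)). apply is_derive_unique, D.
Qed.
Lemma trig_poly_smooth a b f : trig_poly a b f -> smooth f.
Proof.
  intros Hf k. assert (K : trig_poly a b (Derive_n f k)).
  { induction k; trivial. simpl. destruct (trig_poly_derive_ex _ _ _ IHk) as [g [Hg D]].
    apply trig_poly_ext with g; trivial. intro x. symmetry. apply is_derive_unique, D. }
  intro x. destruct (trig_poly_derive_ex _ _ _ K) as [g [_ D]]. exists (g x). apply D.
Qed.
Lemma trig_poly_shift a b f c : trig_poly a b f -> trig_poly a b (fun x => f (x - c)).
Proof.
  induction 1.
  - apply trig_poly_zero.
  - apply trig_poly_ext with (fun x => cos (IZR m * c) * cos (IZR m * x) + sin (IZR m * c) * sin (IZR m * x)).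
    + intro x. rewrite Rmult_minus_distr_l, cos_minus. ring.
    + apply trig_poly_plus; apply trig_poly_scal; [apply trig_poly_cos|apply trig_poly_sin]; trivial.
  - apply trig_poly_ext with (fun x => cos (IZR m * c) * sin (IZR m * x) + - sin (IZR m * c) * cos (IZR m * x)).
    + intro x. rewrite Rmult_minus_distr_l, sin_minus. ring.
    + apply trig_poly_plus; apply trig_poly_scal; [apply trig_poly_sin|apply trig_poly_cos]; trivial.
  - apply (trig_poly_scal a b c0 (fun x => f (x - c))); trivial.
  - apply (trig_poly_plus a b (fun x => f (x - c)) (fun x => g (x - c))); trivial.
  - eapply trig_poly_ext; [|apply IHtrig_poly]. intro; cbv beta; auto.
Qed.

Lemma trig_poly_weaken a b a' b' f : (a' <= a)%Z -> (b <= b')%Z -> trig_poly a b f -> trig_poly a' b' f.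
Proof.
  intros Ha Hb. induction 1; [apply trig_poly_zero|apply trig_poly_cos; lia|apply trig_poly_sin; lia|apply trig_poly_scal|apply trig_poly_plus|eapply trig_poly_ext]; eauto.
Qed.
Lemma pos_sine_poly_weaken a b a' b' W f : (a' <= a)%Z -> (b <= b')%Z -> pos_sine_poly a b W f -> pos_sine_poly a' b' W f.
Proof.
  intros Ha Hb. induction 1; [apply pos_sine_poly_zero|apply pos_sine_poly_sin; lia|apply pos_sine_poly_scal|apply pos_sine_poly_plus|eapply pos_sine_poly_ext]; eauto.
Qed.

Lemma cos_mult u v : cos u * cos v = / 2 * cos (u + v) + / 2 * cos (u - v).
Proof. rewrite cos_plus, cos_minus. field. Qed.
Lemma sin_mult u v : sin u * sin v = / 2 * cos (u - v) + - / 2 * cos (u + v).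
Proof. rewrite cos_plus, cos_minus. field. Qed.
Lemma sin_cos_mult u v : sin u * cos v = / 2 * sin (u + v) + / 2 * sin (u - v).
Proof. rewrite sin_plus, sin_minus. field. Qed.

Lemma trig_poly_mult_sin a b l f : (0 <= l)%Z -> trig_poly a b f -> trig_poly (a - l) (b + l) (fun x => f x * sin (IZR l * x)).
Proof.
  intros Hl. induction 1.
  - apply trig_poly_ext with (fun _ => 0); [intro; ring|apply trig_poly_zero].
  - apply trig_poly_ext with (fun x => / 2 * sin (IZR (l + m) * x) + - / 2 * sin (IZR (m - l) * x)).
    + intro x. rewrite (Rmult_comm (cos _)), sin_cos_mult, plus_IZR, minus_IZR.
      replace (IZR l * x - IZR m * x) with (- ((IZR m - IZR l) * x)) by ring. rewrite sin_neg, Rmult_plus_distr_r. field.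
    + apply trig_poly_plus; apply trig_poly_scal; apply trig_poly_sin; lia.
  - apply trig_poly_ext with (fun x => / 2 * cos (IZR (m - l) * x) + - / 2 * cos (IZR (m + l) * x)).
    + intro x. rewrite sin_mult, plus_IZR, minus_IZR. rewrite Rmult_plus_distr_r, Rmult_minus_distr_r. trivial.
    + apply trig_poly_plus; apply trig_poly_scal; apply trig_poly_cos; lia.
  - apply trig_poly_ext with (fun x => c * (f x * sin (IZR l * x))); [intro; ring|apply trig_poly_scal; trivial].
  - apply trig_poly_ext with (fun x => f x * sin (IZR l * x) + g x * sin (IZR l * x)); [intro; ring|apply trig_poly_plus; trivial].
  - eapply trig_poly_ext; [|apply IHtrig_poly]. intro x; cbv beta; rewrite H; trivial.
Qed.

(** A sine times a cosine is the half sum of two sines, so the spectrum widens by [l] and the total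
    weight is kept. *)
Lemma pos_sine_poly_mult_cos a b l W f : (0 <= l)%Z -> pos_sine_poly a b W f -> pos_sine_poly (a - l) (b + l) W (fun x => f x * cos (IZR l * x)).
Proof.
  intros Hl. induction 1.
  - apply pos_sine_poly_ext with 0 (fun _ => 0); [intro; ring|trivial|apply pos_sine_poly_zero].
  - apply pos_sine_poly_ext with (/ 2 * 1 + / 2 * 1) (fun x => / 2 * sin (IZR (m + l) * x) + / 2 * sin (IZR (m - l) * x)).
    + intro x. rewrite sin_cos_mult, plus_IZR, minus_IZR. rewrite Rmult_plus_distr_r, Rmult_minus_distr_r. trivial.
    + field.
    + apply pos_sine_poly_plus; apply pos_sine_poly_scal; try lra; apply pos_sine_poly_sin; lia.
  - eapply pos_sine_poly_ext; [| |apply (pos_sine_poly_scal _ _ c W (fun x => f x * cos (IZR l * x))); trivial]; [intro; cbv beta; ring|trivial].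
  - eapply pos_sine_poly_ext; [| |apply (pos_sine_poly_plus _ _ W V (fun x => f x * cos (IZR l * x)) (fun x => g x * cos (IZR l * x))); trivial]; [intro; cbv beta; ring|trivial].
  - eapply pos_sine_poly_ext; [| |apply IHpos_sine_poly]; [intro x; cbv beta; rewrite H; trivial|trivial].
Qed.

(** * Dirichlet and Fejer kernels with two derivatives *)

Lemma der_unique (f : R -> R) (x a b : R) : is_derive f x a -> is_derive f x b -> a = b.
Proof. intros H1 H2. rewrite <- (is_derive_unique f x a H1). apply is_derive_unique, H2. Qed.

(** Dirichlet kernel. Its sum [fej M] over the indices below [M] is the unnormalised Fejer kernel
    [(1 - cos (M * x)) / (1 - cos x)], with value [M ^ 2] at 0. *)
Fixpoint dir (m : nat) (x : R) : R :=
  match m with O => 1 | S m' => dir m' x + 2 * cos (INR m * x) end.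
Fixpoint dir1 (m : nat) (x : R) : R :=
  match m with O => 0 | S m' => dir1 m' x - 2 * INR m * sin (INR m * x) end.
Fixpoint dir2 (m : nat) (x : R) : R :=
  match m with O => 0 | S m' => dir2 m' x - 2 * INR m ^ 2 * cos (INR m * x) end.
Fixpoint fej (M : nat) (x : R) : R := match M with O => 0 | S M' => fej M' x + dir M' x end.
Fixpoint fej1 (M : nat) (x : R) : R := match M with O => 0 | S M' => fej1 M' x + dir1 M' x end.
Fixpoint fej2 (M : nat) (x : R) : R := match M with O => 0 | S M' => fej2 M' x + dir2 M' x end.

Lemma dir_derive m x : is_derive (dir m) x (dir1 m x).
Proof.
  induction m; simpl dir; simpl dir1; [apply der_const|].
  eapply der_eq; [apply (der_plus (dir m)); [exact IHm|apply der_scal, der_cos_lin]|ring].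
Qed.
Lemma dir1_derive m x : is_derive (dir1 m) x (dir2 m x).
Proof.
  induction m; simpl dir1; simpl dir2; [apply der_const|].
  eapply der_eq; [apply (der_minus (dir1 m)); [exact IHm|apply der_scal, der_sin_lin]|ring].
Qed.
Lemma fej_derive m x : is_derive (fej m) x (fej1 m x).
Proof. induction m; simpl; [apply der_const|apply (der_plus (fej m)); auto using dir_derive]. Qed.
Lemma fej1_derive m x : is_derive (fej1 m) x (fej2 m x).
Proof. induction m; simpl; [apply der_const|apply (der_plus (fej1 m)); auto using dir1_derive]. Qed.

Lemma dir_identity m x : dir m x * (1 - cos x) = cos (INR m * x) - cos (INR (S m) * x).
Proof.
  induction m.
  - simpl. rewrite Rmult_0_l, cos_0, !Rmult_1_l. ring.
  - change (dir (S m) x) with (dir m x + 2 * cos (INR (S m) * x)). rewrite Rmult_plus_distr_r, IHm, (S_INR (S m)).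
    assert (E : INR m * x = INR (S m) * x - x) by (rewrite S_INR; ring). rewrite E.
    rewrite cos_minus, (Rmult_plus_distr_r (INR (S m)) 1 x), Rmult_1_l, cos_plus. ring.
Qed.
Lemma fej_identity M x : fej M x * (1 - cos x) = 1 - cos (INR M * x).
Proof.
  induction M; [simpl; rewrite !Rmult_0_l, cos_0; ring|].
  change (fej (S M) x) with (fej M x + dir M x). rewrite Rmult_plus_distr_r, IHM, dir_identity. ring.
Qed.

(** Obtained by differentiating [fej_identity]; keeping the factor [1 - cos x] avoids quotients that
    are singular at 0. *)
Lemma fej1_identity M x : fej1 M x * (1 - cos x) + fej M x * sin x = INR M * sin (INR M * x).
Proof.
  assert (D1 : is_derive (fun x => fej M x * (1 - cos x)) x (fej1 M x * (1 - cos x) + fej M x * (0 - - sin x))).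
  { apply (der_mult (fej M) (fun x => 1 - cos x)); [apply fej_derive|apply (der_minus (fun _ => 1) cos); [apply der_const|apply is_derive_cos]]. }
  assert (D2 : is_derive (fun x => 1 - cos (INR M * x)) x (0 - - INR M * sin (INR M * x))).
  { apply der_minus; [apply der_const|apply der_cos_lin]. }
  apply (der_ext _ (fun x => 1 - cos (INR M * x))) in D1; [|apply fej_identity].
  assert (E := der_unique _ _ _ _ D1 D2). lra.
Qed.
Lemma fej2_identity M x :
  fej2 M x * (1 - cos x) + 2 * (fej1 M x * sin x) + fej M x * cos x = INR M ^ 2 * cos (INR M * x).
Proof.
  assert (D1 : is_derive (fun x => fej1 M x * (1 - cos x) + fej M x * sin x) x
    ((fej2 M x * (1 - cos x) + fej1 M x * (0 - - sin x)) + (fej1 M x * sin x + fej M x * cos x))).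
  { apply (der_plus (fun x => fej1 M x * (1 - cos x)) (fun x => fej M x * sin x)); [apply (der_mult (fej1 M) (fun x => 1 - cos x))|apply (der_mult (fej M) sin)];
      [apply fej1_derive|apply (der_minus (fun _ => 1) cos); [apply der_const|apply is_derive_cos]|apply fej_derive|apply is_derive_sin]. }
  assert (D2 : is_derive (fun x => INR M * sin (INR M * x)) x (INR M * (INR M * cos (INR M * x)))).
  { apply der_scal, der_sin_lin. }
  apply (der_ext _ (fun x => INR M * sin (INR M * x))) in D1; [|apply fej1_identity].
  assert (E := der_unique _ _ _ _ D1 D2).
  simpl. lra.
Qed.

Lemma cos_abs_le x : Rabs (cos x) <= 1.
Proof. apply Rabs_le. apply COS_bound. Qed.
Lemma sin_abs_le x : Rabs (sin x) <= 1.
Proof. apply Rabs_le. apply SIN_bound. Qed.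

Lemma fej_nonneg M x : 0 <= fej M x.
Proof.
  destruct (Req_dec (cos x) 1) as [E|E].
  (* Where [cos x = 1] the closed form degenerates, but there every cosine in the sum equals 1. *)
  - assert (Es : sin x = 0). { generalize (sin2_cos2 x). unfold Rsqr. rewrite E. nra. }
    assert (Hc : forall m, cos (INR m * x) = 1).
    { induction m; [simpl; rewrite Rmult_0_l; apply cos_0|].
      rewrite S_INR, Rmult_plus_distr_r, Rmult_1_l, cos_plus, IHm, E, Es. ring. }
    assert (Hd : forall m, 0 <= dir m x).
    { induction m; [simpl; lra|]. change (dir (S m) x) with (dir m x + 2 * cos (INR (S m) * x)). rewrite Hc. lra. }
    induction M; simpl; [lra|]. generalize (Hd M). lra.
  - generalize (fej_identity M x) (COS_bound x) (COS_bound (INR M * x)). intros. nra.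
Qed.

Lemma dir_bounds m x : Rabs (dir m x) <= 2 * INR m + 1 /\ Rabs (dir1 m x) <= INR m * (INR m + 1) /\
  Rabs (dir2 m x) <= 2 * INR m * INR m * (INR m + 1).
Proof.
  induction m as [|m [H1 [H2 H3]]].
  - simpl. rewrite Rabs_R1, Rabs_R0. lra.
  - assert (Hm := pos_INR m).
    assert (Hc := cos_abs_le (INR (S m) * x)). assert (Hs := sin_abs_le (INR (S m) * x)).
    assert (HS := S_INR m).
    split; [|split].
    + change (dir (S m) x) with (dir m x + 2 * cos (INR (S m) * x)).
      eapply Rle_trans; [apply Rabs_triang|]. rewrite Rabs_mult, (Rabs_pos_eq 2), HS in * by lra. lra.
    + change (dir1 (S m) x) with (dir1 m x - 2 * INR (S m) * sin (INR (S m) * x)).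
      eapply Rle_trans; [apply Rabs_triang|]. rewrite Rabs_Ropp, Rabs_mult, (Rabs_pos_eq (2 * INR (S m))) by lra. rewrite HS in *. nra.
    + change (dir2 (S m) x) with (dir2 m x - 2 * INR (S m) ^ 2 * cos (INR (S m) * x)).
      eapply Rle_trans; [apply Rabs_triang|].
      assert (0 <= INR (S m) ^ 2) by apply pow2_ge_0.
      rewrite Rabs_Ropp, Rabs_mult, (Rabs_pos_eq (2 * INR (S m) ^ 2)) by lra. rewrite HS in *. 
      apply Rle_trans with (2 * INR m * INR m * (INR m + 1) + 2 * (INR m + 1) ^ 2 * 1).
      * apply Rplus_le_compat; trivial. apply Rmult_le_compat_l; lra.
      * simpl. nra.
Qed.
Lemma fej_bounds M x : fej M x <= INR M ^ 2 /\ Rabs (fej1 M x) <= INR M ^ 3 /\ Rabs (fej2 M x) <= INR M ^ 4.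
Proof.
  induction M as [|m [H1 [H2 H3]]].
  - simpl. rewrite Rabs_R0. lra.
  - assert (Hm := pos_INR m). destruct (dir_bounds m x) as [K1 [K2 K3]].
    simpl fej; simpl fej1; simpl fej2. rewrite S_INR.
    apply Rabs_le_between in K1.
    split; [simpl in *; nra|split].
    + eapply Rle_trans; [apply Rabs_triang|]. simpl in *. nra.
    + eapply Rle_trans; [apply Rabs_triang|].
      apply Rle_trans with (INR m ^ 4 + 2 * INR m * INR m * (INR m + 1)); [lra|]. simpl. nra.
Qed.

(** From [1 - cos y = 2 * sin (y / 2) ^ 2] and [sin t >= t / 3] on [[0, 2]]. The range 4 allows for
    the distortion by the flow, which maps [[- PI, PI]] to displacements below [5 / 4 * PI < 4]. *)
Lemma one_minus_cos_lower y : Rabs y <= 4 -> y ^ 2 / 18 <= 1 - cos y.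
Proof.
  intro Hy.
  assert (K : forall t, 0 <= t <= 2 -> t / 3 <= sin t).
  { intros t Ht. destruct (pre_sin_bound t 0 ltac:(lra) ltac:(lra)) as [Hl _].
    eapply Rle_trans; [|exact Hl]. unfold sin_approx, sin_term. simpl. nra. }
  assert (E : 1 - cos y = 2 * sin (Rabs y / 2) ^ 2).
  { replace (cos y) with (cos (Rabs y)) by (unfold Rabs; destruct (Rcase_abs y); [apply cos_neg|trivial]).
    replace (Rabs y) with (2 * (Rabs y / 2)) at 1 by field. rewrite cos_2a_sin. ring. }
  rewrite E. generalize (K (Rabs y / 2)). generalize (Rabs_pos y) (pow2_abs y). intros. 
  assert (Rabs y / 2 / 3 <= sin (Rabs y / 2)) by (apply K; lra). nra.
Qed.

Lemma sin_sq_le y : sin y ^ 2 <= 2 * (1 - cos y).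
Proof. generalize (sin2_cos2 y) (COS_bound y). unfold Rsqr. nra. Qed.

Lemma abs_le_of_sq a b : 0 <= b -> a ^ 2 <= b ^ 2 -> Rabs a <= b.
Proof. intros Hb H. apply Rsqr_incr_0_var; trivial. unfold Rsqr. rewrite <- Rabs_mult, Rabs_pos_eq; nra. Qed.

(** [env] is the profile of a Fejer kernel: height [M ^ 2], decay [1 / y ^ 2]. [pois], which is
    [env / M], has the shape of a Poisson kernel, with integral over the line independent of [M]. *)
Definition env (M y : R) : R := M ^ 2 / (1 + (M * y) ^ 2).
Definition pois (M y : R) : R := M / (1 + (M * y) ^ 2).

(** Merges a bound at the peak with a decay bound. The 36 is [2 * 18]: the kernel identities yield
    [Q * (1 - cos y) <= 2 * c], and [one_minus_cos_lower] costs 18. *)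
Lemma le_env (M y c Q : R) : 0 <= Q -> Q <= c * M ^ 2 -> Q * y ^ 2 <= 36 * c -> Q <= 37 * c * env M y.
Proof.
  intros HQ H1 H2. unfold env. assert (0 < 1 + (M * y) ^ 2) by nra.
  replace (37 * c * (M ^ 2 / (1 + (M * y) ^ 2))) with ((37 * c * M ^ 2) / (1 + (M * y) ^ 2)) by (field; lra).
  apply Rle_div_r; [lra|]. replace (Q * (1 + (M * y) ^ 2)) with (Q + M ^ 2 * (Q * y ^ 2)) by ring.
  generalize (pow2_ge_0 M). nra.
Qed.

(** Each derivative costs a factor [M]. The differentiated identities are solved for the highest
    derivative, and the lower ones multiplied by [sin y] are absorbed with
    [sin y ^ 2 <= 2 * (1 - cos y)]. *)
Lemma fej_envelope (M : nat) y : (1 <= M)%nat -> Rabs y <= 4 ->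
  fej M y <= 37 * env (INR M) y /\ Rabs (fej1 M y) <= 74 * INR M * env (INR M) y /\
  Rabs (fej2 M y) <= 148 * INR M ^ 2 * env (INR M) y.
Proof.
  intros HM Hy. assert (HM1 : 1 <= INR M) by (apply (le_INR 1); trivial).
  destruct (fej_bounds M y) as [B0 [B1 B2]]. assert (P := fej_nonneg M y).
  assert (I0 := fej_identity M y). assert (I1 := fej1_identity M y). assert (I2 := fej2_identity M y).
  assert (L := one_minus_cos_lower y Hy). assert (S2 := sin_sq_le y).
  assert (Cb := COS_bound (INR M * y)).
  set (m := INR M) in *. set (F := fej M y) in *. set (F1 := fej1 M y) in *. set (F2 := fej2 M y) in *.
  set (d := 1 - cos y) in *.
  assert (Hd : 0 <= d) by (generalize (pow2_ge_0 y); lra).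
  assert (A0 : F * d <= 2) by lra.
  assert (A1 : Rabs (F * sin y) <= 2 * m).
  { apply abs_le_of_sq; [lra|]. replace ((F * sin y) ^ 2) with (F * (F * sin y ^ 2)) by ring.
    assert (F * sin y ^ 2 <= 4) by nra. replace ((2 * m) ^ 2) with (m ^ 2 * 4) by ring.
    assert (0 <= F * sin y ^ 2) by (apply Rmult_le_pos; [trivial|apply pow2_ge_0]).
    apply Rmult_le_compat; trivial. }
  assert (A2 : Rabs F1 * d <= 3 * m).
  { rewrite <- (Rabs_pos_eq d), <- Rabs_mult by trivial.
    replace (F1 * d) with (m * sin (m * y) + - (F * sin y)) by lra.
    eapply Rle_trans; [apply Rabs_triang|]. rewrite Rabs_Ropp, Rabs_mult, (Rabs_pos_eq m) by lra.
    generalize (sin_abs_le (m * y)). nra. }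
  assert (A3 : Rabs (F1 * sin y) <= 3 * m ^ 2).
  { apply abs_le_of_sq; [nra|]. rewrite <- pow2_abs, Rabs_mult.
    replace ((Rabs F1 * Rabs (sin y)) ^ 2) with (Rabs F1 * (Rabs F1 * Rabs (sin y) ^ 2)) by ring. rewrite pow2_abs.
    assert (Rabs F1 * sin y ^ 2 <= 6 * m) by (generalize (Rabs_pos F1); nra).
    assert (0 <= Rabs F1 * sin y ^ 2) by (apply Rmult_le_pos; [apply Rabs_pos|apply pow2_ge_0]).
    replace ((3 * m ^ 2) ^ 2) with (m ^ 3 * (9 * m)) by ring.
    apply Rmult_le_compat; trivial; try apply Rabs_pos. nra. }
  assert (A4 : Rabs F2 * d <= 8 * m ^ 2).
  { rewrite <- (Rabs_pos_eq d), <- Rabs_mult by trivial.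
    replace (F2 * d) with (m ^ 2 * cos (m * y) + - (2 * (F1 * sin y)) + - (F * cos y)) by lra.
    eapply Rle_trans; [apply Rabs_triang|]. eapply Rle_trans; [apply Rplus_le_compat_r, Rabs_triang|].
    rewrite !Rabs_Ropp, (Rabs_mult 2), (Rabs_pos_eq 2) by lra.
    rewrite (Rabs_mult (m ^ 2)), (Rabs_pos_eq (m ^ 2)), (Rabs_mult F), (Rabs_pos_eq F) by (trivial; apply pow2_ge_0).
    generalize (cos_abs_le (m * y)) (cos_abs_le y) (Rabs_pos (cos y)) (Rabs_pos (cos (m * y))) (pow2_ge_0 m). nra. }
  assert (Y : forall Q, 0 <= Q -> Q * y ^ 2 <= 18 * (Q * d)) by (intros; nra).
  split; [|split].
  - replace 37 with (37 * 1) by ring. apply le_env; trivial; [lra|]. generalize (Y F P). lra.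
  - replace (74 * m) with (37 * (2 * m)) by ring. apply le_env; [apply Rabs_pos| |].
    + eapply Rle_trans; [apply B1|]. simpl. nra.
    + generalize (Y _ (Rabs_pos F1)). lra.
  - replace (148 * m ^ 2) with (37 * (4 * m ^ 2)) by ring. apply le_env; [apply Rabs_pos| |].
    + eapply Rle_trans; [apply B2|]. simpl. generalize (pow2_ge_0 (m ^ 2)). simpl. nra.
    + generalize (Y _ (Rabs_pos F2)). nra.
Qed.

(** * The test kernel and the sawtooth *)

(** Multiplying by a cosine sum with nonnegative coefficients multiplies the weight by the value of
    that sum at 0, here [2 * m + 1]; for [fej M] it is [M ^ 2]. *)
Lemma pos_sine_poly_mult_dir a b W f m : pos_sine_poly a b W f ->
  pos_sine_poly (a - Z.of_nat m) (b + Z.of_nat m) ((2 * INR m + 1) * W) (fun x => f x * dir m x).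
Proof.
  intro H. induction m.
  - apply pos_sine_poly_ext with W f; [intro; simpl; ring|simpl; ring|]. apply pos_sine_poly_weaken with a b; trivial; lia.
  - apply pos_sine_poly_ext with ((2 * INR m + 1) * W + 2 * W)
      (fun x => f x * dir m x + 2 * (f x * cos (IZR (Z.of_nat (S m)) * x))).
    + intro x. change (dir (S m) x) with (dir m x + 2 * cos (INR (S m) * x)). rewrite <- INR_IZR_INZ. ring.
    + rewrite S_INR. ring.
    + apply pos_sine_poly_plus.
      * apply pos_sine_poly_weaken with (a - Z.of_nat m)%Z (b + Z.of_nat m)%Z; trivial; lia.
      * apply (pos_sine_poly_scal _ _ 2 W (fun x => f x * cos (IZR (Z.of_nat (S m)) * x))); [lra|]. apply pos_sine_poly_mult_cos; trivial. lia.
Qed.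

Lemma pos_sine_poly_mult_fej a b W f M : pos_sine_poly a b W f ->
  pos_sine_poly (a - Z.of_nat M) (b + Z.of_nat M) (INR M ^ 2 * W) (fun x => f x * fej M x).
Proof.
  intro H. induction M.
  - apply pos_sine_poly_ext with 0 (fun _ => 0); [intro; simpl; ring|simpl; ring|apply pos_sine_poly_zero].
  - apply pos_sine_poly_ext with (INR M ^ 2 * W + (2 * INR M + 1) * W) (fun x => f x * fej M x + f x * dir M x).
    + intro x. simpl. ring.
    + rewrite S_INR. ring.
    + apply pos_sine_poly_plus.
      * apply pos_sine_poly_weaken with (a - Z.of_nat M)%Z (b + Z.of_nat M)%Z; trivial; lia.
      * apply pos_sine_poly_weaken with (a - Z.of_nat M)%Z (b + Z.of_nat M)%Z; [lia|lia|]. apply pos_sine_poly_mult_dir; trivial.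
Qed.

(* For [M = 2^J] the frequencies of [psi M] lie in [43 M, 47 M], inside (4/3, 3/2) 2^(J+5), where one
   dyadic weight is 1 and all others vanish. *)
Definition psi (M : nat) (y : R) : R := fej M y ^ 2 * sin (45 * INR M * y) / INR M ^ 3.
Definition psi1 (M : nat) (y : R) : R :=
  (2 * (fej M y * fej1 M y) * sin (45 * INR M * y) + 45 * INR M * fej M y ^ 2 * cos (45 * INR M * y)) / INR M ^ 3.
Definition psi2 (M : nat) (y : R) : R :=
  ((2 * fej1 M y ^ 2 + 2 * (fej M y * fej2 M y) - (45 * INR M) ^ 2 * fej M y ^ 2) * sin (45 * INR M * y)
   + 4 * (45 * INR M) * (fej M y * fej1 M y) * cos (45 * INR M * y)) / INR M ^ 3.

Lemma psi_derive M y : is_derive (psi M) y (psi1 M y).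
Proof.
  unfold psi, psi1, Rdiv. eapply der_eq.
  - apply der_mult; [|apply der_const]. apply (der_mult (fun y => fej M y ^ 2) (fun y => sin (45 * INR M * y))).
    + apply der_pow, fej_derive.
    + apply der_sin_lin.
  - cbv beta. simpl INR. simpl pred. ring.
Qed.
Lemma psi1_derive M y : is_derive (psi1 M) y (psi2 M y).
Proof.
  unfold psi1, psi2, Rdiv. eapply der_eq.
  - apply der_mult; [|apply der_const]. apply der_plus.
    + apply (der_mult (fun y => 2 * (fej M y * fej1 M y)) (fun y => sin (45 * INR M * y))).
      * apply der_scal. apply (der_mult (fej M) (fej1 M)); [apply fej_derive|apply fej1_derive].
      * apply der_sin_lin.
    + apply (der_mult (fun y => 45 * INR M * fej M y ^ 2) (fun y => cos (45 * INR M * y))).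
      * apply der_scal, der_pow, fej_derive.
      * apply der_cos_lin.
  - cbv beta. simpl INR. simpl pred. ring.
Qed.

(** Each of the two Fejer factors widens the spectrum by [M] on both sides and multiplies the weight
    by [M ^ 2]; division by [M ^ 3] leaves the weight [M]. *)
Lemma psi_pos_sine_poly M : (1 <= M)%nat -> pos_sine_poly (43 * Z.of_nat M) (47 * Z.of_nat M) (INR M) (psi M).
Proof.
  intro HM. assert (H1 : 1 <= INR M) by (apply (le_INR 1); trivial).
  assert (S0 : pos_sine_poly (45 * Z.of_nat M) (45 * Z.of_nat M) 1 (fun x => sin (IZR (45 * Z.of_nat M) * x))) by (apply pos_sine_poly_sin; lia).
  assert (S2 := pos_sine_poly_mult_fej _ _ _ _ M (pos_sine_poly_mult_fej _ _ _ _ M S0)).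
  apply (pos_sine_poly_scal _ _ (/ INR M ^ 3)) in S2; [|left; apply Rinv_0_lt_compat, pow_lt; lra].
  apply (pos_sine_poly_weaken _ _ (43 * Z.of_nat M) (47 * Z.of_nat M)) in S2; [|lia|lia].
  eapply pos_sine_poly_ext; [| |exact S2].
  - intro x. cbv beta. unfold psi. rewrite mult_IZR, <- INR_IZR_INZ. field. lra.
  - field. lra.
Qed.

Lemma psi_odd M y : psi M (- y) = - psi M y.
Proof.
  assert (Hd : forall m, dir m (- y) = dir m y).
  { induction m; trivial. change (dir (S m) (- y)) with (dir m (- y) + 2 * cos (INR (S m) * - y)).
    rewrite IHm, Ropp_mult_distr_r_reverse, cos_neg. trivial. }
  assert (Hf : fej M (- y) = fej M y).
  { induction M; trivial. simpl. rewrite IHM, Hd. trivial. }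
  unfold psi. rewrite Hf, Ropp_mult_distr_r_reverse, sin_neg. unfold Rdiv. ring.
Qed.

Lemma env_facts M y : 1 <= M -> 0 <= env M y /\ env M y <= M ^ 2 /\ y ^ 2 * env M y <= 1 /\
  Rabs y * env M y <= M / 2 /\ env M y = M * pois M y /\ 0 <= pois M y.
Proof.
  intro HM. unfold env, pois. assert (H0 : 0 < 1 + (M * y) ^ 2) by (generalize (pow2_ge_0 (M * y)); lra).
  assert (HM2 : 0 <= M ^ 2) by apply pow2_ge_0.
  repeat split.
  - apply Rle_div_r; lra.
  - apply Rle_div_l; [lra|]. generalize (pow2_ge_0 (M * y)). nra.
  - replace (y ^ 2 * (M ^ 2 / (1 + (M * y) ^ 2))) with ((M * y) ^ 2 / (1 + (M * y) ^ 2)) by (field; lra).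
    apply Rle_div_l; lra.
  - replace (Rabs y * (M ^ 2 / (1 + (M * y) ^ 2))) with ((Rabs y * M ^ 2) / (1 + (M * y) ^ 2)) by (field; lra).
    apply Rle_div_l; [lra|].
    assert (E : (M * y) ^ 2 = (M * Rabs y) ^ 2) by (rewrite !Rpow_mult_distr, pow2_abs; trivial).
    rewrite E. generalize (pow2_ge_0 (M * Rabs y - 1)). nra.
  - field. lra.
  - apply Rle_div_r; lra.
Qed.

(** Leibniz rule with the constants 37, 74, 148 of [fej_envelope]: [1369 = 37 ^ 2], and the larger
    numbers are dominated by the terms where the derivatives fall on the carrier of frequency
    [45 * M]. *)
Lemma psi_env M y : (1 <= M)%nat -> Rabs y <= 4 ->
  Rabs (psi M y) <= 1369 * (env (INR M) y ^ 2 / INR M ^ 3) /\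
  Rabs (psi1 M y) <= 67081 * (env (INR M) y ^ 2 / INR M ^ 2) /\
  Rabs (psi2 M y) <= 3286969 * (env (INR M) y ^ 2 / INR M).
Proof.
  intros HM Hy. assert (H1 : 1 <= INR M) by (apply (le_INR 1); trivial).
  destruct (fej_envelope M y HM Hy) as [B0 [B1 B2]].
  destruct (env_facts (INR M) y H1) as [He _].
  unfold psi, psi1, psi2.
  assert (P := fej_nonneg M y).
  assert (Hs := sin_abs_le (45 * INR M * y)). assert (Hc := cos_abs_le (45 * INR M * y)).
  set (s := sin (45 * INR M * y)) in *. set (c := cos (45 * INR M * y)) in *.
  set (e := env (INR M) y) in *. set (m := INR M) in *.
  set (F := fej M y) in *. set (F1 := fej1 M y) in *. set (F2 := fej2 M y) in *.
  assert (Hm3 : 0 < m ^ 3) by (apply pow_lt; lra).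
  assert (Q : forall a b k, Rabs a <= k * b -> Rabs (a / m ^ 3) <= k * (b / m ^ 3)).
  { intros a b k K. unfold Rdiv. rewrite Rabs_mult, (Rabs_pos_eq (/ _)) by (left; apply Rinv_0_lt_compat; trivial).
    rewrite <- Rmult_assoc. apply Rmult_le_compat_r; trivial. left; apply Rinv_0_lt_compat; trivial. }
  assert (FF : F ^ 2 <= 1369 * e ^ 2) by (simpl; nra).
  assert (F0 : 0 <= F ^ 2) by apply pow2_ge_0.
  assert (FF1 : F * Rabs F1 <= 2738 * m * e ^ 2).
  { replace (2738 * m * e ^ 2) with ((37 * e) * (74 * m * e)) by ring. apply Rmult_le_compat; trivial; apply Rabs_pos. }
  assert (FF2 : F * Rabs F2 <= 5476 * m ^ 2 * e ^ 2).
  { replace (5476 * m ^ 2 * e ^ 2) with ((37 * e) * (148 * m ^ 2 * e)) by ring. apply Rmult_le_compat; trivial; apply Rabs_pos. }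
  assert (F11 : Rabs F1 ^ 2 <= 5476 * m ^ 2 * e ^ 2).
  { replace (5476 * m ^ 2 * e ^ 2) with ((74 * m * e) ^ 2) by ring. apply pow_incr. split; [apply Rabs_pos|trivial]. }
  assert (S1 : forall a b, Rabs a <= b -> Rabs (a * s) <= b).
  { intros a b K. rewrite Rabs_mult. generalize (Rabs_pos a) (Rabs_pos s). nra. }
  assert (S2 : forall a b, Rabs a <= b -> Rabs (a * c) <= b).
  { intros a b K. rewrite Rabs_mult. generalize (Rabs_pos a) (Rabs_pos c). nra. }
  assert (AF1 : Rabs (F * F1) = F * Rabs F1) by (rewrite Rabs_mult, (Rabs_pos_eq F) by trivial; trivial).
  assert (AF2 : Rabs (F * F2) = F * Rabs F2) by (rewrite Rabs_mult, (Rabs_pos_eq F) by trivial; trivial).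
  split; [|split].
  - apply Q. apply S1. rewrite Rabs_pos_eq; trivial.
  - replace (67081 * (e ^ 2 / m ^ 2)) with (67081 * m * (e ^ 2 / m ^ 3)) by (field; lra). apply Q.
    eapply Rle_trans; [apply Rabs_triang|].
    apply Rle_trans with (2 * (2738 * m * e ^ 2) + 45 * m * (1369 * e ^ 2)); [|right; ring].
    apply Rplus_le_compat; [apply S1|apply S2].
    + rewrite Rabs_mult, (Rabs_pos_eq 2), AF1 by lra. lra.
    + rewrite Rabs_mult, (Rabs_pos_eq (F ^ 2)), Rabs_pos_eq by (trivial; lra). apply Rmult_le_compat_l; lra.
  - replace (3286969 * (e ^ 2 / m)) with (3286969 * m ^ 2 * (e ^ 2 / m ^ 3)) by (field; lra). apply Q.
    eapply Rle_trans; [apply Rabs_triang|].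
    apply Rle_trans with ((2 * (5476 * m ^ 2 * e ^ 2) + 2 * (5476 * m ^ 2 * e ^ 2) + (45 * m) ^ 2 * (1369 * e ^ 2)) + 4 * (45 * m) * (2738 * m * e ^ 2)); [|right; ring].
    apply Rplus_le_compat; [apply S1|apply S2].
    + eapply Rle_trans; [apply Rabs_triang|]. rewrite Rabs_Ropp.
      eapply Rle_trans; [apply Rplus_le_compat_r, Rabs_triang|].
      rewrite (Rabs_mult 2), (Rabs_mult 2), (Rabs_pos_eq 2), AF2, <- RPow_abs, (Rabs_mult _ (F ^ 2)), (Rabs_pos_eq (F ^ 2)), (Rabs_pos_eq ((45 * m) ^ 2))
        by (trivial; try apply pow2_ge_0; lra).
      assert ((45 * m) ^ 2 * F ^ 2 <= (45 * m) ^ 2 * (1369 * e ^ 2)) by (apply Rmult_le_compat_l; trivial; apply pow2_ge_0).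
      lra.
    + rewrite Rabs_mult, AF1, Rabs_pos_eq by lra. apply Rmult_le_compat_l; lra.
Qed.

(* Any bound for the constants of [psi_env]. *)
Definition kernel_const : R := 10000000.

(** This is where the square of the Fejer kernel in [psi] matters: [psi2] is of order [env ^ 2 / M],
    so after [y ^ 2 * env <= 1] one integrable factor [env] remains. A single Fejer factor would
    leave none. *)
Lemma psi_bounds M y : (1 <= M)%nat -> Rabs y <= 4 ->
  Rabs (psi M y) <= kernel_const * pois (INR M) y /\
  Rabs y * Rabs (psi M y) <= kernel_const * (pois (INR M) y / INR M) /\
  Rabs (psi1 M y) <= kernel_const * (INR M * pois (INR M) y) /\
  Rabs y * Rabs (psi1 M y) <= kernel_const * pois (INR M) y /\
  y ^ 2 * Rabs (psi2 M y) <= kernel_const * pois (INR M) y /\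
  Rabs (psi2 M y) <= kernel_const * INR M ^ 3.
Proof.
  intros HM Hy. assert (H1 : 1 <= INR M) by (apply (le_INR 1); trivial).
  destruct (psi_env M y HM Hy) as [B0 [B1 B2]].
  destruct (env_facts (INR M) y H1) as [E0 [E1 [E2 [E3 [E4 E5]]]]].
  set (e := env (INR M) y) in *. set (m := INR M) in *. set (p := pois m y) in *.
  assert (Hm : 0 < m) by lra.
  assert (D : forall a k n, a <= k * m ^ n -> a / m ^ n <= k).
  { intros a k n K. apply Rle_div_l; trivial. apply pow_lt; trivial. }
  unfold kernel_const.
  assert (I1 : 0 < / m) by (apply Rinv_0_lt_compat; trivial).
  assert (Y := Rabs_pos y).
  assert (e2 : e ^ 2 <= m ^ 2 * (m * p)) by (rewrite <- E4; simpl; nra).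
  assert (ye2 : Rabs y * e ^ 2 <= m / 2 * (m * p)).
  { rewrite <- E4. replace (Rabs y * e ^ 2) with (Rabs y * e * e) by ring. apply Rmult_le_compat_r; trivial. }
  assert (yye2 : y ^ 2 * e ^ 2 <= m * p).
  { rewrite <- E4. replace (y ^ 2 * e ^ 2) with (y ^ 2 * e * e) by ring. nra. }
  assert (e4 : e ^ 2 <= m ^ 4) by (replace (m ^ 4) with ((m ^ 2) ^ 2) by ring; apply pow_incr; lra).
  repeat split.
  - assert (e ^ 2 / m ^ 3 <= p) by (apply D; lra). lra.
  - apply Rle_trans with (Rabs y * (1369 * (e ^ 2 / m ^ 3))); [apply Rmult_le_compat_l; trivial|].
    assert (K : Rabs y * e ^ 2 / m ^ 3 <= p / m).
    { apply D. replace (p / m * m ^ 3) with (m * (m * p)) by (field; lra). nra. }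
    replace (Rabs y * (1369 * (e ^ 2 / m ^ 3))) with (1369 * (Rabs y * e ^ 2 / m ^ 3)) by (field; lra).
    assert (0 <= p / m) by (apply Rmult_le_pos; lra). lra.
  - assert (e ^ 2 / m ^ 2 <= m * p) by (apply D; lra). assert (0 <= m * p) by nra. lra.
  - apply Rle_trans with (Rabs y * (67081 * (e ^ 2 / m ^ 2))); [apply Rmult_le_compat_l; trivial|].
    assert (K : Rabs y * e ^ 2 / m ^ 2 <= p) by (apply D; nra).
    replace (Rabs y * (67081 * (e ^ 2 / m ^ 2))) with (67081 * (Rabs y * e ^ 2 / m ^ 2)) by (field; lra). lra.
  - apply Rle_trans with (y ^ 2 * (3286969 * (e ^ 2 / m))); [apply Rmult_le_compat_l; trivial; apply pow2_ge_0|].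
    assert (K : y ^ 2 * e ^ 2 / m ^ 1 <= p) by (apply D; simpl; lra). rewrite pow_1 in K.
    replace (y ^ 2 * (3286969 * (e ^ 2 / m))) with (3286969 * (y ^ 2 * e ^ 2 / m)) by (field; lra). lra.
  - assert (K : e ^ 2 / m ^ 1 <= m ^ 3) by (apply D; simpl in *; lra). rewrite pow_1 in K.
    assert (0 <= m ^ 3) by (apply pow_le; lra). lra.
Qed.

Fixpoint sumN (f : nat -> R -> R) (N : nat) (y : R) : R :=
  match N with O => 0 | S N' => sumN f N' y + f N' y end.

Lemma sumN_derive f g N : (forall n y, is_derive (f n) y (g n y)) -> forall y, is_derive (sumN f N) y (sumN g N y).
Proof. intros H y. induction N; simpl; [apply der_const|apply (der_plus (sumN f N)); auto]. Qed.
Lemma sumN_cont1 f N : (forall n, cont1 (f n)) -> cont1 (sumN f N).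
Proof. intros H. induction N; simpl; [apply cont1_const|apply (cont1_plus (sumN f N)); auto]. Qed.
Lemma sumN_abs_le f g N w y c : 0 <= w -> (forall n, w * Rabs (f n y) <= c * g n y) -> w * Rabs (sumN f N y) <= c * sumN g N y.
Proof.
  intros Hw H. induction N; simpl; [rewrite Rabs_R0; lra|].
  apply Rle_trans with (w * (Rabs (sumN f N y) + Rabs (f N y))).
  - apply Rmult_le_compat_l; trivial. apply Rabs_triang.
  - generalize (H N). lra.
Qed.

Definition pow2n (n : nat) : nat := (2 ^ n)%nat.
Lemma pow2n_pos n : (1 <= pow2n n)%nat.
Proof. unfold pow2n. generalize (Nat.pow_nonzero 2 n). lia. Qed.
Lemma INR_pow2n n : INR (pow2n n) = 2 ^ n.
Proof. unfold pow2n. rewrite pow_INR. trivial. Qed.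

(* A smoothed Hilbert kernel: [ker N y] behaves like [1/y] for [2^-N <= |y| <= 1]. *)
Definition ker N := sumN (fun n => psi (pow2n n)) N.
Definition ker1 N := sumN (fun n => psi1 (pow2n n)) N.
Definition ker2 N := sumN (fun n => psi2 (pow2n n)) N.
(** Majorants summed over the dyadic scales. Integrals of [poisN] grow like [N]; the extra division
    in [poisN'] makes the sum geometric. *)
Definition poisN N := sumN (fun n => pois (INR (pow2n n))) N.
Definition poisN' N := sumN (fun n y => pois (INR (pow2n n)) y / INR (pow2n n)) N.

Lemma ker_derive N y : is_derive (ker N) y (ker1 N y).
Proof. apply sumN_derive. intros; apply psi_derive. Qed.
Lemma ker1_derive N y : is_derive (ker1 N) y (ker2 N y).
Proof. apply sumN_derive. intros; apply psi1_derive. Qed.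

(** A factor [|y|] is worth one scale: it either compensates one derivative of the kernel or
    replaces [poisN] by [poisN']. *)
Lemma ker_bounds N y : Rabs y <= 4 ->
  Rabs (ker N y) <= kernel_const * poisN N y /\
  Rabs y * Rabs (ker N y) <= kernel_const * poisN' N y /\
  Rabs y * Rabs (ker1 N y) <= kernel_const * poisN N y /\
  y ^ 2 * Rabs (ker2 N y) <= kernel_const * poisN N y.
Proof.
  intro Hy. assert (B := fun n => psi_bounds (pow2n n) y (pow2n_pos n) Hy).
  repeat split.
  - rewrite <- (Rmult_1_l (Rabs _)). apply sumN_abs_le; [lra|]. intro n. rewrite Rmult_1_l. apply B.
  - apply sumN_abs_le; [apply Rabs_pos|]. intro n. apply B.
  - apply sumN_abs_le; [apply Rabs_pos|]. intro n. apply B.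
  - apply sumN_abs_le; [apply pow2_ge_0|]. intro n. apply B.
Qed.

Lemma ker_odd N y : ker N (- y) = - ker N y.
Proof. unfold ker. induction N; simpl; [ring|]. rewrite IHN, psi_odd. ring. Qed.

Lemma ker_periodic N : periodic2pi (ker N) /\ periodic2pi (ker1 N).
Proof.
  assert (H : forall M, (1 <= M)%nat -> periodic2pi (psi M) /\ periodic2pi (psi1 M)).
  { intros M HM. assert (T := trig_poly_of_pos_sine_poly _ _ _ _ (psi_pos_sine_poly M HM)). split; [eapply trig_poly_periodic; eassumption|].
    eapply trig_poly_periodic. eapply trig_poly_derive; [apply psi_derive|eassumption]. }
  split; intro y; unfold ker, ker1; induction N; simpl; trivial; rewrite IHN; f_equal; apply H; apply pow2n_pos.
Qed.

(** * The sawtooth and its Fejer means *)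

Fixpoint saw (m : nat) (x : R) : R :=
  match m with O => 0 | S m' => saw m' x + sin (INR m * x) / INR m end.
Fixpoint sawsum (n : nat) (x : R) : R :=
  match n with O => 0 | S n' => sawsum n' x + saw n' x end.
(** Average of the partial sums [saw 0] to [saw (n - 1)] of the Fourier series of [(PI - x) / 2] on
    [(0, 2 * PI)], which jumps at 0. Averaging brings the nonnegative Fejer kernel into its
    derivative. *)
Definition sawmean (n : nat) (x : R) : R := sawsum n x / INR n.

Lemma saw_derive m x : is_derive (saw m) x ((dir m x - 1) / 2).
Proof.
  induction m.
  - simpl. eapply der_eq; [apply der_const|field].
  - change (saw (S m)) with (fun x => saw m x + sin (INR (S m) * x) / INR (S m)).
    change (dir (S m) x) with (dir m x + 2 * cos (INR (S m) * x)).
    eapply der_eq; [apply (der_plus (saw m) (fun x => sin (INR (S m) * x) / INR (S m))); [exact IHm|unfold Rdiv; apply (der_mult (fun x => sin (INR (S m) * x)) (fun _ => / INR (S m))); [apply der_sin_lin|apply der_const]]|].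
    field. apply not_0_INR. lia.
Qed.
Lemma sawsum_derive n x : is_derive (sawsum n) x ((fej n x - INR n) / 2).
Proof.
  induction n; [simpl; eapply der_eq; [apply der_const|field]|].
  change (sawsum (S n)) with (fun x => sawsum n x + saw n x). rewrite S_INR.
  eapply der_eq; [apply (der_plus (sawsum n) (saw n)); [exact IHn|apply saw_derive]|].
  simpl. field.
Qed.
Lemma sawmean_derive n x : (1 <= n)%nat -> is_derive (sawmean n) x ((fej n x / INR n - 1) / 2).
Proof.
  intro Hn. assert (INR n <> 0) by (apply not_0_INR; lia). unfold sawmean, Rdiv at 1.
  eapply der_eq; [apply (der_mult (sawsum n) (fun _ => / INR n)); [apply sawsum_derive|apply der_const]|cbv beta; field; trivial].
Qed.

Lemma saw_odd n x : sawmean n (- x) = - sawmean n x.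
Proof.
  assert (H : forall m, saw m (- x) = - saw m x).
  { induction m; [simpl; ring|]. change (saw (S m) (- x)) with (saw m (- x) + sin (INR (S m) * - x) / INR (S m)).
    change (saw (S m) x) with (saw m x + sin (INR (S m) * x) / INR (S m)).
    rewrite IHm, Ropp_mult_distr_r_reverse, sin_neg. unfold Rdiv. ring. }
  unfold sawmean. assert (E : sawsum n (- x) = - sawsum n x) by (induction n; simpl; [ring|rewrite IHn, H; ring]).
  rewrite E. unfold Rdiv; ring.
Qed.

Lemma sawmean_periodic n : periodic2pi (sawmean n).
Proof.
  assert (H : forall m x, saw m (x + 2 * PI) = saw m x).
  { induction m; intro x; trivial.
    change (saw m (x + 2 * PI) + sin (INR (S m) * (x + 2 * PI)) / INR (S m) = saw m x + sin (INR (S m) * x) / INR (S m)).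
    rewrite IHm, INR_IZR_INZ. rewrite (proj2 (trig_periodic (Z.of_nat (S m)))). trivial. }
  intro x. unfold sawmean. f_equal. induction n; trivial. simpl. rewrite IHn, H. trivial.
Qed.

(** [sawmean n x + x / 2] is nondecreasing, with derivative [fej n x / INR n / 2], and [sawmean]
    vanishes at both ends of the period. Its values thus lie between [- PI] and [PI]. *)
Lemma sawmean_bound n x : (1 <= n)%nat -> Rabs (sawmean n x) <= 4.
Proof.
  intro Hn. assert (HP4 := PI_4).
  destruct (reduce_period x) as [k [b [E Hb]]]. rewrite E, periodic_shift_Z by apply sawmean_periodic.
  assert (Z0 : sawmean n 0 = 0) by (generalize (saw_odd n 0); rewrite Ropp_0; lra).
  assert (Z2 : sawmean n (2 * PI) = 0) by (rewrite <- Z0, <- (sawmean_periodic n 0); f_equal; ring).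
  assert (Hmono : forall a b, a <= b -> sawmean n a + a / 2 <= sawmean n b + b / 2).
  { intros u v Huv. destruct (MVT_gen (fun x => sawmean n x + x / 2) u v (fun x => fej n x / INR n / 2)) as [c [_ Ec]].
    - intros y _. eapply der_eq; [apply der_plus; [apply sawmean_derive; trivial|unfold Rdiv; apply (der_mult (fun x => x) (fun _ => / 2)); [apply der_id|apply der_const]]|cbv beta].
      field. apply not_0_INR. lia.
    - intros y _. apply continuity_pt_filterlim. apply (cont1_plus (sawmean n) (fun x => x / 2)); [eapply cont1_derive; intro; apply sawmean_derive; trivial|unfold Rdiv; auto with cont].
    - cbv beta in Ec. assert (0 <= fej n c / INR n / 2 * (v - u)); [|lra].
      apply Rmult_le_pos; [|lra]. apply Rmult_le_pos; [|lra]. apply Rmult_le_pos; [apply fej_nonneg|].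
      left; apply Rinv_0_lt_compat, lt_0_INR. lia. }
  generalize (Hmono 0 b) (Hmono b (2 * PI)). rewrite Z0, Z2. intros. apply Rabs_le. lra.
Qed.

(** * Orthogonality relations and the low-frequency gain *)

Definition zdelta (m : Z) : R := if Z.eq_dec m 0 then 1 else 0.

Lemma int_cos (m : Z) c : RInt (fun x => cos (IZR m * x)) c (c + 2 * PI) = 2 * PI * zdelta m.
Proof.
  unfold zdelta. destruct (Z.eq_dec m 0) as [E|E].
  - rewrite (rint_ext _ (fun _ => 1)); [rewrite rint_const; rring|].
    intro x. rewrite E, Rmult_0_l. apply cos_0.
  - assert (Hm : IZR m <> 0) by (apply not_0_IZR; trivial).
    rewrite (rint_ftc (fun x => / IZR m * sin (IZR m * x))); auto 20 with cont.
    + rewrite (proj2 (trig_periodic m)). rring.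
    + intro x. eapply der_eq; [apply der_scal, der_sin_lin|field; trivial].
Qed.
Lemma int_sin (m : Z) c : RInt (fun x => sin (IZR m * x)) c (c + 2 * PI) = 0.
Proof.
  destruct (Z.eq_dec m 0) as [E|E].
  - rewrite (rint_ext _ (fun _ => 0)); [rewrite rint_const; rring|].
    intro x. rewrite E, Rmult_0_l. apply sin_0.
  - assert (Hm : IZR m <> 0) by (apply not_0_IZR; trivial).
    rewrite (rint_ftc (fun x => - / IZR m * cos (IZR m * x))); auto 20 with cont.
    + rewrite (proj1 (trig_periodic m)). rring.
    + intro x. eapply der_eq; [apply der_scal, der_cos_lin|field; trivial].
Qed.
Lemma int_sin_sin (m n : Z) c :
  RInt (fun x => sin (IZR m * x) * sin (IZR n * x)) c (c + 2 * PI) = PI * (zdelta (m - n) - zdelta (m + n)).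
Proof.
  rewrite (rint_ext _ (fun x => / 2 * cos (IZR (m - n) * x) + - / 2 * cos (IZR (m + n) * x))).
  - rewrite rint_plus, !rint_scal, !int_cos by auto 20 with cont. rfield.
  - intro x. rewrite sin_mult, minus_IZR, plus_IZR, Rmult_minus_distr_r, Rmult_plus_distr_r. trivial.
Qed.
Lemma int_cos_cos (m n : Z) c :
  RInt (fun x => cos (IZR m * x) * cos (IZR n * x)) c (c + 2 * PI) = PI * (zdelta (m - n) + zdelta (m + n)).
Proof.
  rewrite (rint_ext _ (fun x => / 2 * cos (IZR (m + n) * x) + / 2 * cos (IZR (m - n) * x))).
  - rewrite rint_plus, !rint_scal, !int_cos by auto 20 with cont. rfield.
  - intro x. rewrite cos_mult, minus_IZR, plus_IZR, Rmult_minus_distr_r, Rmult_plus_distr_r. trivial.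
Qed.
Lemma int_sin_cos (m n : Z) c :
  RInt (fun x => sin (IZR m * x) * cos (IZR n * x)) c (c + 2 * PI) = 0.
Proof.
  rewrite (rint_ext _ (fun x => / 2 * sin (IZR (m + n) * x) + / 2 * sin (IZR (m - n) * x))).
  - rewrite rint_plus, !rint_scal, !int_sin by auto 20 with cont. rfield.
  - intro x. rewrite sin_cos_mult, minus_IZR, plus_IZR, Rmult_minus_distr_r, Rmult_plus_distr_r. trivial.
Qed.

Lemma saw_cont1 m : cont1 (saw m).
Proof. eapply cont1_derive. apply saw_derive. Qed.
Lemma sawsum_cont1 m : cont1 (sawsum m).
Proof. eapply cont1_derive. apply sawsum_derive. Qed.
#[export] Hint Resolve saw_cont1 sawsum_cont1 : cont.

Lemma int_saw_sin m (xi : Z) c : (1 <= xi)%Z ->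
  RInt (fun x => saw m x * sin (IZR xi * x)) c (c + 2 * PI) = if Z_le_dec xi (Z.of_nat m) then PI / IZR xi else 0.
Proof.
  intro Hxi.
  induction m.
  - destruct (Z_le_dec xi (Z.of_nat 0)); [lia|].
    rewrite (rint_ext _ (fun _ => 0)); [rewrite rint_const; rring|intro; simpl; ring].
  - rewrite (rint_ext _ (fun x => saw m x * sin (IZR xi * x) + / INR (S m) * (sin (IZR (Z.of_nat (S m)) * x) * sin (IZR xi * x)))).
    + rewrite rint_plus, rint_scal, int_sin_sin, IHm by auto 20 with cont.
      unfold zdelta. destruct (Z.eq_dec (Z.of_nat (S m) + xi) 0); [lia|].
      destruct (Z.eq_dec (Z.of_nat (S m) - xi) 0) as [e|e].
      * destruct (Z_le_dec xi (Z.of_nat m)); [lia|]. destruct (Z_le_dec xi (Z.of_nat (S m))); [|lia].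
        replace xi with (Z.of_nat (S m)) by lia. rewrite <- INR_IZR_INZ. rfield. apply not_0_INR; lia.
      * destruct (Z_le_dec xi (Z.of_nat m)); destruct (Z_le_dec xi (Z.of_nat (S m))); try lia; rring.
    + intro x. change (saw (S m) x) with (saw m x + sin (INR (S m) * x) / INR (S m)). rewrite <- INR_IZR_INZ. unfold Rdiv. ring.
Qed.

(** The mode [xi] occurs in the partial sums of index at least [xi], which are a proportion
    [1 - xi / n >= 1 / 2] of those averaged. *)
Lemma int_sawmean_sin n (xi : Z) c : (1 <= xi)%Z -> (2 * xi <= Z.of_nat n)%Z ->
  PI / (2 * IZR xi) <= RInt (fun x => sawmean n x * sin (IZR xi * x)) c (c + 2 * PI).
Proof.
  intros Hxi Hn. assert (Hx : 1 <= IZR xi) by (apply (IZR_le 1); lia). assert (HP := PI_RGT_0).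
  assert (Hq : 0 < PI / IZR xi) by (apply Rdiv_lt_0_compat; lra).
  assert (K : forall k, 0 <= RInt (fun x => sawsum k x * sin (IZR xi * x)) c (c + 2 * PI) /\
    (INR k - IZR xi) * (PI / IZR xi) <= RInt (fun x => sawsum k x * sin (IZR xi * x)) c (c + 2 * PI)).
  { induction k as [|k [K1 K2]].
    - rewrite (rint_ext _ (fun _ => 0)) by (intro; simpl; ring). rewrite rint_const, Rmult_0_r. simpl INR. split; nra.
    - rewrite (rint_ext _ (fun x => sawsum k x * sin (IZR xi * x) + saw k x * sin (IZR xi * x))) by (intro; simpl; ring).
      rewrite rint_plus, int_saw_sin by (trivial; auto 20 with cont). rewrite S_INR.
      destruct (Z_le_dec xi (Z.of_nat k)) as [h|h].
      + split; nra.
      + assert (INR k + 1 <= IZR xi). { rewrite INR_IZR_INZ, <- plus_IZR. apply IZR_le. lia. }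
        split; nra. }
  assert (Hn2 : 2 * IZR xi <= INR n) by (rewrite INR_IZR_INZ, <- mult_IZR; apply IZR_le; trivial).
  rewrite (rint_ext _ (fun x => / INR n * (sawsum n x * sin (IZR xi * x)))) by (intro; unfold sawmean, Rdiv; ring).
  rewrite rint_scal by auto 20 with cont.
  apply Rmult_le_reg_l with (INR n); [lra|].
  rewrite <- Rmult_assoc, Rinv_r, Rmult_1_l by lra.
  eapply Rle_trans; [|apply (K n)].
  replace (INR n * (PI / (2 * IZR xi))) with (INR n / 2 * (PI / IZR xi)) by (field; lra).
  apply Rmult_le_compat_r; lra.
Qed.

(** All coefficients being nonnegative, each mode may be estimated by the smallest coefficient of
    the sawtooth, the one at the top frequency [b]. *)
Lemma int_sawmean_pos_sine_poly a b W f n c : pos_sine_poly a b W f -> (1 <= a)%Z -> (1 <= b)%Z -> (2 * b <= Z.of_nat n)%Z ->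
  W * (PI / (2 * IZR b)) <= RInt (fun x => sawmean n x * f x) c (c + 2 * PI).
Proof.
  intros H Ha Hb Hn. assert (HP := PI_RGT_0).
  assert (Cs : cont1 (sawmean n)) by (unfold sawmean, Rdiv; auto with cont).
  induction H.
  - rewrite (rint_ext _ (fun _ => 0)) by (intro; ring). rewrite rint_const. lra.
  - eapply Rle_trans; [|apply int_sawmean_sin; lia]. rewrite Rmult_1_l.
    apply Rmult_le_compat_l; [lra|]. assert (1 <= IZR m) by (apply (IZR_le 1); lia).
    apply Rinv_le_contravar; [lra|]. apply Rmult_le_compat_l; [lra|]. apply IZR_le; lia.
  - assert (Cf : cont1 f) by (eapply trig_poly_cont1, trig_poly_of_pos_sine_poly; eassumption).
    rewrite (rint_ext _ (fun x => c0 * (sawmean n x * f x))) by (intro; ring). rewrite rint_scal by auto with cont.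
    rewrite Rmult_assoc. apply Rmult_le_compat_l; trivial.
  - assert (Cf : cont1 f) by (eapply trig_poly_cont1, trig_poly_of_pos_sine_poly; eassumption).
    assert (Cg : cont1 g) by (eapply trig_poly_cont1, trig_poly_of_pos_sine_poly; eassumption).
    rewrite (rint_ext _ (fun x => sawmean n x * f x + sawmean n x * g x)) by (intro; ring).
    rewrite rint_plus by auto with cont. lra.
  - rewrite <- (rint_ext (fun x => sawmean n x * f x)) by (intro; rewrite H; trivial). rewrite <- H0. trivial.
Qed.

Lemma int_odd f a : cont1 f -> (forall x, f (- x) = - f x) -> RInt f (- a) a = 0.
Proof.
  intros Cf Ho.
  assert (E := rint_subst f (fun x => - x) (fun _ => -1) (- a) a Cf).
  rewrite (rint_ext _ f) in E by (intro; rewrite Ho; ring).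
  rewrite Ropp_involutive, (rint_swap f a (- a)) in E by trivial.
  assert (RInt f (- a) a = - RInt f (- a) a); [|lra].
  apply E; auto with cont. intro x. eapply der_eq; [apply der_opp, der_id|ring].
Qed.

(** The kernel is odd, so only the cross term of the square survives. A bump of scale [M] has weight
    [M] and frequencies up to [47 * M], hence contributes at least [PI / 94 >= 1 / 32] whatever its
    scale. The hypothesis with [94 = 2 * 47] is the frequency restriction of [int_sawmean_sin] at
    the finest scale. *)
Lemma bump_pairing N n : (94 * Z.of_nat (pow2n N) <= Z.of_nat n)%Z ->
  INR N / 16 <= RInt (fun x => (1 + sawmean n x) ^ 2 * ker N x) (- PI) PI.
Proof.
  intro Hn. assert (Cs : cont1 (sawmean n)) by (unfold sawmean, Rdiv; auto with cont).
  assert (Ck : forall N, cont1 (ker N)) by (intro; eapply cont1_derive; apply ker_derive).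
  rewrite (rint_ext _ (fun x => 2 * (sawmean n x * ker N x) + (1 + sawmean n x ^ 2) * ker N x)) by (intro; simpl; ring).
  rewrite rint_plus, rint_scal by auto 20 with cont.
  rewrite (int_odd (fun x => (1 + sawmean n x ^ 2) * ker N x)), Rplus_0_r; [|auto 20 with cont|intro x; rewrite saw_odd, ker_odd; ring].
  assert (K : forall k, (k <= N)%nat -> INR k / 32 <= RInt (fun x => sawmean n x * ker k x) (- PI) PI).
  { induction k; intro Hk.
    - rewrite (rint_ext _ (fun _ => 0)) by (intro; unfold ker; simpl; ring). rewrite rint_const. simpl. lra.
    - rewrite (rint_ext _ (fun x => sawmean n x * ker k x + sawmean n x * psi (pow2n k) x)) by (intro; unfold ker; simpl; ring).
      assert (Hp := pow2n_pos k).
      assert (Cp : cont1 (psi (pow2n k))) by (eapply cont1_derive; apply psi_derive).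
      rewrite rint_plus by auto with cont. rewrite S_INR.
      assert (H47 : (2 * (47 * Z.of_nat (pow2n k)) <= Z.of_nat n)%Z).
      { assert (pow2n k <= pow2n N)%nat by (apply Nat.pow_le_mono_r; lia). lia. }
      assert (L := int_sawmean_pos_sine_poly _ _ _ _ n (- PI) (psi_pos_sine_poly (pow2n k) Hp) ltac:(lia) ltac:(lia) H47).
      replace (- PI + 2 * PI) with PI in L by ring.
      assert (H1 : 1 <= INR (pow2n k)) by (apply (le_INR 1); trivial).
      rewrite mult_IZR, <- INR_IZR_INZ in L.
      replace (INR (pow2n k) * (PI / (2 * (47 * INR (pow2n k))))) with (PI / 94) in L by (field; lra).
      generalize (IHk ltac:(lia)) PI2_3_2. lra. }
  generalize (K N (Nat.le_refl N)). lra.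
Qed.

(** * Littlewood-Paley blocks *)

Definition zfreq (k i : nat) : Z := (Z.of_nat i - 2 ^ Z.of_nat (S k))%Z.

Lemma IZR_zfreq k i : INR i - 2 ^ S k = IZR (zfreq k i).
Proof. unfold zfreq. rewrite minus_IZR, <- INR_IZR_INZ, <- pow_IZR. trivial. Qed.

Lemma sum_ext (f g : nat -> R) n : (forall i, f i = g i) -> sum_f_R0 f n = sum_f_R0 g n.
Proof. intro H. apply sum_eq. auto. Qed.
Lemma sum_0 n : sum_f_R0 (fun _ => 0) n = 0.
Proof. induction n; simpl; lra. Qed.
Lemma sum_lin c (f g : nat -> R) n : sum_f_R0 (fun i => c * f i + g i) n = c * sum_f_R0 f n + sum_f_R0 g n.
Proof. induction n; simpl; [trivial|rewrite IHn; ring]. Qed.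

Lemma sum_single (f : nat -> R) n a : (a <= n)%nat -> (forall i, i <> a -> f i = 0) -> sum_f_R0 f n = f a.
Proof.
  intros Ha H. induction n.
  - simpl. f_equal. lia.
  - simpl. destruct (Nat.eq_dec a (S n)) as [e|e].
    + subst a. rewrite (sum_eq f (fun _ => 0)) by (intros; apply H; lia). rewrite sum_0. ring.
    + rewrite IHn, (H (S n)) by lia. ring.
Qed.

(** The sum of a block runs over all integers up to [2 ^ (k + 1)] in absolute value, so a frequency
    in that range is met exactly once. *)
Lemma sum_zdelta k (f : Z -> R) m : (Z.abs m <= 2 ^ Z.of_nat (S k))%Z ->
  sum_f_R0 (fun i => f (zfreq k i) * zdelta (zfreq k i - m)) (2 ^ S (S k)) = f m.
Proof.
  intro Hm. set (P := (2 ^ Z.of_nat (S k))%Z) in *.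
  assert (HP : Z.of_nat (2 ^ S (S k)) = (2 * P)%Z).
  { rewrite Nat2Z.inj_pow. unfold P. rewrite (Nat2Z.inj_succ (S k)), Z.pow_succ_r by lia. trivial. }
  rewrite (sum_single _ _ (Z.to_nat (m + P))).
  - assert (E : zfreq k (Z.to_nat (m + P)) = m) by (unfold zfreq; fold P; lia).
    rewrite E. unfold zdelta. rewrite Z.sub_diag. destruct (Z.eq_dec 0 0); [ring|lia].
  - lia.
  - intros i Hi. unfold zdelta. destruct (Z.eq_dec (zfreq k i - m) 0) as [e|e]; [|ring].
    exfalso. apply Hi. unfold zfreq in e. fold P in e. lia.
Qed.

Lemma fourier_cos (m j : Z) : fourier_re (fun x => cos (IZR m * x)) (IZR j) = PI * (zdelta (j - m) + zdelta (j - - m)) /\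
  fourier_im (fun x => cos (IZR m * x)) (IZR j) = 0.
Proof.
  unfold fourier_re, fourier_im. replace (2 * PI) with (0 + 2 * PI) by ring.
  split.
  - rewrite (rint_ext _ (fun x => cos (IZR j * x) * cos (IZR m * x))) by (intro; rewrite (Rmult_comm x); trivial).
    rewrite int_cos_cos. do 3 f_equal. lia.
  - rewrite (rint_ext _ (fun x => sin (IZR j * x) * cos (IZR m * x))) by (intro; rewrite (Rmult_comm x); trivial).
    rewrite int_sin_cos. ring.
Qed.
Lemma fourier_sin (m j : Z) : fourier_re (fun x => sin (IZR m * x)) (IZR j) = 0 /\
  fourier_im (fun x => sin (IZR m * x)) (IZR j) = - PI * (zdelta (j - m) - zdelta (j - - m)).
Proof.
  unfold fourier_re, fourier_im. replace (2 * PI) with (0 + 2 * PI) by ring.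
  split.
  - rewrite (rint_ext _ (fun x => sin (IZR m * x) * cos (IZR j * x))) by (intro; rewrite (Rmult_comm x); ring).
    apply int_sin_cos.
  - rewrite (rint_ext _ (fun x => sin (IZR j * x) * sin (IZR m * x))) by (intro; rewrite (Rmult_comm x); trivial).
    rewrite int_sin_sin, Ropp_mult_distr_l. do 3 f_equal. lia.
Qed.

Lemma fourier_lin c f g xi : cont1 f -> cont1 g ->
  fourier_re (fun x => c * f x + g x) xi = c * fourier_re f xi + fourier_re g xi /\
  fourier_im (fun x => c * f x + g x) xi = c * fourier_im f xi + fourier_im g xi.
Proof.
  intros Cf Cg. unfold fourier_re, fourier_im. split.
  - rewrite (rint_ext _ (fun x => c * (cos (x * xi) * f x) + cos (x * xi) * g x)) by (intro; ring).
    rewrite rint_plus, rint_scal by auto 20 with cont. trivial.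
  - rewrite (rint_ext _ (fun x => c * (sin (x * xi) * f x) + sin (x * xi) * g x)) by (intro; ring).
    rewrite rint_plus, rint_scal by auto 20 with cont. ring.
Qed.
Lemma fourier_ext f g xi : (forall x, f x = g x) -> fourier_re f xi = fourier_re g xi /\ fourier_im f xi = fourier_im g xi.
Proof. intro H. unfold fourier_re, fourier_im. split; [|f_equal]; apply rint_ext; intro; rewrite H; trivial. Qed.

Lemma block_lin chi k c f g x : cont1 f -> cont1 g ->
  block_re chi k (fun x => c * f x + g x) x = c * block_re chi k f x + block_re chi k g x /\
  block_im chi k (fun x => c * f x + g x) x = c * block_im chi k f x + block_im chi k g x.
Proof.
  intros Cf Cg. unfold block_re, block_im. cbv zeta.
  assert (L := fun i => fourier_lin c f g (INR i - 2 ^ S k) Cf Cg).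
  split.
  - match goal with |- _ = c * (_ * sum_f_R0 ?F _) + _ * sum_f_R0 ?G _ =>
      rewrite (sum_ext _ (fun i => c * F i + G i)) end.
    + rewrite sum_lin. ring.
    + intro i. rewrite (proj1 (L i)), (proj2 (L i)). ring.
  - match goal with |- _ = c * (_ * sum_f_R0 ?F _) + _ * sum_f_R0 ?G _ =>
      rewrite (sum_ext _ (fun i => c * F i + G i)) end.
    + rewrite sum_lin. ring.
    + intro i. rewrite (proj1 (L i)), (proj2 (L i)). ring.
Qed.
Lemma block_ext chi k f g x : (forall x, f x = g x) ->
  block_re chi k f x = block_re chi k g x /\ block_im chi k f x = block_im chi k g x.
Proof.
  intro H. unfold block_re, block_im. cbv zeta.
  split; f_equal; apply sum_ext; intro i; destruct (fourier_ext f g (INR i - 2 ^ S k) H) as [E1 E2]; rewrite E1, E2; trivial.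
Qed.
Lemma block_0 chi k x : block_re chi k (fun _ => 0) x = 0 /\ block_im chi k (fun _ => 0) x = 0.
Proof.
  destruct (block_lin chi k 0 (fun _ => 0) (fun _ => 0) x (cont1_const 0) (cont1_const 0)) as [E1 E2].
  destruct (block_ext chi k (fun _ => 0 * 0 + 0) (fun _ => 0) x) as [E3 E4]; [intro; ring|].
  assert (K := block_lin chi k (-1) (fun _ => 0) (fun _ => 0) x (cont1_const 0) (cont1_const 0)).
  destruct (block_ext chi k (fun _ => -1 * 0 + 0) (fun _ => 0) x) as [E5 E6]; [intro; ring|].
  destruct K as [K1 K2]. split; lra.
Qed.

(** The block multiplies every mode with frequency in [[a, b]] by [W]. The last clause concerns the
    truncation of the block sum: a mode of nonzero weight must lie within its range, while one of
    zero weight may lie outside. *)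
Definition flat_weight chi k W (a b : Z) : Prop := forall m, (a <= m <= b)%Z ->
  lp_weight chi k (IZR m) = W /\ lp_weight chi k (IZR (- m)) = W /\
  (W <> 0 -> (Z.abs m <= 2 ^ Z.of_nat (S k))%Z).

Lemma lp_weight_zdelta chi k m z W : lp_weight chi k (IZR m) = W ->
  lp_weight chi k (IZR z) * zdelta (z - m) = W * zdelta (z - m).
Proof.
  intro H. unfold zdelta. destruct (Z.eq_dec (z - m) 0) as [e|e]; [|ring].
  replace z with m by lia. rewrite H. ring.
Qed.

Lemma block_cos chi k W a b m x : flat_weight chi k W a b -> (a <= m <= b)%Z ->
  block_re chi k (fun x => cos (IZR m * x)) x = W * cos (IZR m * x) /\ block_im chi k (fun x => cos (IZR m * x)) x = 0.
Proof.
  intros HW Hm. destruct (HW m Hm) as [W1 [W2 W3]]. assert (HP := PI_RGT_0).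
  unfold block_re, block_im. cbv zeta.
  assert (S0 : forall f, sum_f_R0 (fun i => PI * (W * f (zfreq k i) * zdelta (zfreq k i - m) + W * f (zfreq k i) * zdelta (zfreq k i - - m))) (2 ^ S (S k))
     = PI * (W * f m + W * f (- m)%Z)).
  { intro f.
    destruct (Req_dec W 0) as [E|E].
    - rewrite (sum_ext _ (fun _ => 0)) by (intro; rewrite E; ring). rewrite sum_0, E. ring.
    - rewrite (sum_ext _ (fun i => PI * (W * f (zfreq k i) * zdelta (zfreq k i - m)) + (PI * (W * f (zfreq k i) * zdelta (zfreq k i - - m)) + 0))) by (intro; ring).
      rewrite !sum_lin, sum_0, (sum_zdelta k (fun z => W * f z)) by auto.
      rewrite (sum_zdelta k (fun z => W * f z)) by (rewrite Z.abs_opp; auto). ring. }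
  assert (T : forall g i, lp_weight chi k (INR i - 2 ^ S k) * (fourier_re (fun x => cos (IZR m * x)) (INR i - 2 ^ S k) * g (INR i - 2 ^ S k)) =
     PI * (W * g (IZR (zfreq k i)) * zdelta (zfreq k i - m) + W * g (IZR (zfreq k i)) * zdelta (zfreq k i - - m))).
  { intros g i. rewrite IZR_zfreq, (proj1 (fourier_cos m (zfreq k i))).
    transitivity (PI * (g (IZR (zfreq k i)) * (lp_weight chi k (IZR (zfreq k i)) * zdelta (zfreq k i - m)) + g (IZR (zfreq k i)) * (lp_weight chi k (IZR (zfreq k i)) * zdelta (zfreq k i - - m)))); [ring|].
    rewrite (lp_weight_zdelta chi k m _ W), (lp_weight_zdelta chi k (- m) _ W) by trivial. ring. }
  assert (F0 : forall i, fourier_im (fun x => cos (IZR m * x)) (INR i - 2 ^ S k) = 0) by (intro; rewrite IZR_zfreq; apply fourier_cos).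
  split.
  - rewrite (sum_ext _ (fun i => PI * (W * cos (x * (IZR (zfreq k i))) * zdelta (zfreq k i - m) + W * cos (x * IZR (zfreq k i)) * zdelta (zfreq k i - - m)))).
    + rewrite (S0 (fun z => cos (x * IZR z))). rewrite opp_IZR, (Ropp_mult_distr_r_reverse x), cos_neg, (Rmult_comm x). field. lra.
    + intro i. rewrite <- (T (fun z => cos (x * z))), F0. ring.
  - rewrite (sum_ext _ (fun i => PI * (W * sin (x * (IZR (zfreq k i))) * zdelta (zfreq k i - m) + W * sin (x * IZR (zfreq k i)) * zdelta (zfreq k i - - m)))).
    + rewrite (S0 (fun z => sin (x * IZR z))). rewrite opp_IZR, (Ropp_mult_distr_r_reverse x), sin_neg, (Rmult_comm x). field. lra.
    + intro i. rewrite <- (T (fun z => sin (x * z))), F0. ring.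
Qed.

Lemma block_sin chi k W a b m x : flat_weight chi k W a b -> (a <= m <= b)%Z ->
  block_re chi k (fun x => sin (IZR m * x)) x = W * sin (IZR m * x) /\ block_im chi k (fun x => sin (IZR m * x)) x = 0.
Proof.
  intros HW Hm. destruct (HW m Hm) as [W1 [W2 W3]]. assert (HP := PI_RGT_0).
  unfold block_re, block_im. cbv zeta.
  assert (S0 : forall f, sum_f_R0 (fun i => PI * (W * f (zfreq k i) * zdelta (zfreq k i - m) - W * f (zfreq k i) * zdelta (zfreq k i - - m))) (2 ^ S (S k))
     = PI * (W * f m - W * f (- m)%Z)).
  { intro f.
    destruct (Req_dec W 0) as [E|E].
    - rewrite (sum_ext _ (fun _ => 0)) by (intro; rewrite E; ring). rewrite sum_0, E. ring.
    - rewrite (sum_ext _ (fun i => PI * (W * f (zfreq k i) * zdelta (zfreq k i - m)) + (- PI * (W * f (zfreq k i) * zdelta (zfreq k i - - m)) + 0))) by (intro; ring).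
      rewrite !sum_lin, sum_0, (sum_zdelta k (fun z => W * f z)) by auto.
      rewrite (sum_zdelta k (fun z => W * f z)) by (rewrite Z.abs_opp; auto). ring. }
  assert (T : forall g i, lp_weight chi k (INR i - 2 ^ S k) * (- fourier_im (fun x => sin (IZR m * x)) (INR i - 2 ^ S k) * g (INR i - 2 ^ S k)) =
     PI * (W * g (IZR (zfreq k i)) * zdelta (zfreq k i - m) - W * g (IZR (zfreq k i)) * zdelta (zfreq k i - - m))).
  { intros g i. rewrite IZR_zfreq, (proj2 (fourier_sin m (zfreq k i))).
    transitivity (PI * (g (IZR (zfreq k i)) * (lp_weight chi k (IZR (zfreq k i)) * zdelta (zfreq k i - m)) - g (IZR (zfreq k i)) * (lp_weight chi k (IZR (zfreq k i)) * zdelta (zfreq k i - - m)))); [ring|].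
    rewrite (lp_weight_zdelta chi k m _ W), (lp_weight_zdelta chi k (- m) _ W) by trivial. ring. }
  assert (F0 : forall i, fourier_re (fun x => sin (IZR m * x)) (INR i - 2 ^ S k) = 0) by (intro; rewrite IZR_zfreq; apply fourier_sin).
  split.
  - rewrite (sum_ext _ (fun i => PI * (W * sin (x * (IZR (zfreq k i))) * zdelta (zfreq k i - m) - W * sin (x * IZR (zfreq k i)) * zdelta (zfreq k i - - m)))).
    + rewrite (S0 (fun z => sin (x * IZR z))). rewrite opp_IZR, (Ropp_mult_distr_r_reverse x), sin_neg, (Rmult_comm x). field. lra.
    + intro i. rewrite <- (T (fun z => sin (x * z))), F0. ring.
  - rewrite (sum_ext _ (fun i => PI * (W * (- cos (x * (IZR (zfreq k i)))) * zdelta (zfreq k i - m) - W * (- cos (x * IZR (zfreq k i))) * zdelta (zfreq k i - - m)))).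
    + rewrite (S0 (fun z => - cos (x * IZR z))). rewrite opp_IZR, (Ropp_mult_distr_r_reverse x), cos_neg, (Rmult_comm x). field. lra.
    + intro i. rewrite <- (T (fun z => - cos (x * z))), F0. ring.
Qed.

Lemma block_trig_poly chi k W a b f : flat_weight chi k W a b -> trig_poly a b f ->
  forall x, block_re chi k f x = W * f x /\ block_im chi k f x = 0.
Proof.
  intros HW. induction 1; intro x.
  - rewrite Rmult_0_r. apply block_0.
  - eapply block_cos; eassumption.
  - eapply block_sin; eassumption.
  - destruct (block_ext chi k (fun x => c * f x) (fun x => c * f x + 0) x) as [E1 E2]; [intro; ring|].
    destruct (block_lin chi k c f (fun _ => 0) x (trig_poly_cont1 _ _ _ H) (cont1_const 0)) as [E3 E4].
    destruct (block_0 chi k x) as [E5 E6]. destruct (IHtrig_poly x) as [E7 E8].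
    rewrite E1, E2, E3, E4, E5, E6, E7, E8. split; ring.
  - destruct (block_ext chi k (fun x => f x + g x) (fun x => 1 * f x + g x) x) as [E1 E2]; [intro; ring|].
    destruct (block_lin chi k 1 f g x (trig_poly_cont1 _ _ _ H) (trig_poly_cont1 _ _ _ H0)) as [E3 E4].
    destruct (IHtrig_poly1 x) as [E5 E6]. destruct (IHtrig_poly2 x) as [E7 E8].
    rewrite E1, E2, E3, E4, E5, E6, E7, E8. split; ring.
  - destruct (block_ext chi k f g x H) as [E1 E2]. rewrite <- E1, <- E2, <- H. apply IHtrig_poly.
Qed.

Lemma sum_cont1 (F : nat -> R -> R) n : (forall i, cont1 (F i)) -> cont1 (fun x => sum_f_R0 (fun i => F i x) n).
Proof. intro H. induction n; simpl; [apply H|apply cont1_plus; auto]. Qed.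
Lemma rint_sum (F : nat -> R -> R) n a b : (forall i, cont1 (F i)) ->
  RInt (fun x => sum_f_R0 (fun i => F i x) n) a b = sum_f_R0 (fun i => RInt (F i) a b) n.
Proof.
  intro H. induction n; simpl; trivial. rewrite rint_plus, IHn; auto using sum_cont1.
Qed.
Lemma block_re_cont1 chi k u : cont1 (block_re chi k u).
Proof.
  unfold block_re. apply cont1_mult; [apply cont1_const|]. cbv zeta. apply sum_cont1. intro i. auto 20 with cont.
Qed.

(** Parseval: the block is a Fourier multiplier equal to 1 on the spectrum of [p]. The left side is
    first expanded into Fourier coefficients of [u], after which [p] is treated mode by mode. *)
Lemma block_pair chi k a b u p : cont1 u -> flat_weight chi k 1 a b -> trig_poly a b p ->
  RInt (fun x => block_re chi k u x * p x) 0 (2 * PI) = RInt (fun x => u x * p x) 0 (2 * PI).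
Proof.
  intros Cu HW Hp. assert (HP := PI_RGT_0). assert (Cb := block_re_cont1 chi k u).
  assert (B0 : forall p, cont1 p -> RInt (fun x => block_re chi k u x * p x) 0 (2 * PI) =
     / (2 * PI) * sum_f_R0 (fun i => lp_weight chi k (IZR (zfreq k i)) * (fourier_re u (IZR (zfreq k i)) * RInt (fun x => cos (IZR (zfreq k i) * x) * p x) 0 (2 * PI)
       - fourier_im u (IZR (zfreq k i)) * RInt (fun x => sin (IZR (zfreq k i) * x) * p x) 0 (2 * PI))) (2 ^ S (S k))).
  { intros q Cq. set (G i x := lp_weight chi k (IZR (zfreq k i)) * (fourier_re u (IZR (zfreq k i)) * (cos (IZR (zfreq k i) * x) * q x)
       - fourier_im u (IZR (zfreq k i)) * (sin (IZR (zfreq k i) * x) * q x))).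
    assert (CG : forall i, cont1 (G i)) by (intro; unfold G; auto 20 with cont).
    rewrite (rint_ext _ (fun x => / (2 * PI) * sum_f_R0 (fun i => G i x) (2 ^ S (S k)))).
    - rewrite rint_scal, rint_sum by auto using sum_cont1. f_equal. apply sum_ext. intro i. unfold G.
      rewrite rint_scal, rint_minus, !rint_scal by auto 20 with cont. trivial.
    - intro x. unfold block_re. cbv zeta. rewrite Rmult_assoc. f_equal. rewrite Rmult_comm, scal_sum.
      apply sum_ext. intro i. unfold G. rewrite IZR_zfreq, (Rmult_comm x). ring. }
  induction Hp as [|m H|m H|c f Hp IHHp|f g Hp1 IHHp1 Hp2 IHHp2|f g H Hp IHHp].
  - rewrite (rint_ext (fun x => block_re chi k u x * 0) (fun x => u x * 0)) by (intro; ring). trivial.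
  - destruct (HW m H) as [W1 [W2 W3]]. assert (Hm := W3 R1_neq_R0).
    rewrite B0 by auto 20 with cont.
    rewrite (sum_ext _ (fun i => PI * (fourier_re u (IZR (zfreq k i)) * zdelta (zfreq k i - m)) + (PI * (fourier_re u (IZR (zfreq k i)) * zdelta (zfreq k i - - m)) + 0))).
    + rewrite !sum_lin, sum_0, (sum_zdelta k (fun z => fourier_re u (IZR z))), (sum_zdelta k (fun z => fourier_re u (IZR z))) by (rewrite ?Z.abs_opp; trivial).
      assert (E : fourier_re u (IZR (- m)) = fourier_re u (IZR m)).
      { unfold fourier_re. apply rint_ext. intro x. rewrite opp_IZR, (Ropp_mult_distr_r_reverse x), cos_neg. trivial. }
      rewrite E. transitivity (fourier_re u (IZR m)); [rfield; lra|].
      unfold fourier_re. apply rint_ext. intro x. rewrite (Rmult_comm x). ring.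
    + intro i. replace (2 * PI) with (0 + 2 * PI) by ring. rewrite int_cos_cos, int_sin_cos.
      replace (zfreq k i + m)%Z with (zfreq k i - - m)%Z by lia.
      generalize (lp_weight_zdelta chi k m (zfreq k i) 1 W1) (lp_weight_zdelta chi k (- m) (zfreq k i) 1 W2).
      intros E1 E2. rewrite Rmult_1_l in E1, E2. rewrite <- E1 at 2. rewrite <- E2 at 2. ring.
  - destruct (HW m H) as [W1 [W2 W3]]. assert (Hm := W3 R1_neq_R0).
    rewrite B0 by auto 20 with cont.
    rewrite (sum_ext _ (fun i => - PI * (fourier_im u (IZR (zfreq k i)) * zdelta (zfreq k i - m)) + (PI * (fourier_im u (IZR (zfreq k i)) * zdelta (zfreq k i - - m)) + 0))).
    + rewrite !sum_lin, sum_0, (sum_zdelta k (fun z => fourier_im u (IZR z))), (sum_zdelta k (fun z => fourier_im u (IZR z))) by (rewrite ?Z.abs_opp; trivial).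
      assert (E : fourier_im u (IZR (- m)) = - fourier_im u (IZR m)).
      { unfold fourier_im. f_equal. rewrite <- rint_opp by auto 20 with cont. apply rint_ext. intro x. rewrite opp_IZR, (Ropp_mult_distr_r_reverse x), sin_neg. ring. }
      rewrite E. transitivity (- fourier_im u (IZR m)); [rfield; lra|].
      unfold fourier_im. rewrite Ropp_involutive. apply rint_ext. intro x. rewrite (Rmult_comm x). ring.
    + intro i. replace (2 * PI) with (0 + 2 * PI) by ring. rewrite int_sin_sin.
      rewrite (rint_ext (fun x => cos (IZR (zfreq k i) * x) * sin (IZR m * x)) (fun x => sin (IZR m * x) * cos (IZR (zfreq k i) * x))) by (intro; ring).
      rewrite int_sin_cos.
      replace (zfreq k i + m)%Z with (zfreq k i - - m)%Z by lia.
      generalize (lp_weight_zdelta chi k m (zfreq k i) 1 W1) (lp_weight_zdelta chi k (- m) (zfreq k i) 1 W2).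
      intros E1 E2. rewrite Rmult_1_l in E1, E2. rewrite <- E1 at 2. rewrite <- E2 at 2. ring.
  - assert (Cf := trig_poly_cont1 _ _ _ Hp).
    rewrite (rint_ext (fun x => block_re chi k u x * (c * f x)) (fun x => c * (block_re chi k u x * f x))) by (intro; ring).
    rewrite (rint_ext (fun x => u x * (c * f x)) (fun x => c * (u x * f x))) by (intro; ring).
    rewrite !rint_scal, IHHp by auto with cont. trivial.
  - assert (Cf := trig_poly_cont1 _ _ _ Hp1). assert (Cg := trig_poly_cont1 _ _ _ Hp2).
    rewrite (rint_ext (fun x => block_re chi k u x * (f x + g x)) (fun x => block_re chi k u x * f x + block_re chi k u x * g x)) by (intro; ring).
    rewrite (rint_ext (fun x => u x * (f x + g x)) (fun x => u x * f x + u x * g x)) by (intro; ring).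
    rewrite !rint_plus, IHHp1, IHHp2 by auto with cont. trivial.
  - rewrite <- (rint_ext (fun x => block_re chi k u x * f x) (fun x => block_re chi k u x * g x)) by (intro; rewrite H; trivial).
    rewrite <- (rint_ext (fun x => u x * f x) (fun x => u x * g x)) by (intro; rewrite H; trivial). trivial.
Qed.

(** Dilations by at most [2 ^ (J + 5)] leave the frequency outside the support of [chi], as
    [43 / 32 > 4 / 3]; from [2 ^ (J + 6)] on it lies in the plateau, as [47 / 64 <= 3 / 4]. The
    weight is nonzero only where the two regimes meet. *)
Lemma weight_window chi J k m :
  (forall xi, 4 / 3 < Rabs xi -> chi xi = 0) -> (forall xi, Rabs xi <= 3 / 4 -> chi xi = 1) ->
  (43 * Z.of_nat (pow2n J) <= Z.abs m <= 47 * Z.of_nat (pow2n J))%Z ->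
  lp_weight chi k (IZR m) = if Nat.eq_dec k (J + 6) then 1 else 0.
Proof.
  intros H0 H1 Hm.
  assert (B : 43 * 2 ^ J <= Rabs (IZR m) <= 47 * 2 ^ J).
  { rewrite <- INR_pow2n, INR_IZR_INZ, <- abs_IZR, <- !mult_IZR. split; apply IZR_le; lia. }
  assert (Z0 : forall j, (j <= J + 5)%nat -> chi (IZR m / 2 ^ j) = 0).
  { intros j Hj. apply H0. assert (Hj2 : 0 < 2 ^ j) by (apply pow_lt; lra).
    unfold Rdiv at 2. rewrite Rabs_mult, (Rabs_pos_eq (/ _)) by (left; apply Rinv_0_lt_compat; trivial).
    apply Rmult_lt_reg_r with (2 ^ j); trivial. rewrite Rmult_assoc, Rinv_l, Rmult_1_r by lra.
    assert (H : 2 ^ j <= 2 ^ (J + 5)) by (apply Rle_pow; [lra|trivial]).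
    rewrite pow_add in H. simpl in H. lra. }
  assert (Z1 : forall j, (J + 6 <= j)%nat -> chi (IZR m / 2 ^ j) = 1).
  { intros j Hj. apply H1. assert (Hj2 : 0 < 2 ^ j) by (apply pow_lt; lra).
    unfold Rdiv at 1. rewrite Rabs_mult, (Rabs_pos_eq (/ _)) by (left; apply Rinv_0_lt_compat; trivial).
    apply Rmult_le_reg_r with (2 ^ j); trivial. rewrite Rmult_assoc, Rinv_l, Rmult_1_r by lra.
    assert (H : 2 ^ (J + 6) <= 2 ^ j) by (apply Rle_pow; [lra|trivial]).
    rewrite pow_add in H. simpl in H. lra. }
  destruct k as [|k]; unfold lp_weight.
  - destruct (Nat.eq_dec 0 (J + 6)); [lia|]. rewrite <- (Z0 0%nat) by lia. f_equal. simpl. field.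
  - destruct (Nat.eq_dec (S k) (J + 6)) as [e|e].
    + rewrite Z1, Z0 by lia. ring.
    + destruct (le_lt_dec (S k) (J + 5)); [rewrite !Z0 by lia|rewrite !Z1 by lia]; ring.
Qed.

Lemma flat_window chi J k :
  (forall xi, 4 / 3 < Rabs xi -> chi xi = 0) -> (forall xi, Rabs xi <= 3 / 4 -> chi xi = 1) ->
  flat_weight chi k (if Nat.eq_dec k (J + 6) then 1 else 0) (43 * Z.of_nat (pow2n J)) (47 * Z.of_nat (pow2n J)).
Proof.
  intros H0 H1 m Hm.
  split; [|split]; [apply weight_window; trivial; lia|apply weight_window; trivial; lia|].
  destruct (Nat.eq_dec k (J + 6)) as [e|e]; [|intro K; exfalso; apply K; trivial]. intros _. subst k.
  replace (Z.of_nat (S (J + 6))) with (Z.of_nat J + 7)%Z by lia. rewrite Z.pow_add_r by lia.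
  unfold pow2n in *. rewrite Nat2Z.inj_pow in Hm. change (Z.of_nat 2) with 2%Z in Hm.
  set (P := (2 ^ Z.of_nat J)%Z) in *. change (2 ^ 7)%Z with 128%Z. lia.
Qed.

Lemma flat_constant chi k : (forall xi, Rabs xi <= 3 / 4 -> chi xi = 1) ->
  flat_weight chi k (if Nat.eq_dec k 0 then 1 else 0) 0 0.
Proof.
  intros H1 m Hm. replace m with 0%Z by lia.
  assert (chi 0 = 1) by (apply H1; rewrite Rabs_R0; lra).
  assert (E : lp_weight chi k 0 = if Nat.eq_dec k 0 then 1 else 0).
  { destruct k; unfold lp_weight; simpl; [trivial|]. unfold Rdiv. rewrite !Rmult_0_l. ring. }
  split; [exact E|split; [exact E|]]. intros _. change (Z.abs 0) with 0%Z. apply Z.pow_nonneg. lia.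
Qed.

(** * Bounds for the Besov norm *)

Lemma block_Linf_ub chi k u x : Rbar_le (Finite (Rabs (block_re chi k u x))) (block_Linf chi k u).
Proof.
  unfold block_Linf. destruct (Lub_Rbar_correct (fun r => exists x, r = sqrt (block_re chi k u x ^ 2 + block_im chi k u x ^ 2))) as [H _].
  apply Rbar_le_trans with (Finite (sqrt (block_re chi k u x ^ 2 + block_im chi k u x ^ 2))).
  - simpl Rbar_le. rewrite <- sqrt_Rsqr_abs. apply sqrt_le_1_alt. unfold Rsqr. generalize (pow2_ge_0 (block_im chi k u x)). simpl. lra.
  - apply H. exists x. trivial.
Qed.
Lemma block_Linf_le chi k u B : (forall x, Rabs (block_re chi k u x) <= B) -> (forall x, block_im chi k u x = 0) ->
  exists l, block_Linf chi k u = Finite l /\ 0 <= l <= B.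
Proof.
  intros H1 H2. generalize (block_Linf_ub chi k u 0).
  assert (K : Rbar_le (block_Linf chi k u) (Finite B)).
  { unfold block_Linf. destruct (Lub_Rbar_correct (fun r => exists x, r = sqrt (block_re chi k u x ^ 2 + block_im chi k u x ^ 2))) as [_ H].
    apply H. intros r [x Hr]. simpl. rewrite Hr, H2. replace (block_re chi k u x ^ 2 + 0 ^ 2) with (Rsqr (block_re chi k u x)) by (unfold Rsqr; ring).
    rewrite sqrt_Rsqr_abs. apply H1. }
  destruct (block_Linf chi k u) as [l| |]; simpl in *; try easy.
  intro L. exists l. split; trivial. generalize (Rabs_pos (block_re chi k u 0)). lra.
Qed.

Lemma besov_partial_le chi u (B : nat -> R) N : (forall k, exists l, block_Linf chi k u = Finite l /\ 0 <= l <= B k) ->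
  exists s, besov_partial chi u N = Finite s /\ s <= sumN (fun k _ => 2 ^ k / 2 * B k) N 0.
Proof.
  intro H. induction N as [|N [s [E1 E2]]]; [exists 0; simpl; split; [trivial|lra]|].
  destruct (H N) as [l [E3 E4]]. exists (s + 2 ^ N / 2 * l).
  simpl besov_partial. rewrite E1, E3. split; [trivial|]. simpl.
  assert (0 < 2 ^ N) by (apply pow_lt; lra). nra.
Qed.

Lemma besov_partial_ge chi u (B : nat -> R) N : (forall k, 0 <= B k /\ Rbar_le (Finite (B k)) (block_Linf chi k u)) ->
  Rbar_le (Finite (sumN (fun k _ => 2 ^ k / 2 * B k) N 0)) (besov_partial chi u N).
Proof.
  intro H. induction N; [simpl; lra|].
  destruct (H N) as [H1 H2]. assert (HN : 0 < 2 ^ N / 2) by (generalize (pow_lt 2 N ltac:(lra)); lra).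
  simpl besov_partial. simpl sumN.
  destruct (block_Linf chi N u) as [l| |]; simpl in H2; try easy.
  - destruct (besov_partial chi u N) as [s| |]; simpl in *; try easy.
    apply Rplus_le_compat; trivial. apply Rmult_le_compat_l; lra.
  (* Block norms are extended reals here, so the value [p_infty] has to be propagated as well. *)
  - assert (E : Rbar_mult (Finite (2 ^ N / 2)) p_infty = p_infty).
    { apply is_Rbar_mult_unique. apply is_Rbar_mult_sym, is_Rbar_mult_p_infty_pos. simpl; trivial. }
    rewrite E. destruct (besov_partial chi u N) as [s| |]; simpl in *; easy.
Qed.

Lemma sup_seq_le_const (v : nat -> Rbar) (B : R) : (forall n, Rbar_le (v n) (Finite B)) -> Rbar_le (Sup_seq v) (Finite B).
Proof.
  intro H. rewrite Rbar_sup_eq_lub. unfold Rbar_lub. destruct (Rbar_ex_lub (fun x : Rbar => exists n : nat, x = v n)) as [l [Hl0 Hl]]. simpl.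
  apply Hl. intros x [n E]. rewrite E. apply H.
Qed.

(** The constant fills the lowest block, of weight [1 / 2], and the oscillation fills the block of
    index [J + 6], of weight [2 ^ (J + 6) / 2 = 32 * 2 ^ J]. *)
Lemma besov_data chi J a0 osc B :
  (forall xi, 4 / 3 < Rabs xi -> chi xi = 0) -> (forall xi, Rabs xi <= 3 / 4 -> chi xi = 1) ->
  trig_poly (43 * Z.of_nat (pow2n J)) (47 * Z.of_nat (pow2n J)) osc -> (forall x, Rabs (osc x) <= B) -> 0 <= a0 ->
  Rbar_le (besov_B1inf1 chi (fun x => a0 + osc x)) (Finite (a0 / 2 + 32 * 2 ^ J * B)).
Proof.
  intros H0 H1 Ho HB Ha.
  assert (HB0 : 0 <= B) by (eapply Rle_trans; [apply Rabs_pos|apply (HB 0)]).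
  set (u := fun x => a0 + osc x).
  set (Bk := fun k => (if Nat.eq_dec k 0 then a0 else 0) + (if Nat.eq_dec k (J + 6) then B else 0)).
  assert (Hk : forall k, exists l, block_Linf chi k u = Finite l /\ 0 <= l <= Bk k).
  { intro k.
    assert (E : forall x, block_re chi k u x = (if Nat.eq_dec k 0 then a0 else 0) + (if Nat.eq_dec k (J + 6) then 1 else 0) * osc x /\ block_im chi k u x = 0).
    { intro x. assert (T1 : trig_poly 0 0 (fun x => cos (IZR 0 * x))) by (apply trig_poly_cos; lia).
      destruct (block_ext chi k u (fun x => a0 * cos (IZR 0 * x) + osc x) x) as [E1 E2]; [intro; unfold u; rewrite Rmult_0_l, cos_0; ring|].
      destruct (block_lin chi k a0 (fun x => cos (IZR 0 * x)) osc x) as [E3 E4]; [eapply trig_poly_cont1; eassumption|eapply trig_poly_cont1; eassumption|].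
      destruct (block_trig_poly chi k _ _ _ _ (flat_constant chi k H1) T1 x) as [E5 E6].
      destruct (block_trig_poly chi k _ _ _ _ (flat_window chi J k H0 H1) Ho x) as [E7 E8].
      rewrite E1, E2, E3, E4, E5, E6, E7, E8, Rmult_0_l, cos_0. split; [|ring]. destruct (Nat.eq_dec k 0); ring. }
    apply block_Linf_le; [|intro; apply E]. intro x. rewrite (proj1 (E x)). unfold Bk.
    eapply Rle_trans; [apply Rabs_triang|]. apply Rplus_le_compat.
    - destruct (Nat.eq_dec k 0); rewrite Rabs_pos_eq; lra.
    - destruct (Nat.eq_dec k (J + 6)); [rewrite Rmult_1_l; apply HB|rewrite Rmult_0_l, Rabs_R0; lra]. }
  apply sup_seq_le_const. intro N. destruct (besov_partial_le chi u Bk N Hk) as [s [Es Hs]]. rewrite Es. simpl.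
  eapply Rle_trans; [exact Hs|].
  assert (H2J : 0 < 2 ^ J) by (apply pow_lt; lra).
  assert (K : forall n, sumN (fun k _ => 2 ^ k / 2 * Bk k) n 0 <= (if Nat.eq_dec n 0 then 0 else a0 / 2) + (if le_lt_dec n (J + 6) then 0 else 32 * 2 ^ J * B)).
  { induction n; [simpl; destruct (le_lt_dec 0 (J + 6)); [lra|lia]|].
    simpl sumN. unfold Bk at 2.
    destruct (Nat.eq_dec n 0) as [e|e].
    - subst n. destruct (Nat.eq_dec 0 (J + 6)); [lia|]. destruct (le_lt_dec 1 (J + 6)); [|lia].
      destruct (le_lt_dec 0 (J + 6)); [|lia]. simpl in *. lra.
    - destruct (Nat.eq_dec (S n) 0); [lia|].
      destruct (Nat.eq_dec n (J + 6)) as [e2|e2].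
      + destruct (le_lt_dec n (J + 6)); [|lia]. destruct (le_lt_dec (S n) (J + 6)); [lia|].
        subst n. rewrite pow_add. simpl in *. lra.
      + destruct (le_lt_dec n (J + 6)); destruct (le_lt_dec (S n) (J + 6)); try lia; lra. }
  eapply Rle_trans; [apply K|].
  assert (0 <= 32 * 2 ^ J * B) by (repeat apply Rmult_le_pos; lra).
  destruct (Nat.eq_dec N 0); destruct (le_lt_dec N (J + 6)); lra.
Qed.

(** * The initial datum *)

(** The Taylor polynomial of degree 4 already makes [cos (8 / 5)] negative. The bound is needed as
    [5 / 4 * PI < 4], the range of the envelope estimates. *)
Lemma PI_lt_3_2 : PI < 16 / 5.
Proof.
  destruct (Rlt_le_dec PI (16 / 5)) as [h|h]; trivial. exfalso.
  assert (H1 : 0 <= cos (8 / 5)) by (apply cos_ge_0; lra).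
  destruct (cos_bound (8 / 5) 0) as [_ H2]; [lra|lra|].
  unfold cos_approx, cos_term in H2. simpl in H2. lra.
Qed.

Definition lam (J : nat) : R := 45 * INR (pow2n J).
Definition osc (b : R) (n J : nat) (x : R) : R := b / lam J * (sin (lam J * x) * (1 + sawmean n x)).
Definition sawd (n : nat) (x : R) : R := (fej n x / INR n - 1) / 2.
Definition oscd (b : R) (n J : nat) (x : R) : R :=
  b * (cos (lam J * x) * (1 + sawmean n x)) + b / lam J * (sin (lam J * x) * sawd n x).

Lemma lam_ge J : 45 <= lam J.
Proof. unfold lam. assert (1 <= INR (pow2n J)) by (apply (le_INR 1), pow2n_pos). lra. Qed.

Lemma lam_IZR J : lam J = IZR (45 * Z.of_nat (pow2n J)).
Proof. unfold lam. rewrite mult_IZR, <- INR_IZR_INZ. trivial. Qed.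

Lemma osc_derive b n J x : (1 <= n)%nat -> is_derive (osc b n J) x (oscd b n J x).
Proof.
  intro Hn. assert (Hl := lam_ge J). unfold osc, oscd. eapply der_eq.
  - apply der_scal. apply (der_mult (fun x => sin (lam J * x)) (fun x => 1 + sawmean n x)); [apply der_sin_lin|].
    apply (der_plus (fun _ => 1) (sawmean n)); [apply der_const|apply sawmean_derive; trivial].
  - cbv beta. unfold sawd. field. assert (INR n <> 0) by (apply not_0_INR; lia). repeat split; lra.
Qed.

(** The carrier [45 * M] is shifted by at most [n <= 2 * M], so the spectrum stays in the window
    [[43 * M, 47 * M]] of one dyadic block. *)
Lemma osc_trig_poly b n J : (Z.of_nat n <= 2 * Z.of_nat (pow2n J))%Z ->
  trig_poly (43 * Z.of_nat (pow2n J)) (47 * Z.of_nat (pow2n J)) (osc b n J).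
Proof.
  intro Hn. set (M := Z.of_nat (pow2n J)) in *.
  assert (T0 : trig_poly (45 * M) (45 * M) (fun x => sin (IZR (45 * M) * x))) by (apply trig_poly_sin; lia).
  assert (Ts : forall m, (Z.of_nat m <= 2 * M)%Z -> trig_poly (43 * M) (47 * M) (fun x => sin (IZR (45 * M) * x) * saw m x)).
  { induction m; intro Hm.
    - apply trig_poly_ext with (fun _ => 0); [intro; simpl; ring|apply trig_poly_zero].
    - apply trig_poly_ext with (fun x => sin (IZR (45 * M) * x) * saw m x + / INR (S m) * (sin (IZR (45 * M) * x) * sin (IZR (Z.of_nat (S m)) * x))).
      + intro x. change (saw (S m) x) with (saw m x + sin (INR (S m) * x) / INR (S m)). rewrite <- INR_IZR_INZ. unfold Rdiv. ring.
      + apply trig_poly_plus; [apply IHm; lia|apply trig_poly_scal].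
        apply (trig_poly_weaken (45 * M - Z.of_nat (S m)) (45 * M + Z.of_nat (S m))); [lia|lia|apply trig_poly_mult_sin; trivial; lia]. }
  assert (Tss : forall m, (Z.of_nat m <= 2 * M)%Z -> trig_poly (43 * M) (47 * M) (fun x => sin (IZR (45 * M) * x) * sawsum m x)).
  { induction m; intro Hm.
    - apply trig_poly_ext with (fun _ => 0); [intro; simpl; ring|apply trig_poly_zero].
    - apply trig_poly_ext with (fun x => sin (IZR (45 * M) * x) * sawsum m x + sin (IZR (45 * M) * x) * saw m x); [intro; simpl; ring|].
      apply trig_poly_plus; [apply IHm; lia|apply Ts; lia]. }
  apply trig_poly_ext with (fun x => b / lam J * (sin (IZR (45 * M) * x) + / INR n * (sin (IZR (45 * M) * x) * sawsum n x))).
  - intro x. unfold osc, sawmean. rewrite lam_IZR. fold M. unfold Rdiv. ring.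
  - apply trig_poly_scal, trig_poly_plus; [apply (trig_poly_weaken (45 * M) (45 * M)); trivial; lia|apply trig_poly_scal, Tss; trivial].
Qed.

Lemma sawd_bound n x : (1 <= n)%nat -> Rabs (sawd n x) <= INR n.
Proof.
  intro Hn. assert (H1 : 1 <= INR n) by (apply (le_INR 1); trivial).
  unfold sawd. destruct (fej_bounds n x) as [B _]. assert (P := fej_nonneg n x).
  assert (0 <= fej n x / INR n) by (apply Rle_div_r; lra).
  assert (fej n x / INR n <= INR n) by (apply Rle_div_l; simpl in B; lra).
  apply Rabs_le. lra.
Qed.

(** Since [|1 + sawmean| <= 5], the slope is at most [5 * b] from the carrier plus [b] from the
    envelope, whose derivative [n] is outweighed by [lam]; this explains [b <= / 6]. *)
Lemma osc_bounds b n J x : 0 <= b <= / 6 -> (1 <= n)%nat -> INR n <= lam J ->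
  Rabs (osc b n J x) <= 5 * b / lam J /\ Rabs (oscd b n J x) <= 1.
Proof.
  intros Hb Hn HnJ. assert (Hl := lam_ge J). unfold osc, oscd.
  assert (Hs := sin_abs_le (lam J * x)). assert (Hc := cos_abs_le (lam J * x)).
  assert (Hg : Rabs (1 + sawmean n x) <= 5).
  { eapply Rle_trans; [apply Rabs_triang|]. rewrite Rabs_R1. generalize (sawmean_bound n x Hn). lra. }
  assert (Hd := sawd_bound n x Hn).
  assert (Hbl : 0 <= b / lam J) by (apply Rmult_le_pos; [lra|left; apply Rinv_0_lt_compat; lra]).
  assert (Q : forall s c, Rabs s <= 1 -> Rabs c <= 5 -> Rabs (s * c) <= 5).
  { intros s c H1 H2. rewrite Rabs_mult. generalize (Rabs_pos s) (Rabs_pos c). nra. }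
  split.
  - rewrite Rabs_mult, (Rabs_pos_eq (b / lam J)) by trivial.
    replace (5 * b / lam J) with (b / lam J * 5) by (field; lra). apply Rmult_le_compat_l; auto.
  - eapply Rle_trans; [apply Rabs_triang|]. rewrite !(Rabs_mult _ (_ * _)), (Rabs_pos_eq b), (Rabs_pos_eq (b / lam J)) by (trivial; lra).
    assert (b * Rabs (cos (lam J * x) * (1 + sawmean n x)) <= b * 5) by (apply Rmult_le_compat_l; [lra|auto]).
    assert (b / lam J * Rabs (sin (lam J * x) * sawd n x) <= b / lam J * lam J).
    { apply Rmult_le_compat_l; trivial. rewrite Rabs_mult. generalize (Rabs_pos (sin (lam J * x))) (Rabs_pos (sawd n x)). nra. }
    replace (b / lam J * lam J) with b in * by (field; lra). lra.
Qed.

Lemma data_small a b n J : 0 <= a <= / 6 -> 0 <= b <= / 6 -> (1 <= n)%nat -> (Z.of_nat n <= 2 * Z.of_nat (pow2n J))%Z ->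
  small_data (fun x => a + osc b n J x) (oscd b n J) /\ smooth (fun x => a + osc b n J x) /\ smooth (oscd b n J).
Proof.
  intros Ha Hb Hn HnJ. assert (Hl := lam_ge J).
  assert (HnJ' : INR n <= lam J).
  { unfold lam. rewrite !INR_IZR_INZ. apply IZR_le in HnJ. rewrite mult_IZR in HnJ.
    assert (0 <= IZR (Z.of_nat (pow2n J))) by (apply IZR_le; lia). lra. }
  assert (T := osc_trig_poly b n J HnJ).
  assert (T' : trig_poly (43 * Z.of_nat (pow2n J)) (47 * Z.of_nat (pow2n J)) (oscd b n J)).
  { eapply trig_poly_derive; [intro x; apply osc_derive; exact Hn|exact T]. }
  assert (D : forall x, is_derive (fun x => a + osc b n J x) x (oscd b n J x)).
  { intro x. eapply der_eq; [apply (der_plus (fun _ => a) (osc b n J)); [apply der_const|apply osc_derive; trivial]|ring]. }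
  split; [split; [exact D|split; [|split; [|split; [|split]]]]|split].
  - eapply trig_poly_cont1; eassumption.
  - intro x. rewrite (trig_poly_periodic _ _ _ T). trivial.
  - eapply trig_poly_periodic; eassumption.
  - intro x. eapply Rle_trans; [apply Rabs_triang|]. rewrite Rabs_pos_eq by lra.
    destruct (osc_bounds b n J x Hb Hn HnJ') as [B _].
    assert (5 * b / lam J <= / 2) by (apply Rle_div_l; lra). lra.
  - intro x. apply (osc_bounds b n J x Hb Hn HnJ').
  - apply (trig_poly_smooth 0 (47 * Z.of_nat (pow2n J))).
    apply trig_poly_ext with (fun x => a * cos (IZR 0 * x) + osc b n J x); [intro; rewrite Rmult_0_l, cos_0; ring|].
    apply trig_poly_plus; [apply trig_poly_scal, trig_poly_cos; lia|]. apply (trig_poly_weaken (43 * Z.of_nat (pow2n J)) (47 * Z.of_nat (pow2n J))); trivial; lia.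
  - eapply trig_poly_smooth; eassumption.
Qed.

Lemma ker_cont1 N : cont1 (ker N) /\ cont1 (ker1 N) /\ cont1 (ker2 N).
Proof.
  split; [eapply cont1_derive; apply ker_derive|split; [eapply cont1_derive; apply ker1_derive|]].
  apply sumN_cont1. intro n. unfold psi2, Rdiv.
  assert (cont1 (fej (pow2n n))) by (eapply cont1_derive; apply fej_derive).
  assert (cont1 (fej1 (pow2n n))) by (eapply cont1_derive; apply fej1_derive).
  assert (cont1 (fej2 (pow2n n))).
  { assert (Hd : forall m, cont1 (dir2 m)) by (induction m; simpl; auto 20 with cont).
    assert (Hf : forall m, cont1 (fej2 m)) by (induction m; simpl; auto with cont). apply Hf. }
  auto 20 with cont.
Qed.

Lemma ker2_periodic N : periodic2pi (ker2 N).
Proof.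
  intro y. apply (der_unique (ker1 N) y); [|apply ker1_derive].
  apply der_ext with (fun z => ker1 N (z + 2 * PI)); [apply ker_periodic|].
  eapply der_eq; [apply (der_comp (ker1 N) (fun z => z + 2 * PI)); [apply ker1_derive|apply der_plus; [apply der_id|apply der_const]]|ring].
Qed.

(** A qualitative bound with uncontrolled dependence on [N]. It is only used against negative powers
    of [lam], which is chosen after [N]. *)
Lemma ker_sup N : exists K, 0 <= K /\ forall y, Rabs (ker N y) <= K /\ Rabs (ker1 N y) <= K /\ Rabs (ker2 N y) <= K.
Proof.
  assert (HP := Rgt_2PI_0). destruct (ker_cont1 N) as [Q0 [Q1 Q2]]. destruct (ker_periodic N) as [P0 P1].
  destruct (periodic_bounded (ker N) _ HP Q0 P0) as [K0 [H0 B0]].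
  destruct (periodic_bounded (ker1 N) _ HP Q1 P1) as [K1 [H1 B1]].
  destruct (periodic_bounded (ker2 N) _ HP Q2 (ker2_periodic N)) as [K2 [H2 B2]].
  exists (K0 + K1 + K2). split; [lra|]. intro y. generalize (B0 y) (B1 y) (B2 y). lra.
Qed.

Lemma rint_bound_2pi f K : cont1 f -> (forall x, Rabs (f x) <= K) -> Rabs (RInt f (- PI) PI) <= 8 * K.
Proof.
  intros Cf HK. assert (HP := PI_RGT_0). assert (H4 := PI_4).
  assert (0 <= K) by (eapply Rle_trans; [apply Rabs_pos|apply (HK 0)]).
  eapply Rle_trans; [apply (rint_bound f (- PI) PI K Cf)|]; [auto|]. rewrite Rabs_pos_eq by lra. nra.
Qed.

(** One integration by parts; the boundary terms cancel by periodicity and the primitive of the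
    cosine supplies the factor [/ m]. *)
Lemma rapid_oscillation (m : Z) h h' H : (1 <= m)%Z -> (forall x, is_derive h x (h' x)) -> cont1 h' -> periodic2pi h ->
  (forall x, Rabs (h' x) <= H) -> Rabs (RInt (fun x => cos (IZR m * x) * h x) (- PI) PI) <= 8 * H / IZR m.
Proof.
  intros Hm D Ch' Ph HH. assert (Hm' : 1 <= IZR m) by (apply (IZR_le 1); trivial).
  assert (Ds : forall x, is_derive (fun x => / IZR m * sin (IZR m * x)) x (cos (IZR m * x))).
  { intro x. eapply der_eq; [apply der_scal, der_sin_lin|field; lra]. }
  rewrite (rint_parts (fun x => / IZR m * sin (IZR m * x)) h _ h') by auto 20 with cont.
  assert (E1 : sin (IZR m * PI) = sin (IZR m * - PI)).
  { rewrite <- (proj2 (trig_periodic m) (- PI)). f_equal. ring. }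
  assert (E2 : h PI = h (- PI)) by (rewrite <- (Ph (- PI)); f_equal; ring).
  rewrite E1, E2.
  match goal with |- Rabs (?a - ?a - ?b) <= _ => replace (a - a - b) with (- b) by ring end.
  rewrite Rabs_Ropp. replace (8 * H / IZR m) with (8 * (H / IZR m)) by (field; lra).
  apply rint_bound_2pi; [auto 20 with cont|]. intro x. rewrite !Rabs_mult, Rabs_pos_eq by (left; apply Rinv_0_lt_compat; lra).
  rewrite Rmult_assoc. unfold Rdiv. rewrite (Rmult_comm H). apply Rmult_le_compat_l; [left; apply Rinv_0_lt_compat; lra|].
  generalize (sin_abs_le (IZR m * x)) (HH x) (Rabs_pos (sin (IZR m * x))) (Rabs_pos (h' x)). nra.
Qed.

(* Squaring demodulates: up to [O(1/lam)] the pairing of [u0 (u0')^2] with the kernel is [a b^2 / 2] times that of [(1 + sawmean)^2]. *)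
Lemma initial_pairing N n : (1 <= n)%nat -> (94 * Z.of_nat (pow2n N) <= Z.of_nat n)%Z -> exists K, 0 <= K /\
  forall a b J, 0 <= a <= / 6 -> 0 <= b <= / 6 -> (Z.of_nat n <= 2 * Z.of_nat (pow2n J))%Z ->
  3 / 64 * (a * b ^ 2) * INR N - K / lam J <=
    RInt (fun x => 3 / 2 * ((a + osc b n J x) * (oscd b n J x * oscd b n J x)) * ker N x) (- PI) PI /\
  - (K / lam J) <= RInt (fun x => oscd b n J x * ker N x) (- PI) PI.
Proof.
  intros Hn HnN. destruct (ker_sup N) as [Kk [HK0 HK]]. destruct (ker_cont1 N) as [Ck [Ck1 _]].
  assert (Hn1 : 1 <= INR n) by (apply (le_INR 1); trivial).
  assert (Cs : cont1 (sawmean n)) by (unfold sawmean, Rdiv; auto with cont).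
  assert (Csd : cont1 (sawd n)).
  { unfold sawd, Rdiv. assert (cont1 (fej n)) by (eapply cont1_derive; apply fej_derive). auto 20 with cont. }
  set (h := fun x => (1 + sawmean n x) ^ 2 * ker N x).
  set (h' := fun x => 2 * (1 + sawmean n x) * sawd n x * ker N x + (1 + sawmean n x) ^ 2 * ker1 N x).
  assert (Dh : forall x, is_derive h x (h' x)).
  { intro x. unfold h, h'. eapply der_eq.
    - apply (der_mult (fun x => (1 + sawmean n x) ^ 2) (ker N)); [|apply ker_derive].
      apply der_pow. apply (der_plus (fun _ => 1) (sawmean n)); [apply der_const|apply sawmean_derive; trivial].
    - unfold sawd. simpl. ring. }
  assert (Ch' : cont1 h') by (unfold h'; auto 20 with cont).
  assert (Ch : cont1 h) by (unfold h; auto 20 with cont).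
  assert (Ph : periodic2pi h).
  { intro x. unfold h. rewrite (sawmean_periodic n), (proj1 (ker_periodic N)). trivial. }
  assert (Hg : forall x, Rabs (1 + sawmean n x) <= 5).
  { intro x. eapply Rle_trans; [apply Rabs_triang|]. rewrite Rabs_R1. generalize (sawmean_bound n x Hn). lra. }
  set (H := 10 * INR n * Kk + 25 * Kk).
  assert (HH : forall x, Rabs (h' x) <= H).
  { intro x. unfold h', H. eapply Rle_trans; [apply Rabs_triang|]. rewrite !Rabs_mult, <- RPow_abs, (Rabs_pos_eq 2) by lra.
    assert (P0 := Rabs_pos (1 + sawmean n x)). assert (P1 := Rabs_pos (sawd n x)).
    generalize (HK x). intros [B0 [B1 _]].
    apply Rplus_le_compat; apply Rmult_le_compat; try apply Rabs_pos; trivial.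
    - repeat apply Rmult_le_pos; trivial; lra.
    - replace (10 * INR n) with (2 * 5 * INR n) by ring. apply Rmult_le_compat; trivial; [lra| |apply sawd_bound; trivial].
      generalize (Hg x); lra.
    - apply pow_le; trivial.
    - replace 25 with (5 ^ 2) by ring. apply pow_incr. split; trivial. }
  assert (HH0 : 0 <= H) by (unfold H; nra).
  exists (8 * H + 8 * (3 / 2 * (5 + 3 * INR n) * Kk) + 40 * Kk). split; [nra|].
  intros a b J Ha Hb HnJ.
  assert (HnJ' : INR n <= lam J).
  { unfold lam. rewrite !INR_IZR_INZ. apply IZR_le in HnJ. rewrite mult_IZR in HnJ.
    assert (0 <= IZR (Z.of_nat (pow2n J))) by (apply IZR_le; lia). lra. }
  assert (Co : cont1 (osc b n J)) by (unfold osc, Rdiv; auto 20 with cont).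
  assert (Cd : cont1 (oscd b n J)) by (unfold oscd, Rdiv; auto 20 with cont).
  assert (OB := fun x => osc_bounds b n J x Hb Hn HnJ').
  assert (Il : 0 < / lam J) by (apply Rinv_0_lt_compat; lra).
  split.
  (* [Am] is the part of the slope in which the derivative falls on the carrier; the remainder [Rm]
     is [O(1 / lam)] for fixed [n]. *)
  - set (Am x := b * (cos (lam J * x) * (1 + sawmean n x))).
    set (Rm x := 3 / 2 * ((a + osc b n J x) * (oscd b n J x * oscd b n J x)) - 3 / 2 * (a * (Am x * Am x))).
    assert (CA : cont1 Am) by (unfold Am; auto 20 with cont).
    assert (BR : forall x, Rabs (Rm x) <= 3 / 2 * (5 + 3 * INR n) / lam J).
    { intro x. destruct (OB x) as [O1 O2].
      set (Bm := b / lam J * (sin (lam J * x) * sawd n x)).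
      assert (EB : oscd b n J x = Am x + Bm) by trivial.
      assert (HB : Rabs Bm <= INR n / lam J).
      { unfold Bm. rewrite !Rabs_mult, Rabs_pos_eq by (apply Rmult_le_pos; lra).
        assert (Hs := sin_abs_le (lam J * x)). assert (Hd := sawd_bound n x Hn).
        assert (Rabs (sin (lam J * x)) * Rabs (sawd n x) <= INR n) by (generalize (Rabs_pos (sin (lam J * x))) (Rabs_pos (sawd n x)); nra).
        assert (0 <= Rabs (sin (lam J * x)) * Rabs (sawd n x)) by (apply Rmult_le_pos; apply Rabs_pos).
        unfold Rdiv. rewrite (Rmult_comm (INR n)). 
        apply Rle_trans with (/ lam J * (Rabs (sin (lam J * x)) * Rabs (sawd n x))).
        - apply Rmult_le_compat_r; trivial. nra.
        - apply Rmult_le_compat_l; lra. }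
      assert (HA : Rabs (Am x) <= 1).
      { unfold Am. rewrite !Rabs_mult, (Rabs_pos_eq b) by lra. generalize (cos_abs_le (lam J * x)) (Hg x) (Rabs_pos (cos (lam J * x))) (Rabs_pos (1 + sawmean n x)).
        intros. assert (Rabs (cos (lam J * x)) * Rabs (1 + sawmean n x) <= 5) by nra. nra. }
      assert (Hnl : INR n / lam J <= 1) by (apply Rle_div_l; lra).
      unfold Rm.
      replace (3 / 2 * ((a + osc b n J x) * (oscd b n J x * oscd b n J x)) - 3 / 2 * (a * (Am x * Am x))) with
        (3 / 2 * (osc b n J x * (oscd b n J x * oscd b n J x) + a * (Bm * (2 * Am x + Bm)))) by (rewrite EB; ring).
      rewrite Rabs_mult, (Rabs_pos_eq (3 / 2)) by lra. unfold Rdiv at 2. rewrite !Rmult_assoc.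
      apply Rmult_le_compat_l; [lra|]. rewrite Rmult_plus_distr_r.
      eapply Rle_trans; [apply Rabs_triang|]. apply Rplus_le_compat.
      - rewrite !Rabs_mult. apply Rle_trans with (5 * b / lam J * 1).
        + apply Rmult_le_compat; trivial; [apply Rabs_pos|apply Rmult_le_pos; apply Rabs_pos|].
          generalize (Rabs_pos (oscd b n J x)); nra.
        + unfold Rdiv. rewrite Rmult_1_r. apply Rmult_le_compat_r; lra.
      - rewrite !Rabs_mult, (Rabs_pos_eq a) by lra.
        assert (Rabs (2 * Am x + Bm) <= 3).
        { eapply Rle_trans; [apply Rabs_triang|]. rewrite Rabs_mult, (Rabs_pos_eq 2) by lra. lra. }
        assert (Rabs Bm * Rabs (2 * Am x + Bm) <= INR n / lam J * 3) by (apply Rmult_le_compat; trivial; apply Rabs_pos).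
        assert (0 <= Rabs Bm * Rabs (2 * Am x + Bm)) by (apply Rmult_le_pos; apply Rabs_pos).
        unfold Rdiv in *. nra. }
    (* The square of the cosine is half its mean plus half a second harmonic. The mean carries the
       profile [h]; the harmonic, of frequency [2 * lam], is left to [rapid_oscillation]. *)
    rewrite (rint_ext _ (fun x => (3 / 4 * (a * b ^ 2)) * (h x + cos (IZR (90 * Z.of_nat (pow2n J)) * x) * h x) + Rm x * ker N x)).
    + assert (CR : cont1 Rm) by (unfold Rm; auto 20 with cont).
      rewrite rint_plus, rint_scal, rint_plus by auto 20 with cont.
      assert (B1 := bump_pairing N n HnN). fold h in B1. change (RInt (fun x => (1 + sawmean n x) ^ 2 * ker N x) (- PI) PI) with (RInt h (- PI) PI) in B1.
      assert (B2 := rapid_oscillation (90 * Z.of_nat (pow2n J)) h h' H ltac:(generalize (pow2n_pos J); lia) Dh Ch' Ph HH).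
      assert (B3 : Rabs (RInt (fun x => Rm x * ker N x) (- PI) PI) <= 8 * (3 / 2 * (5 + 3 * INR n) / lam J * Kk)).
      { apply rint_bound_2pi; auto with cont. intro x. rewrite Rabs_mult. apply Rmult_le_compat; try apply Rabs_pos; auto. apply HK. }
      assert (E90 : IZR (90 * Z.of_nat (pow2n J)) = 2 * lam J) by (unfold lam; rewrite mult_IZR, <- INR_IZR_INZ; ring).
      rewrite E90 in B2 |- *.
      assert (B4 : 8 * H / (2 * lam J) <= 8 * H / lam J).
      { unfold Rdiv. rewrite Rinv_mult. nra. }
      apply Rabs_le_between in B2. apply Rabs_le_between in B3.
      assert (Hab : 0 <= a * b ^ 2 <= 1) by (simpl; split; [repeat apply Rmult_le_pos; lra|nra]).
      replace ((8 * H + 8 * (3 / 2 * (5 + 3 * INR n) * Kk) + 40 * Kk) / lam J) with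
        (8 * H / lam J + 8 * (3 / 2 * (5 + 3 * INR n) / lam J * Kk) + 40 * Kk / lam J) by (field; lra).
      set (X1 := RInt h (- PI) PI) in *. set (X2 := RInt (fun x => cos (2 * lam J * x) * h x) (- PI) PI) in *.
      change (3 / 64 * (a * b ^ 2) * INR N - (8 * H / lam J + 8 * (3 / 2 * (5 + 3 * INR n) / lam J * Kk) + 40 * Kk / lam J) <=
        3 / 4 * (a * b ^ 2) * (X1 + X2) + RInt (fun x => Rm x * ker N x) (- PI) PI).
      nra.
    + intro x. unfold Rm, h, Am. rewrite mult_IZR, <- INR_IZR_INZ.
      replace (90 * INR (pow2n J) * x) with (lam J * x + lam J * x) by (unfold lam; ring).
      rewrite cos_plus. generalize (sin2_cos2 (lam J * x)). unfold Rsqr. intro E.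
      replace (sin (lam J * x) * sin (lam J * x)) with (1 - cos (lam J * x) * cos (lam J * x)) by lra.
      field.
  (* The slope itself pairs weakly: integration by parts exchanges it for [osc], of amplitude
     [O(b / lam)]. *)
  - rewrite (rint_parts (osc b n J) (ker N) (oscd b n J) (ker1 N)); trivial.
    2: intro; apply osc_derive; trivial. 2: apply ker_derive.
    assert (T := osc_trig_poly b n J HnJ).
    assert (E1 : osc b n J PI = osc b n J (- PI)) by (rewrite <- (trig_poly_periodic _ _ _ T (- PI)); f_equal; ring).
    assert (E2 : ker N PI = ker N (- PI)) by (rewrite <- (proj1 (ker_periodic N) (- PI)); f_equal; ring).
    rewrite E1, E2.
    assert (B : Rabs (RInt (fun x => osc b n J x * ker1 N x) (- PI) PI) <= 8 * (5 / lam J * Kk)).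
    { apply rint_bound_2pi; auto with cont. intro x. rewrite Rabs_mult. apply Rmult_le_compat; try apply Rabs_pos; [|apply HK].
      eapply Rle_trans; [apply OB|]. unfold Rdiv. apply Rmult_le_compat_r; lra. }
    apply Rabs_le_between in B.
    replace ((8 * H + 8 * (3 / 2 * (5 + 3 * INR n) * Kk) + 40 * Kk) / lam J) with
        ((8 * H + 8 * (3 / 2 * (5 + 3 * INR n) * Kk)) * / lam J + 8 * (5 / lam J * Kk)) by (field; lra).
    assert (0 <= (8 * H + 8 * (3 / 2 * (5 + 3 * INR n) * Kk)) * / lam J) by (apply Rmult_le_pos; [nra|lra]).
    lra.
Qed.

(** * Growth along the flow *)

Lemma mvt_bound (f f' : R -> R) B a b : (forall s, is_derive f s (f' s)) -> (forall s, Rabs (f' s) <= B) ->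
  Rabs (f b - f a) <= B * Rabs (b - a).
Proof.
  intros D H. destruct (MVT_gen f a b f') as [c [_ E]].
  - intros; apply D.
  - intros; apply continuity_pt_filterlim; apply (cont1_derive f f' D).
  - rewrite E, Rabs_mult. apply Rmult_le_compat_r; [apply Rabs_pos|apply H].
Qed.

Lemma pois_cont1 M : cont1 (pois M).
Proof. unfold pois. apply cont1_div; auto 20 with cont. intro x. generalize (pow2_ge_0 (M * x)). lra. Qed.

(** The substitution [y = Dx x] removes the flow and leaves a difference of arctangents, at most
    [PI] for every [M]. *)
Lemma int_pois M q Dx a b : (forall x, is_derive Dx x (q x)) -> cont1 q ->
  RInt (fun x => q x * pois M (Dx x)) a b <= 4.
Proof.
  intros D Cq. rewrite (rint_subst (pois M) Dx q) by (trivial; apply pois_cont1).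
  rewrite (rint_ftc (fun y => atan (M * y)) (pois M)).
  - generalize (atan_bound (M * Dx b)) (atan_bound (M * Dx a)) PI_4. lra.
  - intro y. eapply der_eq; [apply (der_comp atan (fun y => M * y)); [apply is_derive_atan|apply der_scal, der_id]|].
    unfold pois, Rsqr. field. repeat split; nra.
  - apply pois_cont1.
Qed.

Lemma poisN_cont1 N : cont1 (poisN N).
Proof. apply sumN_cont1. intro. apply pois_cont1. Qed.
Lemma poisN'_C1 N : cont1 (poisN' N).
Proof. apply sumN_cont1. intro. unfold Rdiv. apply cont1_mult; [apply pois_cont1|apply cont1_const]. Qed.

(** One bounded integral per scale in the first case; in the second the geometric series
    [4 * (1 + 1 / 2 + 1 / 4 + ...) = 8]. *)
Lemma int_poisN N q Dx a b : (forall x, is_derive Dx x (q x)) -> cont1 q ->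
  RInt (fun x => q x * poisN N (Dx x)) a b <= 4 * INR N /\
  RInt (fun x => q x * poisN' N (Dx x)) a b <= 8.
Proof.
  intros D Cq. assert (CD : cont1 Dx) by (eapply cont1_derive; exact D).
  assert (C0 : forall n, cont1 (fun x => poisN n (Dx x))) by (intro; apply cont1_comp; [trivial|apply poisN_cont1]).
  assert (C0' : forall n, cont1 (fun x => poisN' n (Dx x))) by (intro; apply cont1_comp; [trivial|apply poisN'_C1]).
  assert (Cp : forall M, cont1 (fun x => pois M (Dx x))) by (intro; apply cont1_comp; [trivial|apply pois_cont1]).
  split.
  - induction N.
    + rewrite (rint_ext _ (fun _ => 0)) by (intro; unfold poisN; simpl; ring). rewrite rint_const, Rmult_0_r. simpl; lra.
    + rewrite (rint_ext _ (fun x => q x * poisN N (Dx x) + q x * pois (INR (pow2n N)) (Dx x))) by (intro; unfold poisN; simpl; ring).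
      rewrite rint_plus, S_INR by auto with cont. generalize (int_pois (INR (pow2n N)) q Dx a b D Cq). lra.
  - assert (K : RInt (fun x => q x * poisN' N (Dx x)) a b <= 8 - 8 / 2 ^ N).
    { induction N.
      + rewrite (rint_ext _ (fun _ => 0)) by (intro; unfold poisN'; simpl; ring). rewrite rint_const, Rmult_0_r. simpl; lra.
      + rewrite (rint_ext _ (fun x => q x * poisN' N (Dx x) + / INR (pow2n N) * (q x * pois (INR (pow2n N)) (Dx x)))) by (intro; unfold poisN', Rdiv; simpl; ring).
        rewrite rint_plus, rint_scal by auto with cont. generalize (int_pois (INR (pow2n N)) q Dx a b D Cq). rewrite INR_pow2n.
        assert (H2 : 0 < / 2 ^ N) by (apply Rinv_0_lt_compat, pow_lt; lra).
        intro. assert (/ 2 ^ N * RInt (fun x => q x * pois (2 ^ N) (Dx x)) a b <= / 2 ^ N * 4) by (apply Rmult_le_compat_l; lra).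
        unfold Rdiv in *. simpl. rewrite Rinv_mult. lra. }
    assert (H2 : 0 < / 2 ^ N) by (apply Rinv_0_lt_compat, pow_lt; lra). unfold Rdiv in K. lra.
Qed.

(** Signed Eulerian distance to the particle labelled 0, where the initial profile has its smoothed
    jump. Centring the kernel there makes the relative velocity vanish at its singularity. *)
Definition displacement (X : component -> R -> R) (x : R) : R := x + X cZ x - X cZ 0.

(* [w_t = mainF + q restF], with [restF] Lipschitz in space; [restF'] is the space derivative of [restF],
   whereas [mainF'] is the time derivative of [mainF]. *)
Definition mainF (X : component -> R -> R) (x : R) : R := 3 / 2 * (X cU x * (X cw x * X cw x) * / X cq x).
Definition restF (X : component -> R -> R) (x : R) : R :=
  X cU x * X cU x * X cU x + (- / 2 * opB (X cZ) (src1 X) x + -1 * opA (X cZ) (src2 X) x).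
Definition restF' (X : component -> R -> R) (x : R) : R :=
  3 * (X cU x * X cU x * X cw x) +
  (- / 2 * (X cq x * opA (X cZ) (src1 X) x + -1 * src1 X x) + -1 * (X cq x * opB (X cZ) (src2 X) x)).
Definition mainF' (X : component -> R -> R) (x : R) : R :=
  3 / 2 * (vfield cU X x * (X cw x * X cw x) * / X cq x + 2 * (X cU x * (X cw x * vfield cw X x) * / X cq x)
   + -1 * (X cU x * (X cw x * X cw x) * (vfield cq X x * (/ X cq x * / X cq x)))).

Ltac good_tac := repeat match goal with
  | |- good (fun X x => _ + _) => apply good_plus
  | |- good (fun X x => _ * _) => apply good_mult
  | |- good (fun X x => / X cq x) => apply good_invq
  | |- good (fun X x => X ?i x) => apply (good_coord i)
  | |- good (fun X => X ?i) => apply (good_coord i)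
  | |- good (vfield ?i) => apply (good_field i)
  | |- good (fun X x => vfield ?i X x) => apply (good_field i)
  | |- good (fun X x => opA (X cZ) (src1 X) x) => apply (good_opA src1 good_src1)
  | |- good (fun X x => opA (X cZ) (src2 X) x) => apply (good_opA src2 good_src2)
  | |- good (fun X x => opB (X cZ) (src1 X) x) => apply (good_opB src1 good_src1)
  | |- good (fun X x => opB (X cZ) (src2 X) x) => apply (good_opB src2 good_src2)
  | |- good (fun X x => src1 X x) => apply good_src1
  | |- good src1 => apply good_src1
  | |- good (fun X x => ?c) => apply (good_const c)
  end.

Lemma good_mainF : good mainF.
Proof. unfold mainF. good_tac. Qed.
Lemma good_restF : good restF.
Proof. unfold restF. good_tac. Qed.
Lemma good_restF' : good restF'.
Proof. unfold restF'. good_tac. Qed.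
Lemma good_mainF' : good mainF'.
Proof. unfold mainF'. good_tac. Qed.

(** The term [U ^ 3 * q] of [src2] joins the nonlocal terms in [restF]; [mainF] keeps only the local
    term quadratic in the slope. *)
Lemma vfield_w_split X x : admissible X -> vfield cw X x = mainF X x + X cq x * restF X x.
Proof.
  intro HX. generalize (admissible_q_bounds X x HX); intro. unfold vfield, mainF, restF, src2 at 2. field. lra.
Qed.

Lemma restF_derive X x : admissible X -> slaved X -> is_derive (restF X) x (restF' X x).
Proof.
  intros HX HD.
  destruct good_src1 as [c1 [_ [G1 _]]], good_src2 as [c2 [_ [G2 _]]].
  destruct (G1 X HX) as [a1 [b1 _]], (G2 X HX) as [a2 [b2 _]].
  assert (DU := proj2 (HD x)).
  assert (DZ : forall x, is_derive (X cZ) x (X cq x - 1)) by (intro; apply HD).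
  unfold restF, restF'. eapply der_eq.
  - apply der_plus; [apply (der_mult (fun x => X cU x * X cU x) (X cU)); [apply der_mult; exact DU|exact DU]|].
    apply (der_plus (fun x => - / 2 * opB (X cZ) (src1 X) x) (fun x => -1 * opA (X cZ) (src2 X) x)); apply der_scal.
    + apply (opB_derive _ (X cq)); trivial. apply HX.
    + apply (opA_derive _ (X cq)); trivial. apply HX.
  - cbv beta. ring.
Qed.

(** * Pairings with the kernel at a fixed time *)

Section SpatialEstimates.
Variables (X : component -> R -> R) (N : nat).
Hypothesis HX : admissible X.
Hypothesis HD : slaved X.
Let Dx := displacement X.
Let q := X cq.

Lemma Dx_derive x : is_derive Dx x (q x).
Proof.
  unfold Dx, displacement. eapply der_eq; [apply der_minus; [apply der_plus; [apply der_id|exact (proj1 (HD x))]|apply der_const]|unfold q; ring].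
Qed.
Lemma q_cont1 : cont1 q. Proof. apply HX. Qed.
Lemma Dx_cont1 : cont1 Dx. Proof. eapply cont1_derive. exact Dx_derive. Qed.
Lemma Dx_0 : Dx 0 = 0. Proof. unfold Dx, displacement. ring. Qed.
Lemma Dx_period : Dx PI = Dx (- PI) + 2 * PI.
Proof. unfold Dx, displacement. rewrite <- (admissible_per X HX cZ (- PI)). replace (- PI + 2 * PI) with PI by ring. ring. Qed.
Lemma Dx_bounds x : 3 / 4 * Rabs x <= Rabs (Dx x) <= 5 / 4 * Rabs x.
Proof.
  destruct (MVT_gen Dx 0 x q) as [c [_ E]].
  - intros; apply Dx_derive.
  - intros; apply continuity_pt_filterlim; apply Dx_cont1.
  - rewrite Dx_0, !Rminus_0_r in E. rewrite E, Rabs_mult.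
    generalize (admissible_q_bounds X c HX). fold q. intro. rewrite (Rabs_pos_eq (q c)) by lra.
    generalize (Rabs_pos x). nra.
Qed.
Lemma Dx_le_4 x : - PI <= x <= PI -> Rabs (Dx x) <= 4.
Proof.
  intro Hx. eapply Rle_trans; [apply Dx_bounds|]. assert (Rabs x <= PI) by (apply Rabs_le; lra).
  generalize PI_lt_3_2. lra.
Qed.
Lemma q_bounds x : 3 / 4 <= q x <= 5 / 4.
Proof. apply admissible_q_bounds; trivial. Qed.

Lemma U_lip x : Rabs (X cU x - X cU 0) <= 2 * Rabs x.
Proof.
  rewrite <- (Rminus_0_r x) at 2. apply (mvt_bound (X cU) (X cw)); [intro; apply HD|apply HX].
Qed.
(** The factor [|Dx|] will pay for the derivative in [ker1]. Numerically, [2 * 4 * (4 / 3) < 11]. *)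
Lemma U2_lip x : Rabs (X cU x * X cU x - X cU 0 * X cU 0) <= 11 * Rabs (Dx x).
Proof.
  replace (X cU x * X cU x - X cU 0 * X cU 0) with ((X cU x - X cU 0) * (X cU x + X cU 0)) by ring.
  rewrite Rabs_mult. assert (H1 := U_lip x). assert (H2 := Dx_bounds x).
  assert (H3 : Rabs (X cU x + X cU 0) <= 4).
  { eapply Rle_trans; [apply Rabs_triang|]. generalize (admissible_U X HX x) (admissible_U X HX 0). lra. }
  generalize (Rabs_pos (X cU x - X cU 0)) (Rabs_pos (X cU x + X cU 0)) (Rabs_pos x). nra.
Qed.

Lemma kerD_cont1 : cont1 (fun x => ker N (Dx x)) /\ cont1 (fun x => ker1 N (Dx x)) /\ cont1 (fun x => ker2 N (Dx x)).
Proof. destruct (ker_cont1 N) as [a [b c]]. split; [|split]; apply cont1_comp; auto using Dx_cont1. Qed.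

(** In the variable [Dx] the integral runs over one full period of an odd periodic function. *)
Lemma int_q_ker : RInt (fun x => q x * ker N (Dx x)) (- PI) PI = 0.
Proof.
  destruct (ker_cont1 N) as [Ck _].
  rewrite (rint_subst (ker N) Dx q) by auto using Dx_derive, q_cont1.
  rewrite Dx_period, (period_shift (ker N) (2 * PI) (Dx (- PI)) (- PI)) by (trivial; apply ker_periodic).
  replace (- PI + 2 * PI) with PI by ring. apply int_odd; trivial. apply ker_odd.
Qed.

(** The Jacobian required by [int_poisN] is inserted at the price of [q >= 3 / 4], and
    [4 / 3 * 4 <= 6]. *)
Lemma pairing_bound g c : cont1 g -> 0 <= c -> (forall x, - PI <= x <= PI -> Rabs (g x) <= c * poisN N (Dx x)) ->
  Rabs (RInt g (- PI) PI) <= 6 * c * INR N.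
Proof.
  intros Cg Hc Hg. assert (HP := PI_RGT_0).
  assert (Cp : cont1 (fun x => poisN N (Dx x))) by (apply cont1_comp; [apply Dx_cont1|apply poisN_cont1]).
  assert (Cq := q_cont1).
  eapply Rle_trans; [apply (rint_abs_le g (fun x => 4 / 3 * c * (q x * poisN N (Dx x)))); auto with cont; [lra|]|].
  - intros x Hx. eapply Rle_trans; [apply Hg; trivial|].
    assert (0 <= c * poisN N (Dx x)) by (eapply Rle_trans; [apply Rabs_pos|apply Hg; trivial]).
    generalize (q_bounds x). nra.
  - rewrite rint_scal by auto with cont. destruct (int_poisN N q Dx (- PI) PI Dx_derive Cq) as [H _].
    
    generalize (pos_INR N). nra.
Qed.

(** By [int_q_ker] the value [restF X 0] may be subtracted for free. The difference is at most
    [4 / 3 * K1 * |Dx|], and this factor makes the sum over scales geometric, so the bound is free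
    of [N]. *)
Lemma rest_bound K1 : (forall x, Rabs (restF' X x) <= K1) ->
  Rabs (RInt (fun x => X cq x * restF X x * ker N (Dx x)) (- PI) PI) <= 11 * K1 * kernel_const.
Proof.
  intro HK. assert (HP := PI_RGT_0). destruct kerD_cont1 as [Ck _]. assert (Cq := q_cont1).
  assert (DR : forall x, is_derive (restF X) x (restF' X x)) by (intro; apply restF_derive; trivial).
  assert (CR : cont1 (restF X)) by (eapply cont1_derive; exact DR).
  assert (HK0 : 0 <= K1) by (eapply Rle_trans; [apply Rabs_pos|apply (HK 0)]).
  rewrite (rint_ext _ (fun x => q x * (restF X x - restF X 0) * ker N (Dx x) + restF X 0 * (q x * ker N (Dx x)))) by (intro; unfold q; ring).
  rewrite rint_plus, rint_scal, int_q_ker, Rmult_0_r, Rplus_0_r by auto 20 with cont.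
  assert (Cp : cont1 (fun x => poisN' N (Dx x))) by (apply cont1_comp; [apply Dx_cont1|apply poisN'_C1]).
  eapply Rle_trans; [apply (rint_abs_le _ (fun x => 4 / 3 * K1 * kernel_const * (q x * poisN' N (Dx x)))); auto 20 with cont; [lra|]|].
  - intros x Hx. rewrite !Rabs_mult. generalize (q_bounds x); intro Hq. rewrite (Rabs_pos_eq (q x)) by lra.
    assert (H1 : Rabs (restF X x - restF X 0) <= K1 * Rabs x).
    { rewrite <- (Rminus_0_r x) at 2. apply (mvt_bound (restF X) (restF' X)); trivial. }
    destruct (ker_bounds N (Dx x) (Dx_le_4 x Hx)) as [_ [B _]].
    assert (H2 := Dx_bounds x).
    assert (H3 : Rabs (restF X x - restF X 0) <= 4 / 3 * K1 * Rabs (Dx x)) by nra.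
    replace (4 / 3 * K1 * kernel_const * (q x * poisN' N (Dx x))) with (q x * (4 / 3 * K1 * (kernel_const * poisN' N (Dx x)))) by ring.
    rewrite Rmult_assoc. apply Rmult_le_compat_l; [lra|].
    apply Rle_trans with (4 / 3 * K1 * Rabs (Dx x) * Rabs (ker N (Dx x))); [apply Rmult_le_compat_r; [apply Rabs_pos|trivial]|].
    rewrite Rmult_assoc. apply Rmult_le_compat_l; [lra|trivial].
  - rewrite rint_scal by auto with cont. destruct (int_poisN N q Dx (- PI) PI Dx_derive Cq) as [_ H].
    assert (0 <= 4 / 3 * K1 * kernel_const) by (unfold kernel_const; lra).
    nra.
Qed.

(* [w (U^2 - c^2)] is the derivative of [(U - c)^2 (U + 2 c) / 3], which vanishes quadratically where [U = c]. *)
Lemma transport_bound d e KN : 0 <= d -> 0 <= e -> (forall y, Rabs (ker2 N y) <= KN) ->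
  (forall x, Rabs (X cU x - X cU 0) <= 2 * d + e * Rabs x) ->
  Rabs (RInt (fun x => X cw x * (X cU x * X cU x - X cU 0 * X cU 0) * ker1 N (Dx x)) (- PI) PI)
    <= 160 * KN * d ^ 2 + 32 * kernel_const * e ^ 2 * INR N.
Proof.
  intros Hd He HKN HU. assert (HP := PI_RGT_0). destruct kerD_cont1 as [_ [Ck1 Ck2]]. assert (Cq := q_cont1).
  assert (HKN0 : 0 <= KN) by (eapply Rle_trans; [apply Rabs_pos|apply (HKN 0)]).
  set (c := X cU 0) in *.
  set (P x := (X cU x - c) ^ 2 * (X cU x + 2 * c) / 3).
  assert (CU : cont1 (X cU)) by apply HX. assert (Cw : cont1 (X cw)) by apply HX.
  assert (DP : forall x, is_derive P x (X cw x * (X cU x * X cU x - c * c))).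
  { intro x. unfold P, Rdiv. assert (DU := proj2 (HD x)). eapply der_eq.
    - apply (der_mult (fun x => (X cU x - c) ^ 2 * (X cU x + 2 * c)) (fun _ => / 3)); [|apply der_const].
      apply (der_mult (fun x => (X cU x - c) ^ 2) (fun x => X cU x + 2 * c)).
      + apply der_pow. apply (der_minus (X cU) (fun _ => c)); [exact DU|apply der_const].
      + apply (der_plus (X cU) (fun _ => 2 * c)); [exact DU|apply der_const].
    - simpl. field. }
  assert (Dk : forall x, is_derive (fun x => ker1 N (Dx x)) x (ker2 N (Dx x) * q x)).
  { intro x. apply (der_comp (ker1 N) Dx); [apply ker1_derive|apply Dx_derive]. }
  rewrite (rint_parts P (fun x => ker1 N (Dx x)) _ (fun x => ker2 N (Dx x) * q x)) by auto 20 with cont.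
  assert (E1 : P PI = P (- PI)).
  { unfold P. rewrite <- (admissible_per X HX cU (- PI)). replace (- PI + 2 * PI) with PI by ring. trivial. }
  assert (E2 : ker1 N (Dx PI) = ker1 N (Dx (- PI))) by (rewrite Dx_period; apply ker_periodic).
  rewrite E1, E2.
  match goal with |- Rabs (?a - ?a - ?b) <= _ => replace (a - a - b) with (- b) by ring end. rewrite Rabs_Ropp.
  assert (CP : cont1 P) by (eapply cont1_derive; exact DP).
  assert (Cp : cont1 (fun x => poisN N (Dx x))) by (apply cont1_comp; [apply Dx_cont1|apply poisN_cont1]).
  (* The [d ^ 2] part takes the crude bound [KN] on [ker2]. The [e ^ 2] part carries [Dx x ^ 2],
     which compensates both derivatives and leaves [poisN]. *)
  eapply Rle_trans; [apply (rint_abs_le _ (fun x => 20 * KN * d ^ 2 + 8 * kernel_const * e ^ 2 * (q x * poisN N (Dx x)))); auto 20 with cont; [lra|]|].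
  - intros x Hx. unfold P. rewrite !Rabs_mult. generalize (q_bounds x); intro Hq. rewrite (Rabs_pos_eq (q x)) by lra.
    assert (H1 : Rabs ((X cU x - c) ^ 2 * (X cU x + 2 * c) / 3) <= 2 * (2 * d + e * Rabs x) ^ 2).
    { unfold Rdiv. rewrite !Rabs_mult, <- RPow_abs, (Rabs_pos_eq (/ 3)) by lra.
      assert (Rabs (X cU x + 2 * c) <= 6).
      { eapply Rle_trans; [apply Rabs_triang|]. rewrite Rabs_mult, (Rabs_pos_eq 2) by lra. generalize (admissible_U X HX x) (admissible_U X HX 0). fold c. lra. }
      assert (Rabs (X cU x - c) ^ 2 <= (2 * d + e * Rabs x) ^ 2) by (apply pow_incr; split; [apply Rabs_pos|apply HU]).
      generalize (Rabs_pos (X cU x + 2 * c)). nra. }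
    assert (H2 : 2 * (2 * d + e * Rabs x) ^ 2 <= 16 * d ^ 2 + 8 * e ^ 2 * Dx x ^ 2).
    { destruct (Dx_bounds x) as [B _]. rewrite <- (pow2_abs (Dx x)).
      assert (Rabs x ^ 2 <= 2 * Rabs (Dx x) ^ 2) by (generalize (Rabs_pos x); simpl; nra).
      assert (2 * (2 * d + e * Rabs x) ^ 2 <= 16 * d ^ 2 + 4 * e ^ 2 * Rabs x ^ 2).
      { assert (0 <= (2 * d - e * Rabs x) ^ 2) by apply pow2_ge_0. simpl in *. nra. }
      nra. }
    destruct (ker_bounds N (Dx x) (Dx_le_4 x Hx)) as [_ [_ [_ B]]].
    rewrite <- Rmult_assoc.
    apply Rle_trans with ((16 * d ^ 2 + 8 * e ^ 2 * Dx x ^ 2) * Rabs (ker2 N (Dx x)) * q x).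
    + apply Rmult_le_compat_r; [lra|]. 
      apply Rmult_le_compat_r; [apply Rabs_pos|]. lra.
    + replace ((16 * d ^ 2 + 8 * e ^ 2 * Dx x ^ 2) * Rabs (ker2 N (Dx x)) * q x) with
       (16 * d ^ 2 * (Rabs (ker2 N (Dx x)) * q x) + 8 * e ^ 2 * q x * (Dx x ^ 2 * Rabs (ker2 N (Dx x)))) by ring.
      apply Rplus_le_compat.
      * assert (Rabs (ker2 N (Dx x)) * q x <= KN * (5 / 4)) by (apply Rmult_le_compat; try apply Rabs_pos; try lra; apply HKN).
        generalize (pow2_ge_0 d). nra.
      * replace (8 * kernel_const * e ^ 2 * (q x * poisN N (Dx x))) with (8 * e ^ 2 * q x * (kernel_const * poisN N (Dx x))) by ring.
        apply Rmult_le_compat_l; trivial. repeat apply Rmult_le_pos; lra || apply pow2_ge_0.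
  - rewrite rint_plus, rint_const, rint_scal by auto 20 with cont. destruct (int_poisN N q Dx (- PI) PI Dx_derive Cq) as [H _].
    assert (0 <= 8 * kernel_const * e ^ 2) by (unfold kernel_const; generalize (pow2_ge_0 e); lra).
    assert (0 <= 20 * KN * d ^ 2) by (generalize (pow2_ge_0 d); nra). generalize PI_4. nra.
Qed.
End SpatialEstimates.

(** * Norm inflation *)

(** The time derivative of the pairing is [Mw + Ew + Tw]: main term, Lipschitz remainder, motion of
    the kernel. [Mw] departs from its initial value by [O(N * t)], [Ew] is bounded, [Tw] is
    [O(KN * d ^ 2 + N * t ^ 2)]. The constant [K] is fixed before the datum and before [N]. *)
Lemma flow_growth C : 0 < C -> (forall i, good_with C (vfield i)) -> exists K, 0 < K /\
  forall T u0 v0 X a d N KN, 0 < T <= 1 -> lagrangian_flow T C u0 v0 X ->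
  0 <= d -> (forall x, Rabs (u0 x - a) <= d) -> (forall y, Rabs (ker2 N y) <= KN) ->
  forall t, 0 <= t <= T ->
  RInt (fun x => v0 x * ker N x) (- PI) PI
   + t * (RInt (fun x => 3 / 2 * (u0 x * (v0 x * v0 x)) * ker N x) (- PI) PI - K * (INR N * t + 1 + KN * d ^ 2))
  <= RInt (fun x => X t cw x * ker N (displacement (X t) x)) (- PI) PI.
Proof.
  intros HC HF.
  destruct good_restF' as [K1 [HK1 [GK1 _]]], good_mainF as [K2 [HK2 [GK2 _]]], good_mainF' as [K3 [HK3 [GK3 _]]].
  set (c := (K3 + 11 * K2) * kernel_const).
  assert (HkC : 0 < kernel_const) by (unfold kernel_const; lra).
  assert (Hc : 0 <= c) by (unfold c; nra).
  exists (6 * c + 11 * K1 * kernel_const + 160 + 32 * kernel_const * C ^ 2).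
  assert (HC2 : 0 <= C ^ 2) by apply pow2_ge_0.
  split; [nra|].
  intros T u0 v0 X a d N KN HT [Hok [Hsl [H0 Ht]]] Hd Hu0 HKN t Htt.
  assert (HA := proj1 Hok).
  assert (HKN0 : 0 <= KN) by (eapply Rle_trans; [apply Rabs_pos|apply (HKN 0)]).
  destruct (ker_cont1 N) as [Ck [Ck1 _]].
  set (D t x := displacement (X t) x).
  assert (CX : forall i, cont2 (fun t => X t i)) by (intro; eapply coord_along_flow; eassumption).
  assert (CcT : cont2 (fun s _ => cutoff T s)) by (apply (cont2_comp1 (cutoff T) (fun s _ => s)); [apply cutoff_cont1|apply cont2_fst]).
  assert (CX0 : forall i, cont2 (fun t _ => X t i 0)) by (intro i; apply (cont2_comp (fun t => X t i) (fun t _ => t) (fun _ _ => 0)); auto with cont).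
  assert (CD : cont2 D) by (unfold D, displacement; apply cont2_minus; auto with cont; apply cont2_plus; auto with cont; apply (CX cZ)).
  assert (CkD : cont2 (fun t x => ker N (D t x))) by (apply cont2_comp1; trivial).
  assert (Ck1D : cont2 (fun t x => ker1 N (D t x))) by (apply cont2_comp1; trivial).
  assert (CF : forall P, good P -> cont2 (fun t => P (X t))) by (intros P [k HP]; eapply good_along_flow; eassumption).
  set (dU t x := X t cU x * X t cU x - X t cU 0 * X t cU 0).
  assert (CdU : cont2 dU) by (unfold dU; apply cont2_minus; apply cont2_mult; auto).
  assert (DD : forall t x, is_derive (fun t => D t x) t (cutoff T t * dU t x)).
  { intros s x. unfold D, displacement. eapply der_eq.
    - apply der_minus; [apply der_plus; [apply der_const|exact (Ht s cZ x)]|exact (Ht s cZ 0)].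
    - unfold vfield, dU. ring. }
  assert (DkD : forall t x, is_derive (fun t => ker N (D t x)) t (ker1 N (D t x) * (cutoff T t * dU t x))).
  { intros s x. apply (der_comp (ker N) (fun t => D t x)); [apply ker_derive|apply DD]. }
  set (Iw t := RInt (fun x => X t cw x * ker N (D t x)) (- PI) PI).
  set (Mw t := RInt (fun x => mainF (X t) x * ker N (D t x)) (- PI) PI).
  set (Ew t := RInt (fun x => X t cq x * restF (X t) x * ker N (D t x)) (- PI) PI).
  set (Tw t := RInt (fun x => X t cw x * dU t x * ker1 N (D t x)) (- PI) PI).
  assert (CI : cont2 (fun t x => mainF (X t) x * ker N (D t x))) by (apply cont2_mult; trivial; apply CF, good_mainF).
  assert (CE : cont2 (fun t x => X t cq x * restF (X t) x * ker N (D t x))) by (apply cont2_mult; trivial; apply cont2_mult; [apply CX|apply CF, good_restF]).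
  assert (CTw : cont2 (fun t x => X t cw x * dU t x * ker1 N (D t x))) by (apply cont2_mult; trivial; apply cont2_mult; trivial; apply (CX cw)).
  assert (DI : forall t, is_derive Iw t (cutoff T t * (Mw t + Ew t + Tw t))).
  { intro s. unfold Iw.
    set (h' x t := cutoff T t * (mainF (X t) x * ker N (D t x) + X t cq x * restF (X t) x * ker N (D t x) + X t cw x * dU t x * ker1 N (D t x))).
    eapply der_eq; [apply (rint_param_derive (fun x t => X t cw x * ker N (D t x)) h')|].
    - intros x r. unfold h'. eapply der_eq; [apply der_mult; [exact (Ht r cw x)|apply DkD]|].
      rewrite vfield_w_split by trivial. ring.
    - apply (cont2_swap (fun t x => cutoff T t * (mainF (X t) x * ker N (D t x) + X t cq x * restF (X t) x * ker N (D t x) + X t cw x * dU t x * ker1 N (D t x)))).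
      auto 20 with cont.
    - intro r. apply (cont2_slice_x (fun t x => X t cw x * ker N (D t x)) r). apply cont2_mult; trivial; apply (CX cw).
    - unfold h', Mw, Ew, Tw.
      assert (Q1 := cont2_slice_x _ s CI). assert (Q2 := cont2_slice_x _ s CE). assert (Q3 := cont2_slice_x _ s CTw). cbv beta in Q1, Q2, Q3.
      rewrite rint_scal, !rint_plus by auto with cont. trivial. }
  (* Differentiating the kernel in time yields [ker1] times a velocity difference bounded by
     [11 * |D|], hence again [O(poisN)]: time derivatives cost no power of the scale. *)
  assert (DM : forall s, Rabs (Mw s - Mw 0) <= 6 * c * INR N * Rabs s).
  { intro s. rewrite <- (Rminus_0_r s) at 2.
    set (h' x t := cutoff T t * (mainF' (X t) x * ker N (D t x) + mainF (X t) x * (ker1 N (D t x) * dU t x))).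
    assert (Ch' : cont2 (fun t x => cutoff T t * (mainF' (X t) x * ker N (D t x) + mainF (X t) x * (ker1 N (D t x) * dU t x)))).
    { assert (Q1 := CF _ good_mainF). assert (Q2 := CF _ good_mainF'). auto 20 with cont. }
    apply (mvt_bound Mw (fun t => RInt (fun x => h' x t) (- PI) PI)).
    - intro r. unfold Mw. apply (rint_param_derive (fun x t => mainF (X t) x * ker N (D t x)) h').
      + intros x r'. unfold h'. assert (Hq := admissible_q_bounds (X r') x (HA r')). eapply der_eq.
        * apply (der_mult (fun t => mainF (X t) x) (fun t => ker N (D t x))); [|apply DkD].
          unfold mainF. apply der_scal. apply (der_mult (fun t => X t cU x * (X t cw x * X t cw x)) (fun t => / X t cq x)).
          -- apply (der_mult (fun t => X t cU x) (fun t => X t cw x * X t cw x)); [exact (Ht r' cU x)|].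
             apply (der_mult (fun t => X t cw x) (fun t => X t cw x)); exact (Ht r' cw x).
          -- apply der_inv; [exact (Ht r' cq x)|lra].
        * cbv beta. unfold mainF, mainF'. field. lra.
      + apply (cont2_swap _ Ch').
      + intro r'. apply (cont2_slice_x _ r' CI).
    - intro r. unfold h'.
      apply (pairing_bound (X r) N (HA r) (Hsl r)); trivial.
      + apply (cont2_slice_x _ r Ch').
      + intros x Hx. assert (Hb := cutoff_bounds T r). rewrite Rabs_mult, (Rabs_pos_eq (cutoff T r)) by lra.
        destruct (ker_bounds N (D r x) (Dx_le_4 (X r) (HA r) (Hsl r) x Hx)) as [B0 [_ [B1 _]]].
        set (Pn := poisN N (D r x)) in *. change (poisN N (displacement (X r) x)) with Pn.
        assert (A1 : Rabs (mainF' (X r) x) <= K3) by (apply GK3; trivial).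
        assert (A2 : Rabs (mainF (X r) x) <= K2) by (apply GK2; trivial).
        assert (A3 : Rabs (dU r x) <= 11 * Rabs (D r x)) by (apply (U2_lip (X r) (HA r) (Hsl r))).
        assert (A4 : Rabs (ker1 N (D r x) * dU r x) <= 11 * (kernel_const * Pn)).
        { rewrite Rabs_mult. apply Rle_trans with (Rabs (ker1 N (D r x)) * (11 * Rabs (D r x))).
          - apply Rmult_le_compat_l; [apply Rabs_pos|trivial]. - lra. }
        assert (A5 : Rabs (mainF' (X r) x * ker N (D r x) + mainF (X r) x * (ker1 N (D r x) * dU r x)) <= c * Pn).
        { eapply Rle_trans; [apply Rabs_triang|]. rewrite (Rabs_mult (mainF' _ _)), (Rabs_mult (mainF _ _)). unfold c.
          replace ((K3 + 11 * K2) * kernel_const * Pn) with (K3 * (kernel_const * Pn) + K2 * (11 * (kernel_const * Pn))) by ring.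
          apply Rplus_le_compat; apply Rmult_le_compat; try apply Rabs_pos; trivial. }
        generalize (Rabs_pos (mainF' (X r) x * ker N (D r x) + mainF (X r) x * (ker1 N (D r x) * dU r x))). nra. }
  assert (HEw : forall s, Rabs (Ew s) <= 11 * K1 * kernel_const).
  { intro s. apply (rest_bound (X s) N (HA s) (Hsl s)). intro x. apply GK1; trivial. }
  (* The increment [U x - U 0] is at most [2 * d] initially. Its rate of change is Lipschitz in [x]
     with constant [C], because [vfield cw] is the derivative of [vfield cU]; hence [e = C * s]. *)
  assert (HTw : forall s, 0 <= s -> Rabs (Tw s) <= 160 * KN * d ^ 2 + 32 * kernel_const * (C * s) ^ 2 * INR N).
  { intros s Hs. apply (transport_bound (X s) N (HA s) (Hsl s)); trivial; [nra|]. intro x.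
    assert (B1 : Rabs ((X s cU x - X s cU 0) - (X 0 cU x - X 0 cU 0)) <= C * Rabs x * Rabs (s - 0)).
    { apply (mvt_bound (fun s => X s cU x - X s cU 0) (fun s => cutoff T s * (vfield cU (X s) x - vfield cU (X s) 0))).
      - intro r. eapply der_eq; [apply der_minus; [exact (Ht r cU x)|exact (Ht r cU 0)]|ring].
      - intro r. rewrite Rabs_mult. assert (Hb := cutoff_bounds T r). rewrite (Rabs_pos_eq (cutoff T r)) by lra.
        assert (B2 : Rabs (vfield cU (X r) x - vfield cU (X r) 0) <= C * Rabs (x - 0)).
        { apply (mvt_bound (vfield cU (X r)) (vfield cw (X r))).
          - intro y. apply (field_slaved (X r) (HA r) (Hsl r) y).
          - intro y. destruct (HF cw) as [_ [G _]]. apply G; trivial. }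
        rewrite Rminus_0_r in B2. generalize (Rabs_pos (vfield cU (X r) x - vfield cU (X r) 0)). nra. }
    rewrite Rminus_0_r, (Rabs_pos_eq s), !H0 in B1 by trivial. simpl data in B1.
    replace (X s cU x - X s cU 0) with ((X s cU x - X s cU 0 - (u0 x - u0 0)) + ((u0 x - a) + - (u0 0 - a))) by ring.
    eapply Rle_trans; [apply Rabs_triang|].
    assert (Rabs ((u0 x - a) + - (u0 0 - a)) <= 2 * d).
    { eapply Rle_trans; [apply Rabs_triang|]. rewrite Rabs_Ropp. generalize (Hu0 x) (Hu0 0). lra. }
    nra. }
  assert (ED0 : forall x, D 0 x = x) by (intro x; unfold D, displacement; rewrite !H0; simpl; ring).
  assert (EI0 : Iw 0 = RInt (fun x => v0 x * ker N x) (- PI) PI).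
  { unfold Iw. apply rint_ext. intro x. rewrite ED0, H0. trivial. }
  assert (EM0 : Mw 0 = RInt (fun x => 3 / 2 * (u0 x * (v0 x * v0 x)) * ker N x) (- PI) PI).
  { unfold Mw. apply rint_ext. intro x. rewrite ED0. unfold mainF. rewrite !H0. simpl. field. }
  rewrite <- EI0, <- EM0. change (Iw 0 + t * (Mw 0 - (6 * c + 11 * K1 * kernel_const + 160 + 32 * kernel_const * C ^ 2) * (INR N * t + 1 + KN * d ^ 2)) <= Iw t).
  destruct (MVT_gen Iw 0 t (fun t => cutoff T t * (Mw t + Ew t + Tw t))) as [s [Hs E]].
  - intros; apply DI.
  - intros; apply continuity_pt_filterlim; apply (cont1_derive _ _ DI).
  - rewrite Rmin_left, Rmax_right in Hs by lra. rewrite Rminus_0_r in E.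
    rewrite cutoff_1, Rmult_1_l in E by (try rewrite Rabs_pos_eq; lra).
    assert (B1 := DM s). rewrite (Rabs_pos_eq s) in B1 by lra. assert (B2 := HEw s). assert (B3 := HTw s (proj1 Hs)).
    apply Rabs_le_between in B1. apply Rabs_le_between in B2. apply Rabs_le_between in B3.
    assert (HN := pos_INR N).
    assert (Hd2 : 0 <= KN * d ^ 2) by (apply Rmult_le_pos; [trivial|apply pow2_ge_0]).
    assert (Hst : (C * s) ^ 2 * INR N <= C ^ 2 * (INR N * t)).
    { replace ((C * s) ^ 2 * INR N) with (C ^ 2 * (INR N * (s * s))) by ring.
      apply Rmult_le_compat_l; trivial. apply Rmult_le_compat_l; trivial. nra. }
    assert (HsN : INR N * s <= INR N * t) by (apply Rmult_le_compat_l; lra).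
    assert (P2 : 0 <= 32 * kernel_const * C ^ 2) by nra.
    assert (P3 : 0 <= INR N * t) by (apply Rmult_le_pos; lra).
    assert (G3 : Mw 0 - (6 * c + 11 * K1 * kernel_const + 160 + 32 * kernel_const * C ^ 2) * (INR N * t + 1 + KN * d ^ 2) <= Mw s + Ew s + Tw s).
    { set (Y := INR N * t) in *. set (W := KN * d ^ 2) in *.
      assert (160 * KN * d ^ 2 = 160 * W) by (unfold W; ring).
      
      
      nra. }
    assert (t * (Mw 0 - (6 * c + 11 * K1 * kernel_const + 160 + 32 * kernel_const * C ^ 2) * (INR N * t + 1 + KN * d ^ 2)) <= t * (Mw s + Ew s + Tw s)) by (apply Rmult_le_compat_l; lra).
    lra.
Qed.

(** * From the pairing to the Besov norm *)

Lemma int_psi1_abs M y0 : (1 <= M)%nat ->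
  RInt (fun y => Rabs (psi1 M (y - y0))) 0 (2 * PI) <= 4 * kernel_const * INR M.
Proof.
  intro HM. assert (HP := PI_RGT_0). assert (HP4 := PI_4). assert (H1 : 1 <= INR M) by (apply (le_INR 1); trivial).
  assert (Cp : cont1 (psi1 M)) by (eapply cont1_derive; apply psi1_derive).
  assert (Pp : periodic2pi (psi1 M)).
  { eapply trig_poly_periodic. eapply trig_poly_derive; [apply psi_derive|eapply trig_poly_of_pos_sine_poly; apply psi_pos_sine_poly; trivial]. }
  assert (Cs : cont1 (fun y => Rabs (psi1 M (y - y0)))) by (apply cont1_abs; apply (cont1_comp (psi1 M) (fun y => y - y0)); auto with cont).
  replace (2 * PI) with (0 + 2 * PI) by ring.
  rewrite (period_shift _ (2 * PI) 0 (- PI + y0)); trivial.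
  2: { intro x. replace (x + 2 * PI - y0) with (x - y0 + 2 * PI) by ring. rewrite Pp. trivial. }
  assert (K := rint_subst (fun y => Rabs (psi1 M (y - y0))) (fun x => x + y0) (fun _ => 1) (- PI) PI Cs).
  cbv beta in K. replace (- PI + y0 + 2 * PI) with (PI + y0) by ring. rewrite <- K; [|intro; eapply der_eq; [apply der_plus; [apply der_id|apply der_const]|ring]|auto with cont].
  eapply Rle_trans; [apply (rint_le _ (fun x => kernel_const * INR M * (1 * pois (INR M) x))); [lra| | |]|].
  - apply cont1_mult; auto with cont. apply cont1_abs. apply (cont1_comp (psi1 M) (fun x => x + y0 - y0)); auto with cont.
  - apply cont1_mult; auto with cont. apply cont1_mult; auto with cont. apply pois_cont1.
  - intros x Hx. rewrite Rmult_1_l. replace (x + y0 - y0) with x by ring.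
    destruct (psi_bounds M x HM) as [_ [_ [B _]]]; [apply Rabs_le; lra|]. lra.
  - rewrite rint_scal by (apply cont1_mult; auto with cont; apply pois_cont1).
    assert (B := int_pois (INR M) (fun _ => 1) (fun x => x) (- PI) PI der_id (cont1_const 1)).
    assert (0 <= kernel_const * INR M) by (unfold kernel_const; lra).
    assert (kernel_const * INR M * RInt (fun x => 1 * pois (INR M) x) (- PI) PI <= kernel_const * INR M * 4) by (apply Rmult_le_compat_l; trivial). lra.
Qed.

(** Duality, block by block: the spectrum of the bump of scale [2 ^ i] lies where the block of index
    [i + 6] has weight 1, so its pairing with [u] is at most the block norm times an [L^1] norm of
    [4 * kernel_const * 2 ^ i]. The Besov weight [32 * 2 ^ i] cancels the scale and leaves
    [8 / kernel_const]. *)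
Lemma besov_lower chi u N y0 c :
  (forall xi, 4 / 3 < Rabs xi -> chi xi = 0) -> (forall xi, Rabs xi <= 3 / 4 -> chi xi = 1) ->
  cont1 u -> periodic2pi u ->
  Rbar_le (Finite (8 / kernel_const * Rabs (RInt (fun y => u y * ker1 N (y - y0)) c (c + 2 * PI)))) (besov_B1inf1 chi u).
Proof.
  intros H0 H1 Cu Pu. assert (HP := PI_RGT_0). assert (HkC : 0 < kernel_const) by (unfold kernel_const; lra).
  set (f i := RInt (fun y => u y * psi1 (pow2n i) (y - y0)) 0 (2 * PI)).
  assert (Cp : forall i, cont1 (fun y => psi1 (pow2n i) (y - y0))).
  { intro i. apply (cont1_comp (psi1 (pow2n i)) (fun y => y - y0)); auto with cont. eapply cont1_derive; apply psi1_derive. }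
  set (b i := Rabs (f i) / (4 * kernel_const * INR (pow2n i))).
  assert (Hb : forall i, 0 <= b i /\ Rbar_le (Finite (b i)) (block_Linf chi (i + 6) u)).
  { intro i. assert (Hp : 1 <= INR (pow2n i)) by (apply (le_INR 1), pow2n_pos).
    assert (Hden : 0 < 4 * kernel_const * INR (pow2n i)) by (apply Rmult_lt_0_compat; lra).
    split; [apply Rmult_le_pos; [apply Rabs_pos|left; apply Rinv_0_lt_compat; trivial]|].
    assert (UB := fun x => block_Linf_ub chi (i + 6) u x).
    assert (FW := flat_window chi i (i + 6) H0 H1). destruct (Nat.eq_dec (i + 6) (i + 6)) as [_|e]; [|exfalso; apply e; trivial].
    assert (TP : trig_poly (43 * Z.of_nat (pow2n i)) (47 * Z.of_nat (pow2n i)) (fun y => psi1 (pow2n i) (y - y0))).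
    { apply trig_poly_shift. eapply trig_poly_derive; [apply psi_derive|eapply trig_poly_of_pos_sine_poly; apply psi_pos_sine_poly, pow2n_pos]. }
    assert (E : f i = RInt (fun y => block_re chi (i + 6) u y * psi1 (pow2n i) (y - y0)) 0 (2 * PI)).
    { unfold f. symmetry. apply (block_pair chi (i + 6) _ _ u _ Cu FW TP). }
    assert (Cb := block_re_cont1 chi (i + 6) u).
    destruct (block_Linf chi (i + 6) u) as [L| |]; simpl in *; trivial.
    - apply Rle_div_l; trivial. rewrite E.
      eapply Rle_trans; [apply (rint_abs_le _ (fun y => L * Rabs (psi1 (pow2n i) (y - y0)))); auto with cont; [lra|]|].
      + intros x _. rewrite Rabs_mult. apply Rmult_le_compat_r; [apply Rabs_pos|apply UB].
      + rewrite rint_scal by (apply (cont1_abs (fun y => psi1 (pow2n i) (y - y0))); trivial).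
        apply Rmult_le_compat_l; [|apply int_psi1_abs, pow2n_pos]. eapply Rle_trans; [apply Rabs_pos|apply (UB 0)].
    - apply (UB 0). }
  set (B k := if le_lt_dec 6 k then b (k - 6)%nat else 0).
  assert (HB : forall k, 0 <= B k /\ Rbar_le (Finite (B k)) (block_Linf chi k u)).
  { intro k. unfold B. destruct (le_lt_dec 6 k).
    - replace k with (k - 6 + 6)%nat at 2 by lia. destruct (Hb (k - 6)%nat) as [Q1 Q2]. split; trivial.
      replace (k - 6 + 6)%nat with k in Q2 by lia. replace (k - 6 + 6)%nat with k by lia. trivial.
    - split; [lra|]. eapply Rbar_le_trans; [|apply (block_Linf_ub chi k u 0)]. simpl. apply Rabs_pos. }
  assert (S1 : 8 / kernel_const * Rabs (RInt (fun y => u y * ker1 N (y - y0)) c (c + 2 * PI)) <= sumN (fun k _ => 2 ^ k / 2 * B k) (N + 6) 0).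
  { assert (S2 : forall n, sumN (fun k _ => 2 ^ k / 2 * B k) (n + 6) 0 = 8 / kernel_const * sumN (fun i _ => Rabs (f i)) n 0).
    { induction n.
      - simpl. unfold B. repeat match goal with |- context [le_lt_dec 6 ?k] => destruct (le_lt_dec 6 k); [lia|] end. ring.
      - simpl sumN. rewrite IHn. unfold B at 1. destruct (le_lt_dec 6 (n + 6)); [|lia].
        replace (n + 6 - 6)%nat with n by lia. unfold b. rewrite INR_pow2n, pow_add. simpl.
        assert (0 < 2 ^ n) by (apply pow_lt; lra). field. lra. }
    rewrite S2. apply Rmult_le_compat_l; [apply Rle_div_r; lra|].
    assert (Ck : forall n, cont1 (fun y => ker1 n (y - y0))).
    { intro n. apply (cont1_comp (ker1 n) (fun y => y - y0)); [auto with cont|apply ker_cont1]. }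
    rewrite (period_shift _ (2 * PI) c 0).
    - rewrite Rplus_0_l. induction N.
      + rewrite (rint_ext _ (fun _ => 0)) by (intro; unfold ker1; simpl; ring). rewrite rint_const, Rmult_0_r, Rabs_R0. simpl; lra.
      + rewrite (rint_ext _ (fun y => u y * ker1 N (y - y0) + u y * psi1 (pow2n N) (y - y0))) by (intro; unfold ker1; simpl; ring).
        assert (cont1 (fun y => u y * ker1 N (y - y0))) by (apply cont1_mult; trivial).
        assert (cont1 (fun y => u y * psi1 (pow2n N) (y - y0))) by (apply cont1_mult; trivial).
        rewrite rint_plus by trivial. eapply Rle_trans; [apply Rabs_triang|]. simpl sumN. fold (f N). lra.
    - apply cont1_mult; trivial.
    - intro x. rewrite Pu. f_equal. replace (x + 2 * PI - y0) with (x - y0 + 2 * PI) by ring. apply ker_periodic. }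
  eapply Rbar_le_trans; [|apply (Sup_seq_minor_le (besov_partial chi u) (sumN (fun k _ => 2 ^ k / 2 * B k) (N + 6) 0) (N + 6)); apply (besov_partial_ge chi u B (N + 6) HB)].
  exact S1.
Qed.

(** Integration by parts moves the derivative from [U] to the kernel, and [y = x + Z x] turns the
    result into an integral of [u] over one period, as [besov_lower] expects. *)
Lemma pairing_eulerian X N (u : R -> R) : admissible X -> slaved X -> (forall x, u (x + X cZ x) = X cU x) -> cont1 u ->
  RInt (fun x => X cw x * ker N (displacement X x)) (- PI) PI =
  - RInt (fun y => u y * ker1 N (y - X cZ 0)) (- PI + X cZ (- PI)) (- PI + X cZ (- PI) + 2 * PI).
Proof.
  intros HX HD Hu Cu. destruct (ker_cont1 N) as [_ [Ck1 _]].
  assert (DD := Dx_derive X HD). assert (Cq : cont1 (X cq)) by apply HX.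
  assert (CD := Dx_cont1 X HD).
  assert (CkD : cont1 (fun x => ker1 N (displacement X x))) by (apply cont1_comp; trivial).
  rewrite (rint_parts (X cU) (fun x => ker N (displacement X x)) (X cw) (fun x => ker1 N (displacement X x) * X cq x)); auto with cont.
  2: intro; apply HD. 2: intro x; apply (der_comp (ker N) (displacement X)); [apply ker_derive|apply DD]. 2: apply HX.
  assert (E1 : X cU PI = X cU (- PI)).
  { rewrite <- (admissible_per X HX cU (- PI)). replace (- PI + 2 * PI) with PI by ring. trivial. }
  assert (E2 : ker N (displacement X PI) = ker N (displacement X (- PI))) by (rewrite Dx_period by trivial; apply ker_periodic).
  rewrite E1, E2, Rminus_diag, Rminus_0_l. f_equal.
  replace (- PI + X cZ (- PI) + 2 * PI) with (PI + X cZ PI).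
  2: { rewrite <- (admissible_per X HX cZ (- PI)). replace (- PI + 2 * PI) with PI by ring. ring. }
  assert (K := rint_subst (fun y => u y * ker1 N (y - X cZ 0)) (fun x => x + X cZ x) (X cq) (- PI) PI).
  cbv beta in K. rewrite <- K; trivial.
  - apply rint_ext. intro x. rewrite Hu. unfold displacement. ring.
  - apply cont1_mult; trivial. apply (cont1_comp (ker1 N) (fun y => y - X cZ 0)); auto with cont.
  - intro x. eapply der_eq; [apply der_plus; [apply der_id|exact (proj1 (HD x))]|ring].
Qed.

(** * Choice of the parameters *)

Lemma exists_large_nat (x : R) : exists n : nat, x <= INR n.
Proof.
  destruct (INR_unbounded x) as [n Hn]. exists n. lra.
Qed.

Lemma pow2n_ge n : (n <= pow2n n)%nat.
Proof. unfold pow2n. apply Nat.lt_le_incl, Nat.pow_gt_lin_r. lia. Qed.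

(** With [s = ln (ln n)], the datum costs three powers of [s] and a fourth absorbs the constants;
    all are beaten by [exp s = ln n]. *)
Lemma exp_quartic s : 0 <= s -> s ^ 4 <= 256 * exp s.
Proof.
  intro Hs. assert (H : s / 4 <= exp (s / 4)).
  { destruct (Req_dec s 0) as [e|e]; [rewrite e; replace (0 / 4) with 0 by field; rewrite exp_0; lra|].
    generalize (exp_ineq1 (s / 4)). lra. }
  assert (E : exp s = exp (s / 4) ^ 4).
  { simpl. rewrite Rmult_1_r, <- !exp_plus. f_equal. field. }
  rewrite E. replace (s ^ 4) with (256 * (s / 4) ^ 4) by field.
  apply Rmult_le_compat_l; [lra|]. apply pow_incr. lra.
Qed.

Theorem theorem1p2 :
  forall chi : R -> R,
    smooth chi ->
    (forall xi, 4 / 3 < Rabs xi -> chi xi = 0) ->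
    (forall xi, Rabs xi <= 3 / 4 -> chi xi = 1) ->
    exists N : nat, forall n : nat, (N <= n)%nat ->
      exists u0 : R -> R,
        H_infty u0 /\
        Rbar_le (besov_B1inf1 chi u0) (Finite (/ ln (ln (INR n)))) /\
        exists (T : R) (u : R -> R -> R),
          0 < T /\ novikov_solution T u0 u /\
          exists t0 : R,
            0 < t0 <= / ln (INR n) /\ t0 < T /\
            Rbar_le (Finite (ln (ln (INR n)))) (besov_B1inf1 chi (u t0)).
Proof.
  intros chi _ Hchi0 Hchi1.
  destruct good_field_uniform as [C [HC HF]].
  destruct (flow_growth C HC HF) as [K [HK Hgrow]].
  (* The lifespan depends only on the constant [C] of the vector field, not on the datum. *)
  set (T := Rmin 1 (/ (8 * C))).
  assert (HT : 0 < T <= 1).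
  { split; [apply Rmin_pos; [lra|apply Rinv_0_lt_compat; lra]|apply Rmin_l]. }
  assert (HTC : 8 * T * C <= 1).
  { assert (T <= / (8 * C)) by apply Rmin_r.
    apply Rle_trans with (8 * C * / (8 * C)); [|right; field; lra]. nra. }
  (* The coefficient of [e ^ 3] in [3 / 64 * b ^ 3] for [b = e / 5]. *)
  set (c0 := 3 / 8000).
  (* Threshold for [ln (ln n)]: the 2 gives [e <= / 2], the second term gives [HKt] with
     [512 = 2 * 256], and the third gives [t0 < T]. *)
  set (s0 := 2 + 512 * K / c0 + 2 / T).
  assert (Hs0 : 0 <= 512 * K / c0 /\ 0 <= 2 / T).
  { split; apply Rmult_le_pos; try lra; left; apply Rinv_0_lt_compat; unfold c0; lra. }
  destruct (exists_large_nat (exp (exp s0))) as [N0 HN0].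
  exists N0. intros n Hn.
  assert (Hnn : exp (exp s0) <= INR n) by (eapply Rle_trans; [exact HN0|apply le_INR; trivial]).
  assert (Hln : exp s0 <= ln (INR n)).
  { rewrite <- (ln_exp (exp s0)). apply Rcomplements.ln_le; [apply exp_pos|trivial]. }
  set (s := ln (ln (INR n))).
  assert (Hs : s0 <= s).
  { rewrite <- (ln_exp s0). apply Rcomplements.ln_le; [apply exp_pos|trivial]. }
  assert (Es : ln (INR n) = exp s).
  { unfold s. rewrite exp_ln; trivial. eapply Rlt_le_trans; [apply exp_pos|exact Hln]. }
  rewrite Es. set (t0 := / exp s).
  assert (Hes := exp_pos s).
  assert (Ht0 : 0 < t0) by (apply Rinv_0_lt_compat; trivial).
  assert (Hs2 : 2 <= s) by (unfold s0 in Hs; lra).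
  assert (Ht0T : t0 < T).
  { assert (2 / T <= s) by (unfold s0 in Hs; lra).
    assert (s < exp s) by (generalize (exp_ineq1 s); lra).
    unfold t0. rewrite <- (Rinv_inv T). apply Rinv_lt_contravar.
    - apply Rmult_lt_0_compat; [apply Rinv_0_lt_compat; lra|trivial].
    - assert (0 < / T) by (apply Rinv_0_lt_compat; lra). unfold Rdiv in *. lra. }
  set (e := / s).
  assert (He : 0 < e <= / 2).
  { split; [apply Rinv_0_lt_compat; lra|apply Rinv_le_contravar; lra]. }
  (* Up to time [t0] the losses linear in [N] consume at most half of the gain. *)
  assert (HKt : K * t0 <= c0 * e ^ 3 / 2).
  { assert (Q := exp_quartic s ltac:(lra)).
    assert (H5 : 512 * K / c0 <= s) by (unfold s0 in Hs; lra).
    assert (H6 : 512 * K <= c0 * s).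
    { replace (512 * K) with (c0 * (512 * K / c0)) by (field; unfold c0; lra). apply Rmult_le_compat_l; [unfold c0; lra|trivial]. }
    assert (Hs3 : 0 < s ^ 3) by (apply pow_lt; lra).
    unfold t0, e. rewrite pow_inv.
    apply Rmult_le_reg_r with (exp s * s ^ 3); [apply Rmult_lt_0_compat; trivial|].
    replace (K * / exp s * (exp s * s ^ 3)) with (K * s ^ 3) by (field; lra).
    replace (c0 * / s ^ 3 / 2 * (exp s * s ^ 3)) with (c0 * exp s / 2) by (field; lra).
    assert (512 * K * s ^ 3 <= c0 * s * s ^ 3) by (apply Rmult_le_compat_r; lra).
    replace (c0 * s * s ^ 3) with (c0 * s ^ 4) in H by ring.
    assert (c0 * s ^ 4 <= c0 * (256 * exp s)) by (apply Rmult_le_compat_l; [unfold c0; lra|trivial]). lra. }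
  (* The datum has norm at most [(1 / 2 + 160 / 45) * b], which is below [5 * b = e]. *)
  set (b := e / 5).
  assert (Hb : 0 <= b <= / 6) by (unfold b; lra).
  assert (He3 : 0 < c0 * e ^ 3 / 2) by (unfold c0; generalize (pow_lt e 3 (proj1 He)); lra).
  (* Now [t0] and [e] are fixed, so [N] can make the remaining half of the gain, accumulated over
     [t0], exceed the target together with all bounded losses. *)
  destruct (exists_large_nat ((s * kernel_const / 8 + 2 * K + 3) / (t0 * (c0 * e ^ 3 / 2)))) as [N HN].
  set (m := (94 * pow2n N)%nat).
  assert (Hm : (1 <= m)%nat) by (unfold m; generalize (pow2n_pos N); lia).
  destruct (initial_pairing N m Hm ltac:(unfold m; lia)) as [Kp [HKp Hpair]].
  destruct (ker_sup N) as [KN [HKN0 HKN]].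
  (* The carrier frequency comes last. It dominates [Kp], and because [d * lam J <= 1] it also makes
     [KN * d ^ 2 <= 1]. *)
  destruct (exists_large_nat (Kp + KN)) as [J0 HJ0].
  set (J := (m + J0)%nat).
  assert (HmJ : (Z.of_nat m <= 2 * Z.of_nat (pow2n J))%Z) by (generalize (pow2n_ge J); unfold J; lia).
  assert (Hlam : Kp + KN <= lam J).
  { unfold lam. assert (INR J0 <= INR (pow2n J)) by (apply le_INR; generalize (pow2n_ge J); unfold J; lia). generalize (pos_INR (pow2n J)). lra. }
  assert (Hl45 := lam_ge J).
  assert (HmJ' : INR m <= lam J).
  { unfold lam. assert (INR m <= INR (pow2n J)) by (apply le_INR; generalize (pow2n_ge J); unfold J; lia). generalize (pos_INR (pow2n J)). lra. }
  destruct (data_small b b m J Hb Hb Hm HmJ) as [Hsm [Hsmo Hsmo']].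
  assert (Cv0 : cont1 (oscd b m J)) by apply Hsm.
  destruct (lagrangian_flow_intro T C _ _ (proj1 HT) HTC HC HF Hsm) as [X HX].
  destruct (lagrangian_to_eulerian T C _ _ X (proj1 HT) Hsmo' Cv0 HX) as [u [Hsol [HuH Hu]]].
  exists (fun x => b + osc b m J x).
  assert (Hosc := fun x => osc_bounds b m J x Hb Hm HmJ').
  split; [split; [apply Hsm|trivial]|split].
  - eapply Rbar_le_trans; [apply (besov_data chi J b (osc b m J) (5 * b / lam J) Hchi0 Hchi1)|].
    + apply osc_trig_poly; trivial. + apply Hosc. + apply Hb.
    + simpl. fold s. fold e. unfold lam. rewrite INR_pow2n.
      assert (0 < 2 ^ J) by (apply pow_lt; lra).
      replace (32 * 2 ^ J * (5 * b / (45 * 2 ^ J))) with (160 / 45 * b) by (field; lra). unfold b. lra.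
  - exists T, u. split; [apply HT|split; [trivial|]].
    exists t0. split; [split; [trivial|unfold t0; lra]|split; [trivial|]].
    destruct (HuH t0 (Rlt_le _ _ Ht0)) as [Pu Su].
    assert (Cu : cont1 (u t0)) by (eapply cont1_derive; intro x; apply Derive_correct; apply (Su 0%nat)).
    assert (HX' := HX). destruct HX' as [Hok [Hsl _]].
    eapply Rbar_le_trans; [|apply (besov_lower chi (u t0) N (X t0 cZ 0) (- PI + X t0 cZ (- PI)) Hchi0 Hchi1 Cu Pu)].
    simpl. fold s.
    rewrite <- Rabs_Ropp, <- (pairing_eulerian (X t0) N (u t0) (proj1 Hok t0) (Hsl t0) (Hu t0) Cu).
    set (d := 5 * b / lam J).
    assert (Hd : 0 <= d) by (apply Rmult_le_pos; [lra|left; apply Rinv_0_lt_compat; lra]).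
    assert (Hd1 : d * lam J <= 1) by (unfold d; replace (5 * b / lam J * lam J) with (5 * b) by (field; lra); lra).
    assert (Ha : forall x, Rabs (b + osc b m J x - b) <= d).
    { intro x. replace (b + osc b m J x - b) with (osc b m J x) by ring. apply Hosc. }
    assert (G := Hgrow T _ _ X b d N KN HT HX Hd Ha (fun y => proj2 (proj2 (HKN y))) t0 ltac:(lra)).
    destruct (Hpair b b J Hb Hb HmJ) as [G1 G2].
    set (I1 := RInt _ _ _) in G at 1. set (I2 := RInt _ _ _) in G at 1. set (I3 := RInt _ _ _) in G at 1.
    change (s <= 8 / kernel_const * Rabs I3).
    change (3 / 64 * (b * b ^ 2) * INR N - Kp / lam J <= I2) in G1. change (- (Kp / lam J) <= I1) in G2.
    assert (HKl : Kp / lam J <= 1) by (apply Rle_div_l; lra).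
    assert (HKd : KN * d ^ 2 <= 1).
    { assert (d <= 1) by nra. assert (KN * d <= 1) by nra. simpl. assert (0 <= KN * d) by nra. nra. }
    assert (Eb : 3 / 64 * (b * b ^ 2) = c0 * e ^ 3) by (unfold b, c0; field).
    rewrite Eb in G1.
    assert (HkC : 0 < kernel_const) by (unfold kernel_const; lra).
    assert (HNt : s * kernel_const / 8 + 2 * K + 3 <= INR N * (t0 * (c0 * e ^ 3 / 2))).
    { apply Rle_div_l; [apply Rmult_lt_0_compat; trivial|exact HN]. }
    assert (G4 : K * (INR N * t0) <= INR N * (c0 * e ^ 3 / 2)).
    { generalize (pos_INR N). nra. }
    assert (G5 : c0 * e ^ 3 * INR N - 1 - INR N * (c0 * e ^ 3 / 2) - 2 * K <= I2 - K * (INR N * t0 + 1 + KN * d ^ 2)) by nra.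
    assert (G6 : t0 * (c0 * e ^ 3 * INR N - 1 - INR N * (c0 * e ^ 3 / 2) - 2 * K) <= t0 * (I2 - K * (INR N * t0 + 1 + KN * d ^ 2))) by (apply Rmult_le_compat_l; lra).
    assert (G7 : s * kernel_const / 8 <= I3) by nra.
    apply Rle_trans with (8 / kernel_const * (s * kernel_const / 8)); [right; field; lra|].
    apply Rmult_le_compat_l; [apply Rle_div_r; lra|]. generalize (Rle_abs I3). lra.
Qed.
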